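(* Let $\mathfrak g=\mathfrak g_{\bar 0}\oplus\mathfrak g_{\bar 1}$ be a finite-dimensional solvable Lie superalgebra over $\mathbb C$. With the notation $L$, $f_\lambda$, polarization, $\theta_{\mathfrak h}$, $I(\lambda)$, $Z$, $\sim$, $\Pi$, $G$-type, $Q$-type of the context, the following hold. 1) Every irreducible finite-dimensional representation of $\mathfrak g$ is isomorphic, up to application of the change of parity functor $\Pi$, to a representation of the form $I(\lambda)$ for some $\lambda$. 2) The map $\lambda\mapsto I(\lambda)$ is (up to $\Pi$) a one-to-one correspondence between elements of $L$ and the irreducible finite-dimensional representations of $\mathfrak g$. 3) Let $(\lambda,\mathfrak h),(\mu,\mathfrak t)\in Z$. Then $\operatorname{Ind}^{\mathfrak g}_{\mathfrak h}(\lambda)\cong\operatorname{Ind}^{\mathfrak g}_{\mathfrak t}(\mu)$ if and only if $(\lambda,\mathfrak h)\sim(\mu,\mathfrak t)$. 4) If $\operatorname{rk} f_\lambda$ is even, then $I(\lambda)$ is a $G$-type representation; if $\operatorname{rk} f_\lambda$ is odd, then $I(\lambda)$ is a $Q$-type representation.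
   Context: All modules and superalgebras are finite-dimensional over $\mathbb C$. $L=\{\lambda\in\mathfrak g^*:\lambda(\mathfrak g_{\bar 1})=0,\ \lambda([\mathfrak g_{\bar 0},\mathfrak g_{\bar 0}])=0\}$. For $\lambda\in L$, $f_\lambda$ is the symmetric bilinear form on $\mathfrak g_{\bar 1}$ given by $f_\lambda(\xi_1,\xi_2)=\lambda([\xi_1,\xi_2])$. A subalgebra (subsuperalgebra) $\mathfrak h\subset\mathfrak g$ is a polarization for $\lambda\in L$ if $\lambda([\mathfrak h,\mathfrak h])=0$, $\mathfrak h\supset\mathfrak g_{\bar 0}$, and $\mathfrak h_{\bar 1}$ is a maximal isotropic subspace for $f_\lambda$; a polarization exists for every $\lambda\in L$. If $\lambda([\mathfrak h,\mathfrak h])=0$, then $\lambda$ also denotes the $(1,0)$-dimensional $\mathfrak h$-module it determines, and $\operatorname{Ind}^{\mathfrak g}_{\mathfrak h}(\lambda)=U(\mathfrak g)\otimes_{U(\mathfrak h)}\lambda$. For a Lie subsuperalgebra $\mathfrak h\supset\mathfrak g_{\bar 0}$ define $\theta_{\mathfrak h}\in L$ by $\theta_{\mathfrak h}(g)=\tfrac12\operatorname{str}_{\mathfrak g/\mathfrak h}(\operatorname{ad} g)$ for $g\in\mathfrak g_{\bar 0}$ and $\theta_{\mathfrak h}(g)=0$ for $g\in\mathfrak g_{\bar 1}$, where $\operatorname{str}$ is the supertrace. For a polarization $\mathfrak h$ for $\lambda\in L$ set $I^{\mathfrak g}_{\mathfrak h}(\lambda)=\operatorname{Ind}^{\mathfrak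 g}_{\mathfrak h}(\lambda+\theta_{\mathfrak h})=U(\mathfrak g)\otimes_{U(\mathfrak h)}(\lambda+\theta_{\mathfrak h})$. The module $I^{\mathfrak g}_{\mathfrak h}(\lambda)$ does not depend on the choice of the polarization $\mathfrak h$; $I(\lambda)$ denotes $I^{\mathfrak g}_{\mathfrak h}(\lambda)$ for some polarization $\mathfrak h$ for $\lambda$. $Z=\{(\lambda,\mathfrak h):\lambda\in L,\ \mathfrak h\text{ is a polarization for }\lambda\}$, with the equivalence relation $(\lambda,\mathfrak h)\sim(\mu,\mathfrak t)\iff\lambda-\theta_{\mathfrak h}=\mu-\theta_{\mathfrak t}$. $\Pi$ is the change of parity functor. A representation is irreducible of $G$-type if it has no nontrivial proper invariant subspaces (graded or not); it is irreducible of $Q$-type if it has no nontrivial proper invariant subsuperspaces (graded subspaces) but does have a nontrivial proper invariant non-graded subspace.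
   Formalization: In part 3, ≅ is read as isomorphism up to the change of parity functor Π, as in parts 1 and 2; with parity-preserving isomorphisms it fails for g spanned by z (even), ξ, η (odd) with [ξ,η]=z, λ(z)=1, h=⟨z,ξ⟩, t=⟨z,η⟩, where the two induced modules differ by Π. *)

(* Defs.v *)
From HB Require Import structures.
From mathcomp Require Import all_boot all_order all_algebra.
From mathcomp Require Import boolp classical_sets.

Set Implicit Arguments.
Unset Strict Implicit.
Unset Printing Implicit Defensive.

Import Order.TTheory GRing.Theory Num.Theory.
Local Open Scope ring_scope.
Local Open Scope quotient_scope.

(* The degrees 0 and 1 of Z/2 are the booleans false and true; addition of
   degrees is addb, and (-1) ^+ (a && b) is the sign (-1)^(ab). *)

Record lieSuperalg (F : numFieldType) := LieSuperalg {
  lsa_sort :> vectType F;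
  gr : bool -> {vspace lsa_sort};
  br : lsa_sort -> lsa_sort -> lsa_sort;
  gr_cap : (gr false :&: gr true = 0)%VS;
  gr_add : (gr false + gr true = fullv)%VS;
  br_linr : forall x, linear (br x);
  br_linl : forall y, linear (br^~ y);
  br_gr : forall a b x y, x \in gr a -> y \in gr b -> br x y \in gr (a (+) b);
  br_anti : forall a b x y, x \in gr a -> y \in gr b ->
    br x y = - ((-1) ^+ (a && b) *: br y x);
  br_jacobi : forall a b x y z, x \in gr a -> y \in gr b ->
    br x (br y z) = br (br x y) z + (-1) ^+ (a && b) *: br y (br x z)
}.
Arguments gr {F} g a : rename.
Arguments br {F g} x y : rename.

Section LieSuperalgebra.
Variables (F : numFieldType) (g : lieSuperalg F).
Implicit Types (x y : g) (h U V : {vspace g}) (l : 'Hom(g, F^o)).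

Definition brv U V : {vspace g} :=
  <<[seq br x y | x <- vbasis U, y <- vbasis V]>>%VS.

Definition solvable_lsa : Prop :=
  exists n, iter n (fun U => brv U U) fullv = 0%VS.

Definition subalg h : Prop :=
  h = (h :&: gr g false + h :&: gr g true)%VS /\
  (forall x y, x \in h -> y \in h -> br x y \in h).

Definition inL l : Prop :=
  (forall x, x \in gr g true -> l x = 0) /\
  (forall x y, x \in gr g false -> y \in gr g false -> l (br x y) = 0).

Definition fform l x y : F := l (br x y).

Definition rk_fform l : nat :=
  \rank (\matrix_(i < \dim (gr g true), j < \dim (gr g true))
    fform l (vbasis (gr g true))`_i (vbasis (gr g true))`_j).

Definition isotropic l U : Prop :=
  (U <= gr g true)%VS /\ (forall x y, x \in U -> y \in U -> fform l x y = 0).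

Definition max_isotropic l U : Prop :=
  isotropic l U /\ (forall V, isotropic l V -> (U <= V)%VS -> V = U).

Definition polarization l h : Prop :=
  [/\ subalg h,
      forall x y, x \in h -> y \in h -> l (br x y) = 0,
      (gr g false <= h)%VS
    & max_isotropic l (h :&: gr g true)%VS].

(* The trace of the endomorphism of U / (U :&: h) induced by f, computed on the
   complement U :\: h of U :&: h in U; addv_pi1 U h is the projection of U + h
   onto this complement along h. *)
Definition trq U h (f : g -> g) : F :=
  \sum_(i < \dim (U :\: h))
     coord (vbasis (U :\: h)) i (addv_pi1 U h (f (vbasis (U :\: h))`_i)).

Definition str_ad h x : F :=
  trq (gr g false) h (br x) - trq (gr g true) h (br x).

Definition even_part x : g := daddv_pi (gr g false) (gr g true) x.
Definition odd_part x : g := daddv_pi (gr g true) (gr g false) x.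

Definition theta h : 'Hom(g, F^o) :=
  linfun (fun x => 2^-1 * str_ad h (even_part x) : F^o).

Lemma brDr x y z : br x (y + z) = br x y + br x z.
Proof. by have := br_linr x 1 y z; rewrite !scale1r. Qed.
Lemma brDl x y z : br (x + y) z = br x z + br y z.
Proof. by have := br_linl z 1 x y; rewrite !scale1r. Qed.
Lemma br0r x : br x 0 = 0.
Proof. by apply: (addrI (br x 0)); rewrite -brDr !addr0. Qed.
Lemma br0l x : br 0 x = 0.
Proof. by apply: (addrI (br 0 x)); rewrite -brDl !addr0. Qed.
Lemma brZr c x y : br x (c *: y) = c *: br x y.
Proof. by have := br_linr x c y 0; rewrite br0r !addr0. Qed.
Lemma brZl c x y : br (c *: x) y = c *: br x y.
Proof. by have := br_linl y c x 0; rewrite br0l !addr0. Qed.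

Lemma trq_linear U h (a : F) (f1 f2 : g -> g) :
  trq U h (fun z => a *: f1 z + f2 z) = a * trq U h f1 + trq U h f2.
Proof.
rewrite /trq mulr_sumr -big_split /=; apply: eq_bigr => i _.
by rewrite !linearP.
Qed.

Lemma theta_subproof h :
  linear (fun x => 2^-1 * str_ad h (even_part x) : F^o).
Proof.
move=> a x y; rewrite /even_part linearP /str_ad.
set u := daddv_pi _ _ x; set v := daddv_pi _ _ y.
have E W : trq W h (br (a *: u + v)) = a * trq W h (br u) + trq W h (br v).
  rewrite -trq_linear /trq; apply: eq_bigr => i _.
  by rewrite brDl brZl.
rewrite !E /GRing.scale /= mulrCA -mulrDr; congr (_ * _).
by rewrite mulrBr addrACA opprD.
Qed.

Lemma thetaE h x : theta h x = 2^-1 * str_ad h (even_part x).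
Proof.
pose fl := GRing.isLinear.Build F g F^o *:%R _ (theta_subproof h).
pose f : {linear g -> F^o} := HB.pack (fun x => 2^-1 * str_ad h (even_part x) : F^o) fl.
by rewrite /theta -[LHS]/(linfun f x) lfunE.
Qed.

Lemma even_part_in x : even_part x \in gr g false.
Proof. exact: memv_pi. Qed.
Lemma odd_part_in x : odd_part x \in gr g true.
Proof. exact: memv_pi. Qed.
Lemma gr_capC : (gr g true :&: gr g false = 0)%VS.
Proof. by rewrite capvC gr_cap. Qed.
Lemma even_odd_part x : x = even_part x + odd_part x.
Proof. by rewrite /even_part /odd_part daddv_pi_add ?gr_cap // gr_add memvf. Qed.
Lemma even_part_id x : x \in gr g false -> even_part x = x.
Proof. by move=> hx; rewrite /even_part daddv_pi_id ?gr_cap. Qed.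
Lemma odd_part_id x : x \in gr g true -> odd_part x = x.
Proof. by move=> hx; rewrite /odd_part daddv_pi_id ?gr_capC. Qed.
Lemma even_part0 x : x \in gr g true -> even_part x = 0.
Proof.
move=> hx; have := even_odd_part x; rewrite (odd_part_id hx) => /eqP.
by rewrite -subr_eq subrr eq_sym => /eqP.
Qed.
Lemma odd_part0 x : x \in gr g false -> odd_part x = 0.
Proof.
move=> hx; have := even_odd_part x; rewrite (even_part_id hx) => /eqP.
by rewrite addrC -subr_eq subrr eq_sym => /eqP.
Qed.

End LieSuperalgebra.

(* Supermodules; the dimension is not part of the structure, see fin_dim. *)
Record supermod (F : numFieldType) (g : lieSuperalg F) := SuperMod {
  smod_sort :> lmodType F;
  mgr : bool -> smod_sort -> Prop;
  act : g -> smod_sort -> smod_sort;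
  mgr0 : forall a, mgr a 0;
  mgrP : forall a c u v, mgr a u -> mgr a v -> mgr a (c *: u + v);
  mgr_cap : forall u, mgr false u -> mgr true u -> u = 0;
  mgr_add : forall u, exists u0 u1, [/\ mgr false u0, mgr true u1 & u = u0 + u1];
  act_linr : forall x, linear (act x);
  act_linl : forall u, linear (act^~ u);
  act_mgr : forall a b x u, x \in gr g a -> mgr b u -> mgr (a (+) b) (act x u);
  act_br : forall a b x y u, x \in gr g a -> y \in gr g b ->
    act (br x y) u = act x (act y u) - (-1) ^+ (a && b) *: act y (act x u)
}.
Arguments mgr {F g} M a u : rename.
Arguments act {F g M} x u : rename.

Section Supermodules.
Variables (F : numFieldType) (g : lieSuperalg F).
Implicit Types M N : supermod g.

Definition fin_dim M : Prop :=
  exists n (b : 'I_n -> M), forall u, exists c : 'I_n -> F,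
    u = \sum_i c i *: b i.

Definition inv_subspace M (W : M -> Prop) : Prop :=
  [/\ W 0,
      forall c u v, W u -> W v -> W (c *: u + v)
    & forall x u, W u -> W (act x u)].

Definition graded_subspace M (W : M -> Prop) : Prop :=
  forall u0 u1, mgr M false u0 -> mgr M true u1 -> W (u0 + u1) -> W u0 /\ W u1.

Definition nontrivial_proper M (W : M -> Prop) : Prop :=
  (exists2 u, W u & u != 0) /\ (exists u, ~ W u).

Definition irreducible M : Prop :=
  (exists u : M, u != 0) /\
  forall W : M -> Prop, inv_subspace W -> graded_subspace W ->
    ~ nontrivial_proper W.

Definition G_type M : Prop :=
  (exists u : M, u != 0) /\
  forall W : M -> Prop, inv_subspace W -> ~ nontrivial_proper W.

Definition Q_type M : Prop :=
  irreducible M /\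
  exists W : M -> Prop,
    [/\ inv_subspace W, ~ graded_subspace W & nontrivial_proper W].

Definition smod_iso M N : Prop :=
  exists f : {linear M -> N},
    [/\ bijective f,
        forall a u, mgr M a u -> mgr N a (f u)
      & forall x u, f (act x u) = act x (f u)].

Section Parity.
Variable M : supermod g.

Lemma Pi_cap (u : M) : mgr M (~~ false) u -> mgr M (~~ true) u -> u = 0.
Proof. by move=> h1 h0; apply: (mgr_cap h0 h1). Qed.

Lemma Pi_add (u : M) : exists u0 u1,
  [/\ mgr M (~~ false) u0, mgr M (~~ true) u1 & u = u0 + u1].
Proof.
have [u0 [u1 [h0 h1 ->]]] := mgr_add u.
by exists u1, u0; split=> //; rewrite addrC.
Qed.

Lemma Pi_act a b (x : g) (u : M) :
  x \in gr g a -> mgr M (~~ b) u -> mgr M (~~ (a (+) b)) (act x u).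
Proof. by move=> hx hu; rewrite -addbN; apply: act_mgr. Qed.

(* The convention in which x acts on the degree-shifted module by the sign
   (-1)^|x| gives an isomorphic module, through u |-> (-1)^|u| u. *)
Definition Pi : supermod g :=
  SuperMod (fun a => @mgr0 F g M (~~ a)) (fun a => @mgrP F g M (~~ a))
    Pi_cap Pi_add (@act_linr F g M) (@act_linl F g M) Pi_act (@act_br F g M).
End Parity.

Definition smod_iso_Pi M N : Prop := smod_iso M N \/ smod_iso M (Pi N).

End Supermodules.

Section Enveloping.
Variables (F : numFieldType) (g : lieSuperalg F).

(* U(g), as the unital associative algebra generated by the vector space g
   with the relations xy - (-1)^(ab) yx = [x, y], x and y homogeneous of
   degrees a and b: terms UGen x (a generator) and UScal c (the scalar c.1),
   modulo the congruence ueq. *)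
Inductive uterm : Type :=
  | UGen of g
  | UScal of F
  | UAdd of uterm & uterm
  | UMul of uterm & uterm.

Inductive ueq : uterm -> uterm -> Prop :=
  | ueq_refl s : ueq s s
  | ueq_sym s t : ueq s t -> ueq t s
  | ueq_trans s t r : ueq s t -> ueq t r -> ueq s r
  | ueq_add s s' t t' : ueq s s' -> ueq t t' -> ueq (UAdd s t) (UAdd s' t')
  | ueq_mul s s' t t' : ueq s s' -> ueq t t' -> ueq (UMul s t) (UMul s' t')
  | ueq_addA r s t : ueq (UAdd r (UAdd s t)) (UAdd (UAdd r s) t)
  | ueq_addC s t : ueq (UAdd s t) (UAdd t s)
  | ueq_add0 s : ueq (UAdd (UScal 0) s) s
  | ueq_mulA r s t : ueq (UMul r (UMul s t)) (UMul (UMul r s) t)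
  | ueq_mul1l s : ueq (UMul (UScal 1) s) s
  | ueq_mul0l s : ueq (UMul (UScal 0) s) (UScal 0)
  | ueq_mulDl r s t : ueq (UMul (UAdd r s) t) (UAdd (UMul r t) (UMul s t))
  | ueq_mulDr r s t : ueq (UMul r (UAdd s t)) (UAdd (UMul r s) (UMul r t))
  | ueq_scalD c d : ueq (UScal (c + d)) (UAdd (UScal c) (UScal d))
  | ueq_scalM c d : ueq (UScal (c * d)) (UMul (UScal c) (UScal d))
  | ueq_scalC c s : ueq (UMul (UScal c) s) (UMul s (UScal c))
  | ueq_genD x y : ueq (UGen (x + y)) (UAdd (UGen x) (UGen y))
  | ueq_genZ c x : ueq (UGen (c *: x)) (UMul (UScal c) (UGen x))
  | ueq_br a b x y : x \in gr g a -> y \in gr g b ->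
      ueq (UMul (UGen x) (UGen y))
          (UAdd (UGen (br x y))
                (UMul (UScal ((-1) ^+ (a && b))) (UMul (UGen y) (UGen x)))).

HB.instance Definition _ := gen_eqMixin uterm.
HB.instance Definition _ := gen_choiceMixin uterm.

Definition ueqb : rel uterm := fun s t => `[< ueq s t >].

Lemma ueqb_equiv : equiv_class_of ueqb.
Proof.
split=> [s|s t|t s r].
- exact/asboolP/ueq_refl.
- by apply/asboolP/asboolP; apply: ueq_sym.
- by move=> /asboolP h1 /asboolP h2; apply/asboolP; apply: ueq_trans h1 h2.
Qed.

Canonical ueqb_equiv_rel := EquivRelPack ueqb_equiv.

Definition Ug : Type := {eq_quot ueqb}.
HB.instance Definition _ := Choice.on Ug.
HB.instance Definition _ := EqQuotient.on Ug.

Definition upi (t : uterm) : Ug := \pi_Ug t.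

Lemma upiP s t : ueq s t <-> upi s = upi t.
Proof.
split=> [h|]; first by apply/eqquotP/asboolP.
by move/eqquotP/asboolP.
Qed.

Lemma ueq_repr t : ueq (repr (upi t)) t.
Proof. by apply/upiP; rewrite /upi reprK. Qed.

Lemma Ug_ind (P : Ug -> Prop) : (forall t, P (upi t)) -> forall u, P u.
Proof. by move=> h u; rewrite -[u]reprK. Qed.

Definition uadd (u v : Ug) : Ug := upi (UAdd (repr u) (repr v)).
Definition umul (u v : Ug) : Ug := upi (UMul (repr u) (repr v)).
Definition uscal (c : F) : Ug := upi (UScal c).

Lemma uaddE s t : uadd (upi s) (upi t) = upi (UAdd s t).
Proof. by apply/upiP/ueq_add; apply: ueq_repr. Qed.
Lemma umulE s t : umul (upi s) (upi t) = upi (UMul s t).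
Proof. by apply/upiP/ueq_mul; apply: ueq_repr. Qed.

Lemma uaddA : associative uadd.
Proof.
elim/Ug_ind=> r; elim/Ug_ind=> s; elim/Ug_ind=> t; rewrite !uaddE.
exact/upiP/ueq_addA.
Qed.
Lemma uaddC : commutative uadd.
Proof. by elim/Ug_ind=> r; elim/Ug_ind=> s; rewrite !uaddE; apply/upiP/ueq_addC. Qed.
Lemma uadd0 : left_id (uscal 0) uadd.
Proof. by elim/Ug_ind=> r; rewrite !uaddE; apply/upiP/ueq_add0. Qed.
Lemma umulA : associative umul.
Proof.
elim/Ug_ind=> r; elim/Ug_ind=> s; elim/Ug_ind=> t; rewrite !umulE.
exact/upiP/ueq_mulA.
Qed.
Lemma umul1l : left_id (uscal 1) umul.
Proof. by elim/Ug_ind=> r; rewrite !umulE; apply/upiP/ueq_mul1l. Qed.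
Lemma umul0l u : umul (uscal 0) u = uscal 0.
Proof. by elim/Ug_ind: u => r; rewrite !umulE; apply/upiP/ueq_mul0l. Qed.
Lemma uscalC c u : umul (uscal c) u = umul u (uscal c).
Proof. by elim/Ug_ind: u => r; rewrite !umulE; apply/upiP/ueq_scalC. Qed.
Lemma umul1r : right_id (uscal 1) umul.
Proof. by move=> u; rewrite -uscalC umul1l. Qed.
Lemma umulDl : left_distributive umul uadd.
Proof.
elim/Ug_ind=> r; elim/Ug_ind=> s; elim/Ug_ind=> t; rewrite !(umulE, uaddE).
exact/upiP/ueq_mulDl.
Qed.
Lemma umulDr : right_distributive umul uadd.
Proof.
elim/Ug_ind=> r; elim/Ug_ind=> s; elim/Ug_ind=> t; rewrite !(umulE, uaddE).
exact/upiP/ueq_mulDr.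
Qed.
Lemma uscalD c d : uscal (c + d) = uadd (uscal c) (uscal d).
Proof. by rewrite uaddE; apply/upiP/ueq_scalD. Qed.
Lemma uscalM c d : uscal (c * d) = umul (uscal c) (uscal d).
Proof. by rewrite umulE; apply/upiP/ueq_scalM. Qed.

Definition uopp (u : Ug) : Ug := umul (uscal (-1)) u.
Lemma uaddN : left_inverse (uscal 0) uopp uadd.
Proof.
move=> u; rewrite /uopp -{2}[u]umul1l -umulDl -uscalD addNr; exact: umul0l.
Qed.

HB.instance Definition _ :=
  GRing.isZmodule.Build Ug uaddA uaddC uadd0 uaddN.

Section Lift.
Variables (A : algType F) (f : {linear g -> A}).
Hypothesis f_br : forall a b x y, x \in gr g a -> y \in gr g b ->
  f x * f y = f (br x y) + (-1) ^+ (a && b) *: (f y * f x).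

Fixpoint ueval (t : uterm) : A :=
  match t with
  | UGen x => f x
  | UScal c => c%:A
  | UAdd s t => ueval s + ueval t
  | UMul s t => ueval s * ueval t
  end.

Lemma ueval_ueq s t : ueq s t -> ueval s = ueval t.
Proof.
elim=> //=.
- by move=> r t' q _ -> _ ->.
- by move=> r r' t' q _ -> _ ->.
- by move=> r r' t' q _ -> _ ->.
- by move=> *; rewrite addrA.
- by move=> *; rewrite addrC.
- by move=> *; rewrite scale0r add0r.
- by move=> *; rewrite mulrA.
- by move=> *; rewrite scale1r mul1r.
- by move=> *; rewrite scale0r mul0r.
- by move=> *; rewrite mulrDl.
- by move=> *; rewrite mulrDr.
- by move=> *; rewrite scalerDl.
- by move=> *; rewrite -scalerAl mul1r scalerA.
- by move=> *; rewrite -scalerAl -scalerAr mul1r mulr1.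
- by move=> *; rewrite linearD.
- by move=> *; rewrite linearZ -scalerAl mul1r.
- by move=> a b x y hx hy; rewrite (f_br hx hy) -scalerAl mul1r.
Qed.

Definition ulift (u : Ug) : A := ueval (repr u).

Lemma uliftE t : ulift (upi t) = ueval t.
Proof. exact/ueval_ueq/ueq_repr. Qed.

End Lift.

Lemma uscal1_neq0 : uscal 1 != 0 :> Ug.
Proof.
pose f : {linear g -> F^o} := \0.
have f_br a b x y : x \in gr g a -> y \in gr g b ->
    f x * f y = f (br x y) + (-1) ^+ (a && b) *: (f y * f x).
  by rewrite /= !mulr0 scaler0 addr0.
apply/eqP => /upiP /(ueval_ueq f_br) /= /eqP.
by rewrite scale1r scale0r oner_eq0.
Qed.

HB.instance Definition _ :=
  GRing.Zmodule_isNzRing.Build Ug umulA umul1l umul1r umulDl umulDr uscal1_neq0.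

Definition uscale (c : F) (u : Ug) : Ug := uscal c * u.

Lemma uscaleA c d u : uscale c (uscale d u) = uscale (c * d) u.
Proof. by rewrite /uscale mulrA; congr (_ * _); rewrite uscalM. Qed.
Lemma uscale1 : left_id 1 uscale.
Proof. by move=> u; apply: umul1l. Qed.
Lemma uscaleDr : right_distributive uscale +%R.
Proof. by move=> c u v; apply: mulrDr. Qed.
Lemma uscaleDl u : {morph uscale^~ u : c d / c + d}.
Proof. by move=> c d; rewrite /uscale uscalD; apply: mulrDl. Qed.

HB.instance Definition _ :=
  GRing.Zmodule_isLmodule.Build F Ug uscaleA uscale1 uscaleDr uscaleDl.

Lemma uscaleAl (c : F) (u v : Ug) : c *: (u * v) = (c *: u) * v.
Proof. exact: mulrA. Qed.
HB.instance Definition _ := GRing.Lmodule_isLalgebra.Build F Ug uscaleAl.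

Lemma uscaleAr (c : F) (u v : Ug) : c *: (u * v) = u * (c *: v).
Proof.
rewrite -[LHS]/(uscal c * (u * v)) -[c *: v]/(uscal c * v) !mulrA.
by congr (_ * _); apply: uscalC.
Qed.
HB.instance Definition _ := GRing.Lalgebra_isAlgebra.Build F Ug uscaleAr.

Definition iota (x : g) : Ug := upi (UGen x).

Lemma iota_linear : linear iota.
Proof.
move=> c x y; rewrite -[RHS]/(uadd (umul (uscal c) (iota x)) (iota y)).
rewrite umulE uaddE; apply/upiP.
apply: ueq_trans (ueq_genD _ _) _; apply: ueq_add (ueq_refl _).
exact: ueq_genZ.
Qed.
HB.instance Definition _ := GRing.isLinear.Build F g Ug *:%R iota iota_linear.

Lemma iota_br a b x y : x \in gr g a -> y \in gr g b ->
  iota (br x y) = iota x * iota y - (-1) ^+ (a && b) *: (iota y * iota x).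
Proof.
move=> hx hy; apply/eqP; rewrite eq_sym subr_eq; apply/eqP.
rewrite -[LHS]/(umul (iota x) (iota y)).
rewrite -[RHS]/(uadd (iota (br x y))
  (umul (uscal ((-1) ^+ (a && b))) (umul (iota y) (iota x)))).
by rewrite (umulE (UGen y)) !umulE uaddE; apply/upiP; apply: ueq_br hx hy.
Qed.

(* The grading of U(g) for which iota preserves degrees. *)
Inductive udeg : bool -> Ug -> Prop :=
  | udeg_iota a x : x \in gr g a -> udeg a (iota x)
  | udeg_0 a : udeg a 0
  | udeg_1 : udeg false 1
  | udeg_lin a c u v : udeg a u -> udeg a v -> udeg a (c *: u + v)
  | udeg_mul a b u v : udeg a u -> udeg b v -> udeg (a (+) b) (u * v).


Lemma udegD a u v : udeg a u -> udeg a v -> udeg a (u + v).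
Proof. by move=> hu hv; rewrite -[u]scale1r; apply: udeg_lin. Qed.

Lemma udegZ a c u : udeg a u -> udeg a (c *: u).
Proof. by move=> hu; rewrite -[_ *: _]addr0; apply: udeg_lin hu (udeg_0 a). Qed.

Lemma udeg_decomp u : exists u0 u1, [/\ udeg false u0, udeg true u1 & u = u0 + u1].
Proof.
elim/Ug_ind: u; elim.
- move=> x; exists (iota (even_part x)), (iota (odd_part x)); split.
  + exact/udeg_iota/even_part_in.
  + exact/udeg_iota/odd_part_in.
  + by rewrite -linearD -even_odd_part.
- move=> c; exists (c *: 1), 0; split.
  + exact/udegZ/udeg_1.
  + exact: udeg_0.
  + by rewrite addr0 -[RHS]/(uscal c * 1) mulr1.
- move=> s [s0 [s1 [hs0 hs1 es]]] t [t0 [t1 [ht0 ht1 et]]].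
  exists (s0 + t0), (s1 + t1); split; [exact: udegD | exact: udegD |].
  by rewrite -uaddE -[LHS]/(upi s + upi t) es et addrACA.
- move=> s [s0 [s1 [hs0 hs1 es]]] t [t0 [t1 [ht0 ht1 et]]].
  exists (s0 * t0 + s1 * t1), (s0 * t1 + s1 * t0); split.
  + by apply: udegD; [apply: (udeg_mul hs0 ht0) | apply: (udeg_mul hs1 ht1)].
  + by apply: udegD; [apply: (udeg_mul hs0 ht1) | apply: (udeg_mul hs1 ht0)].
  + rewrite -umulE -[LHS]/(upi s * upi t) es et mulrDl !mulrDr.
    by rewrite [s1 * t0 + _]addrC addrACA.
Qed.

Definition sgn_lsa (x : g) : g := even_part x - odd_part x.

Lemma sgn_lsaE a x : x \in gr g a -> sgn_lsa x = (-1) ^+ a *: x.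
Proof.
case: a => hx; rewrite /sgn_lsa.
  by rewrite (even_part0 hx) (odd_part_id hx) add0r expr1 scaleN1r.
by rewrite (odd_part0 hx) (even_part_id hx) subr0 expr0 scale1r.
Qed.

Definition iota_sgn (x : g) : Ug := iota (sgn_lsa x).

Lemma iota_sgn_linear : linear iota_sgn.
Proof.
move=> c x y; rewrite /iota_sgn -linearP; congr iota.
have pP : even_part (c *: x + y) = c *: even_part x + even_part y.
  exact: linearP.
have qP : odd_part (c *: x + y) = c *: odd_part x + odd_part y.
  exact: linearP.
by rewrite /sgn_lsa pP qP opprD addrACA -scalerBr.
Qed.
HB.instance Definition _ :=
  GRing.isLinear.Build F g Ug *:%R iota_sgn iota_sgn_linear.

Lemma iota_sgn_br a b x y : x \in gr g a -> y \in gr g b ->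
  iota_sgn x * iota_sgn y =
    iota_sgn (br x y) + (-1) ^+ (a && b) *: (iota_sgn y * iota_sgn x).
Proof.
move=> hx hy; rewrite /iota_sgn /= (sgn_lsaE hx) (sgn_lsaE hy).
rewrite (sgn_lsaE (br_gr hx hy)) !linearZ /= -!scalerAl -!scalerAr !scalerA.
have -> : iota x * iota y =
    iota (br x y) + (-1) ^+ (a && b) *: (iota y * iota x).
  by rewrite (iota_br hx hy) subrK.
rewrite scalerDr scalerA -signr_addb; congr (_ + _ *: _).
by rewrite signr_addb mulrC [(-1) ^+ a * _]mulrC mulrA.
Qed.

Definition usgn (u : Ug) : Ug := ulift iota_sgn u.

Lemma usgnD u v : usgn (u + v) = usgn u + usgn v.
Proof.
elim/Ug_ind: u => s; elim/Ug_ind: v => t.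
by rewrite -[_ + _]/(uadd _ _) uaddE /usgn !(uliftE iota_sgn_br).
Qed.

Lemma usgnM u v : usgn (u * v) = usgn u * usgn v.
Proof.
elim/Ug_ind: u => s; elim/Ug_ind: v => t.
by rewrite -[_ * _]/(umul _ _) umulE /usgn !(uliftE iota_sgn_br).
Qed.

Lemma usgnZ c u : usgn (c *: u) = c *: usgn u.
Proof.
rewrite -[c *: u]/(uscal c * u) usgnM [usgn (uscal c)](uliftE iota_sgn_br) /=.
by rewrite -scalerAl mul1r.
Qed.

Lemma usgn_iota x : usgn (iota x) = iota (sgn_lsa x).
Proof. by rewrite /usgn (uliftE iota_sgn_br). Qed.

Lemma usgn_udeg a u : udeg a u -> usgn u = (-1) ^+ a *: u.
Proof.
elim=> {a u}.
- by move=> a x hx; rewrite usgn_iota (sgn_lsaE hx) linearZ.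
- by move=> a; rewrite scaler0 -[in LHS](scale0r (0 : Ug)) usgnZ scale0r.
- rewrite expr0 scale1r -[1]/(uscal 1) /usgn (uliftE iota_sgn_br) /=.
  by rewrite scale1r.
- by move=> a c u v _ hu _ hv; rewrite usgnD usgnZ hu hv scalerDr !scalerA mulrC.
- move=> a b u v _ hu _ hv.
  by rewrite usgnM hu hv -scalerAl -scalerAr scalerA signr_addb.
Qed.

End Enveloping.

Section Induction.
Variables (F : numFieldType) (g : lieSuperalg F).
Variables (h : {vspace g}) (l : 'Hom(g, F^o)).
Local Notation U := (Ug g).

(* U(g) (x)_{U(h)} l, where l stands for the module of dimension (1, 0) on
   which the even elements of h act through l and the odd ones by 0: the tensor
   products u (x) c, with u in U(g) and c in F, modulo bilinearity and
   (u x) (x) c = u (x) (x c); as the algebra U(h) is generated by h, it is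
   enough to impose the latter for homogeneous x in h. *)
Inductive tterm : Type :=
  | TTens of U & F
  | TAdd of tterm & tterm
  | TScal of F & tterm.

Inductive teq : tterm -> tterm -> Prop :=
  | teq_refl s : teq s s
  | teq_sym s t : teq s t -> teq t s
  | teq_trans s t r : teq s t -> teq t r -> teq s r
  | teq_add s s' t t' : teq s s' -> teq t t' -> teq (TAdd s t) (TAdd s' t')
  | teq_scal c s s' : teq s s' -> teq (TScal c s) (TScal c s')
  | teq_addA r s t : teq (TAdd r (TAdd s t)) (TAdd (TAdd r s) t)
  | teq_addC s t : teq (TAdd s t) (TAdd t s)
  | teq_add0 s : teq (TAdd (TTens 0 0) s) s
  | teq_scalA c d s : teq (TScal c (TScal d s)) (TScal (c * d) s)
  | teq_scal1 s : teq (TScal 1 s) s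
  | teq_scal0 s : teq (TScal 0 s) (TTens 0 0)
  | teq_scalDl c d s : teq (TScal (c + d) s) (TAdd (TScal c s) (TScal d s))
  | teq_scalDr c s t : teq (TScal c (TAdd s t)) (TAdd (TScal c s) (TScal c t))
  | teq_tensDl u v c : teq (TTens (u + v) c) (TAdd (TTens u c) (TTens v c))
  | teq_tensDr u c d : teq (TTens u (c + d)) (TAdd (TTens u c) (TTens u d))
  | teq_tensZl c u d : teq (TTens (c *: u) d) (TScal c (TTens u d))
  | teq_tensZr c u d : teq (TTens u (c * d)) (TScal c (TTens u d))
  | teq_bal a x u c : x \in h -> x \in gr g a ->
      teq (TTens (u * iota x) c) (TTens u ((if a then 0 else l x) * c)).

HB.instance Definition _ := gen_eqMixin tterm.
HB.instance Definition _ := gen_choiceMixin tterm.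

Definition teqb : rel tterm := fun s t => `[< teq s t >].

Lemma teqb_equiv : equiv_class_of teqb.
Proof.
split=> [s|s t|t s r].
- exact/asboolP/teq_refl.
- by apply/asboolP/asboolP; apply: teq_sym.
- by move=> /asboolP h1 /asboolP h2; apply/asboolP; apply: teq_trans h1 h2.
Qed.

Canonical teqb_equiv_rel := EquivRelPack teqb_equiv.

Definition indT : Type := {eq_quot teqb}.
HB.instance Definition _ := Choice.on indT.
HB.instance Definition _ := EqQuotient.on indT.

Definition tpi (t : tterm) : indT := \pi_indT t.

Lemma tpiP s t : teq s t <-> tpi s = tpi t.
Proof.
split=> [e|]; first by apply/eqquotP/asboolP.
by move/eqquotP/asboolP.
Qed.

Lemma teq_repr t : teq (repr (tpi t)) t.
Proof. by apply/tpiP; rewrite /tpi reprK. Qed.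

Lemma indT_ind (P : indT -> Prop) : (forall t, P (tpi t)) -> forall u, P u.
Proof. by move=> H u; rewrite -[u]reprK. Qed.

Definition tadd (u v : indT) : indT := tpi (TAdd (repr u) (repr v)).
Definition tscal (c : F) (u : indT) : indT := tpi (TScal c (repr u)).
Definition tens (u : U) (c : F) : indT := tpi (TTens u c).

Lemma taddE s t : tadd (tpi s) (tpi t) = tpi (TAdd s t).
Proof. by apply/tpiP/teq_add; apply: teq_repr. Qed.
Lemma tscalE c s : tscal c (tpi s) = tpi (TScal c s).
Proof. by apply/tpiP/teq_scal; apply: teq_repr. Qed.

Lemma taddA : associative tadd.
Proof.
elim/indT_ind=> r; elim/indT_ind=> s; elim/indT_ind=> t; rewrite !taddE.
exact/tpiP/teq_addA.
Qed.
Lemma taddC : commutative tadd.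
Proof. by elim/indT_ind=> r; elim/indT_ind=> s; rewrite !taddE; apply/tpiP/teq_addC. Qed.
Lemma tadd0 : left_id (tens 0 0) tadd.
Proof. by elim/indT_ind=> r; rewrite !taddE; apply/tpiP/teq_add0. Qed.
Lemma tscalA c d u : tscal c (tscal d u) = tscal (c * d) u.
Proof. by elim/indT_ind: u => r; rewrite !tscalE; apply/tpiP/teq_scalA. Qed.
Lemma tscal1 : left_id 1 tscal.
Proof. by elim/indT_ind=> r; rewrite !tscalE; apply/tpiP/teq_scal1. Qed.
Lemma tscal0 u : tscal 0 u = tens 0 0.
Proof. by elim/indT_ind: u => r; rewrite !tscalE; apply/tpiP/teq_scal0. Qed.
Lemma tscalDl u c d : tscal (c + d) u = tadd (tscal c u) (tscal d u).
Proof. by elim/indT_ind: u => r; rewrite !tscalE taddE; apply/tpiP/teq_scalDl. Qed.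
Lemma tscalDr c u v : tscal c (tadd u v) = tadd (tscal c u) (tscal c v).
Proof.
elim/indT_ind: u => r; elim/indT_ind: v => s.
by rewrite !(tscalE, taddE); apply/tpiP/teq_scalDr.
Qed.
Lemma taddN : left_inverse (tens 0 0) (tscal (-1)) tadd.
Proof. by move=> u; rewrite -{2}[u]tscal1 -tscalDl addNr tscal0. Qed.

HB.instance Definition _ :=
  GRing.isZmodule.Build indT taddA taddC tadd0 taddN.
HB.instance Definition _ :=
  GRing.Zmodule_isLmodule.Build F indT tscalA tscal1 tscalDr tscalDl.

Lemma tensDl u v c : tens (u + v) c = tens u c + tens v c.
Proof. by rewrite -[RHS]/(tadd _ _) taddE; apply/tpiP/teq_tensDl. Qed.
Lemma tensDr u c d : tens u (c + d) = tens u c + tens u d.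
Proof. by rewrite -[RHS]/(tadd _ _) taddE; apply/tpiP/teq_tensDr. Qed.
Lemma tensZl c u d : tens (c *: u) d = c *: tens u d.
Proof. by rewrite -[RHS]/(tscal _ _) tscalE; apply/tpiP/teq_tensZl. Qed.
Lemma tensZr c u d : tens u (c * d) = c *: tens u d.
Proof. by rewrite -[RHS]/(tscal _ _) tscalE; apply/tpiP/teq_tensZr. Qed.
Lemma tens_bal a x u c : x \in h -> x \in gr g a ->
  tens (u * iota x) c = tens u ((if a then 0 else l x) * c).
Proof. by move=> hx ax; apply/tpiP; apply: teq_bal. Qed.

Lemma indT_tens_ind (P : indT -> Prop) :
  (forall u c, P (tens u c)) ->
  (forall m n, P m -> P n -> P (m + n)) ->
  (forall c m, P m -> P (c *: m)) -> forall m, P m.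
Proof.
move=> Pt PD PZ; elim/indT_ind; elim=> [u c|s Ps t Pt'|c s Ps].
- exact: Pt.
- by rewrite -taddE; apply: PD.
- by rewrite -tscalE; apply: PZ.
Qed.

(* The endomorphism u (x) c |-> f u (x) c. *)
Section Map.
Variable f : U -> U.
Hypothesis fD : forall u v, f (u + v) = f u + f v.
Hypothesis fZ : forall c u, f (c *: u) = c *: f u.
Hypothesis f_bal : forall a x u c, x \in h -> x \in gr g a ->
  tens (f (u * iota x)) c = tens (f u) ((if a then 0 else l x) * c).

Fixpoint tmapt (t : tterm) : indT :=
  match t with
  | TTens u c => tens (f u) c
  | TAdd s t => tmapt s + tmapt t
  | TScal c s => c *: tmapt s
  end.

Lemma tmapt_teq s t : teq s t -> tmapt s = tmapt t.
Proof.
have f0 : f 0 = 0 by rewrite -[in LHS](scale0r (0 : U)) fZ scale0r.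
have t00 : tens (f 0) 0 = 0 by rewrite f0.
elim=> //=; rewrite ?t00.
- by move=> r t' q _ -> _ ->.
- by move=> r r' t' q _ -> _ ->.
- by move=> c r r' _ ->.
- by move=> *; rewrite addrA.
- by move=> *; rewrite addrC.
- by move=> *; rewrite add0r.
- by move=> *; rewrite scalerA.
- by move=> *; rewrite scale1r.
- by move=> *; rewrite scale0r.
- by move=> *; rewrite scalerDl.
- by move=> *; rewrite scalerDr.
- by move=> *; rewrite fD tensDl.
- by move=> *; rewrite tensDr.
- by move=> *; rewrite fZ tensZl.
- by move=> *; rewrite tensZr.
Qed.

Definition tmap (m : indT) : indT := tmapt (repr m).

Lemma tmap_pi t : tmap (tpi t) = tmapt t.
Proof. exact/tmapt_teq/teq_repr. Qed.

Lemma tmapE u c : tmap (tens u c) = tens (f u) c.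
Proof. exact: tmap_pi. Qed.
Lemma tmapD m n : tmap (m + n) = tmap m + tmap n.
Proof.
elim/indT_ind: m => s; elim/indT_ind: n => t.
by rewrite -[_ + _]/(tadd _ _) taddE !tmap_pi.
Qed.
Lemma tmapZ c m : tmap (c *: m) = c *: tmap m.
Proof.
by elim/indT_ind: m => s; rewrite -[_ *: _]/(tscal _ _) tscalE !tmap_pi.
Qed.
End Map.

Definition ind_act (x : g) : indT -> indT := tmap (fun u => iota x * u).

Section Act.
Variable x : g.
Let fD u v : iota x * (u + v) = iota x * u + iota x * v.
Proof. exact: mulrDr. Qed.
Let fZ c u : iota x * (c *: u) = c *: (iota x * u).
Proof. by rewrite scalerAr. Qed.
Let f_bal a y u c : y \in h -> y \in gr g a ->
  tens (iota x * (u * iota y)) c =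
  tens (iota x * u) ((if a then 0 else l y) * c).
Proof. by move=> hy ay; rewrite mulrA (tens_bal _ _ hy ay). Qed.

Lemma ind_actE u c : ind_act x (tens u c) = tens (iota x * u) c.
Proof. exact: tmapE fD fZ f_bal _ _. Qed.
Lemma ind_actD m n : ind_act x (m + n) = ind_act x m + ind_act x n.
Proof. exact: tmapD fD fZ f_bal _ _. Qed.
Lemma ind_actZ c m : ind_act x (c *: m) = c *: ind_act x m.
Proof. exact: tmapZ fD fZ f_bal _ _. Qed.
End Act.

Lemma ind_act_linr x : linear (ind_act x).
Proof. by move=> c m n; rewrite ind_actD ind_actZ. Qed.

Lemma ind_act_linl m : linear (ind_act^~ m).
Proof.
move=> c x y; elim/indT_tens_ind: m => [u d|m n Hm Hn|d m Hm].
- by rewrite !ind_actE linearP mulrDl -scalerAl tensDl tensZl.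
- by rewrite !ind_actD Hm Hn scalerDr addrACA.
- by rewrite !ind_actZ Hm scalerDr !scalerA mulrC.
Qed.

Lemma ind_act_br a b x y m : x \in gr g a -> y \in gr g b ->
  ind_act (br x y) m =
  ind_act x (ind_act y m) - (-1) ^+ (a && b) *: ind_act y (ind_act x m).
Proof.
move=> hx hy; elim/indT_tens_ind: m => [u d|m n Hm Hn|d m Hm].
- rewrite !ind_actE (iota_br hx hy) mulrBl -scalerAl -!mulrA.
  by rewrite -scaleNr tensDl tensZl scaleNr.
- by rewrite !ind_actD Hm Hn scalerDr opprD addrACA.
- by rewrite !ind_actZ Hm scalerBr !scalerA mulrC.
Qed.

Inductive ind_gr (a : bool) : indT -> Prop :=
  | ind_gr_tens u c : udeg a u -> ind_gr a (tens u c)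
  | ind_gr_lin c m n : ind_gr a m -> ind_gr a n -> ind_gr a (c *: m + n).

Lemma ind_gr0 a : ind_gr a 0.
Proof. exact: (ind_gr_tens 0 (udeg_0 g a)). Qed.

Lemma ind_grD a m n : ind_gr a m -> ind_gr a n -> ind_gr a (m + n).
Proof. by move=> hm hn; rewrite -[m]scale1r; apply: ind_gr_lin. Qed.

Lemma ind_grZ a c m : ind_gr a m -> ind_gr a (c *: m).
Proof. by move=> hm; rewrite -[_ *: _]addr0; apply: ind_gr_lin (ind_gr0 a). Qed.

Lemma ind_gr_add m : exists m0 m1,
  [/\ ind_gr false m0, ind_gr true m1 & m = m0 + m1].
Proof.
elim/indT_tens_ind: m.
- move=> u c; have [u0 [u1 [h0 h1 ->]]] := udeg_decomp u.
  exists (tens u0 c), (tens u1 c); split; [exact: ind_gr_tens..|].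
  by rewrite tensDl.
- move=> m n [m0 [m1 [h0 h1 ->]]] [n0 [n1 [k0 k1 ->]]].
  exists (m0 + n0), (m1 + n1); split; [exact: ind_grD..|].
  by rewrite addrACA.
- move=> c m [m0 [m1 [h0 h1 ->]]].
  exists (c *: m0), (c *: m1); split; [exact: ind_grZ..|].
  by rewrite scalerDr.
Qed.

Lemma ind_act_gr a b x m : x \in gr g a -> ind_gr b m ->
  ind_gr (a (+) b) (ind_act x m).
Proof.
move=> hx; elim=> [u c hu|c m' n _ Hm _ Hn].
- by rewrite ind_actE; apply/ind_gr_tens/udeg_mul/hu/udeg_iota.
- by rewrite ind_actD ind_actZ; apply: ind_gr_lin.
Qed.

Definition ind_sgn : indT -> indT := tmap (@usgn F g).

Let sgn_bal a x u c : x \in h -> x \in gr g a ->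
  tens (usgn (u * iota x)) c = tens (usgn u) ((if a then 0 else l x) * c).
Proof.
move=> hx ax; rewrite usgnM usgn_iota (sgn_lsaE ax) linearZ -scalerAr tensZl.
rewrite (tens_bal _ _ hx ax) -tensZr; congr tens.
by case: a {ax}; rewrite ?mul0r ?mulr0 // expr0 mul1r.
Qed.

Lemma ind_sgn_gr a m : ind_gr a m -> ind_sgn m = (-1) ^+ a *: m.
Proof.
elim=> [u c hu|c m' n _ Hm _ Hn].
- by rewrite /ind_sgn (tmapE (@usgnD F g) (@usgnZ F g) sgn_bal) (usgn_udeg hu) tensZl.
- rewrite /ind_sgn (tmapD (@usgnD F g) (@usgnZ F g) sgn_bal).
  rewrite (tmapZ (@usgnD F g) (@usgnZ F g) sgn_bal) -!/(ind_sgn _) Hm Hn.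
  by rewrite scalerDr !scalerA mulrC.
Qed.

Lemma ind_gr_cap m : ind_gr false m -> ind_gr true m -> m = 0.
Proof.
move=> /ind_sgn_gr e0 /ind_sgn_gr; rewrite e0 expr0 expr1 scale1r scaleN1r.
move/eqP; rewrite -addr_eq0 -mulr2n -scaler_nat scaler_eq0 pnatr_eq0 /=.
by move/eqP.
Qed.

Definition Ind : supermod g :=
  SuperMod ind_gr0 ind_gr_lin ind_gr_cap ind_gr_add
    ind_act_linr ind_act_linl ind_act_gr ind_act_br.

End Induction.

Section Kirillov.
Variables (F : numFieldType) (g : lieSuperalg F).
Implicit Types (h t : {vspace g}) (l m : 'Hom(g, F^o)).

Definition Ih h l : supermod g := Ind h (l + theta h).

(* The default value fullv is never used when l is in L, as l then has a
   polarization. *)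
Definition some_polarization l : {vspace g} :=
  xget fullv [set h | polarization l h]%classic.

Definition I_ l : supermod g := Ih (some_polarization l) l.

Definition inZ l h : Prop := inL l /\ polarization l h.

Definition equivZ l h m t : Prop := l - theta h = m - theta t.

End Kirillov.

(* Main.v *)
(* A polarization h is g_0 + H, where H is a g_0-submodule of g_1 maximal isotropic for f_l;
   by Lie's theorem g_1 / H has a flag of g_0-submodules with one-dimensional quotients.
   Along this flag, duality between H and g_1 / H^perp shows that in a module generated by a
   vector v of weight l killed by H, the vectors killed by H are the combinations of v and
   y v, where y spans H^perp / H (which has dimension 0 or 1, according to the parity of
   rk f_l), and that the ordered monomials in the elements of the flag applied to v are
   linearly independent.  Hence Ind_h(l) is irreducible, of type G or Q, as soon as it is
   nonzero, and the trace of z in g_0 on it is dim * (l - theta_h)(z), so that l - theta_h is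
   an invariant.  Moreover h is again a polarization for l + c theta_h: by the Jacobi identity
   theta_h([x, y]) = 0 if x is in H and y is an eigenvector modulo H^perp.
   Two polarizations are connected by a chain in which consecutive ones differ by one
   dimension, H' = (H cap x^perp) + <x>, and then x v is the singular vector that defines
   I_h'(l) -> I_h(l).  In an irreducible module, a g_0-eigenvector killed by a submodule k of
   g_1 of maximal dimension has a weight chi for which g_0 + k is a polarization: otherwise
   k + <x> is isotropic for some eigenvector x modulo k, and v or x v is killed by it. *)
Require Import Defs.
From HB Require Import structures.
From mathcomp Require Import all_boot all_order all_algebra.
From mathcomp Require Import boolp classical_sets ring.
From mathcomp Require Import reals complex.

Set Implicit Arguments.
Unset Strict Implicit.
Unset Printing Implicit Defensive.

Import Order.TTheory GRing.Theory Num.Theory.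
Local Open Scope ring_scope.



(** [Ug] and [Ind] are terms modulo relations, so it is not evident that an induced module is
    nonzero. In place of a PBW basis, a module with a nonzero singular vector is built by hand, as
    an iterated sum V + yV along a flag, and the universal property of [Ind] transfers the
    nonvanishing. Independence of the monomials then holds in any module with such a vector, because
    each flag vector has a dual vector in H. The factor 1/2 in theta: a flag vector y of weight w
    turns dimension d and trace T into 2d and 2T + dw, so trace / dimension grows by w/2. It also
    fits the exchange of polarizations: if x of weight w replaces its dual vector in H, of weight
    -w, the trace on g1/H drops by 2w and theta grows by w, which is exactly the shift from v to xv.
    One obstacle remains: I(l) is induced from l + theta, while H and the rank belong to f_l. The
    two forms differ, and are compared only where Jacobi makes an operator on g1/H zero or of rank
    one. Quotients are not formed: eigenvectors, bases and traces are taken modulo a subspace. *)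

Section LinearExpressions.
Variables (F : fieldType) (V : lmodType F).

(** Syntax of linear combinations for the reflexive tactic [lmodule], which turns an identity of
    vectors into one scalar identity per atom. *)
Inductive lexp : Type :=
  | LAtom of nat | LZero | LAdd of lexp & lexp | LOpp of lexp | LScale of F & lexp.

Fixpoint leval (env : seq V) (e : lexp) : V :=
  match e with
  | LAtom n => nth 0 env n
  | LZero => 0
  | LAdd e1 e2 => leval env e1 + leval env e2
  | LOpp e1 => - leval env e1
  | LScale c e1 => c *: leval env e1
  end.

Fixpoint lcoef (e : lexp) (n : nat) : F :=
  match e with
  | LAtom m => if eqn m n then 1 else 0
  | LZero => 0
  | LAdd e1 e2 => lcoef e1 n + lcoef e2 n
  | LOpp e1 => - lcoef e1 n
  | LScale c e1 => c * lcoef e1 n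
  end.

Fixpoint lbound (N : nat) (e : lexp) : bool :=
  match e with
  | LAtom m => (m < N)%N
  | LZero => true
  | LAdd e1 e2 => lbound N e1 && lbound N e2
  | LOpp e1 | LScale _ e1 => lbound N e1
  end.

Lemma leval_coef env e : lbound (size env) e ->
  leval env e = \sum_(i < size env) lcoef e i *: nth 0 env i.
Proof.
elim: e => [m /= mN||e1 IH1 e2 IH2 /= /andP[/IH1 -> /IH2 ->]|e1 IH /= /IH ->|c e1 IH /= /IH ->] //=.
- rewrite (bigD1 (Ordinal mN)) //= [eqn m m]eqxx scale1r big1 ?addr0 // => i.
  by rewrite -val_eqE /= eq_sym => /negPf im; rewrite [eqn m i]im scale0r.
- by rewrite big1 // => i _; rewrite scale0r.
- by rewrite -big_split; apply: eq_bigr => i _; rewrite scalerDl.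
- by rewrite -sumrN; apply: eq_bigr => i _; rewrite scaleNr.
- by rewrite scaler_sumr; apply: eq_bigr => i _; rewrite scalerA.
Qed.

(** A recursion on the number of atoms, so that for a concrete environment it unfolds to a finite
    conjunction. *)
Fixpoint lcoef_eq (e1 e2 : lexp) (n : nat) : Prop :=
  if n is m.+1 then lcoef e1 m = lcoef e2 m /\ lcoef_eq e1 e2 m else True.

Lemma leval_eq env e1 e2 : lbound (size env) e1 && lbound (size env) e2 ->
  lcoef_eq e1 e2 (size env) -> leval env e1 = leval env e2.
Proof.
case/andP=> /leval_coef -> /leval_coef -> h; apply: eq_bigr => -[i /= iN] _; congr (_ *: _).
by elim: (size env) iN h => //= n IH; rewrite ltnS leq_eqVlt => /orP[/eqP -> []|/IH h [_ /h]].
Qed.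

End LinearExpressions.

(** The inner [match constr:(tt)] runs the tactic [constr_eq] while a term is computed; its failure
    backtracks to the next branch. *)
Ltac lindex x env n :=
  lazymatch env with
  | ?y :: ?env' => match constr:(tt) with
      | _ => let _ := match constr:(tt) with _ => constr_eq x y end in n
      | _ => lindex x env' constr:(S n)
      end
  end.
Ltac latoms t env :=
  lazymatch t with
  | (?a + ?b)%R => let env := latoms a env in latoms b env
  | (- ?a)%R => latoms a env
  | (_ *: ?a)%R => latoms a env
  | 0%R => env
  | _ => match constr:(tt) with
      | _ => let _ := lindex t env O in env
      | _ => constr:(t :: env)
      end
  end.
Ltac lreify F t env :=
  lazymatch t with
  | (?a + ?b)%R => let a := lreify F a env in let b := lreify F b env in constr:(LAdd a b)
  | (- ?a)%R => let a := lreify F a env in constr:(LOpp a)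
  | (?c *: ?a)%R => let a := lreify F a env in constr:(@LScale F c a)
  | 0%R => constr:(@LZero F)
  | _ => let n := lindex t env O in constr:(@LAtom F n)
  end.
(* Proves equalities between linear combinations in a module over the field F,
   by comparing the coefficients of the atoms. *)
Ltac lmodule F :=
  lazymatch goal with
  | |- @eq ?T ?s ?t =>
    let env := latoms s (@nil T) in let env := latoms t env in
    let e1 := lreify F s env in let e2 := lreify F t env in
    apply: (@leval_eq F _ env e1 e2); [reflexivity | cbn -[GRing.add GRing.opp GRing.mul
      GRing.one GRing.zero GRing.natmul GRing.exp GRing.inv]; repeat split; first [ring | by field]]
  end.

(** * Subspaces given by predicates, and linear forms *)

Section LinearAlgebra.
Variable F : fieldType.

Definition subspace (V : lmodType F) (P : V -> Prop) : Prop :=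
  P 0 /\ forall c u v, P u -> P v -> P (c *: u + v).

Section Subspace.
Variables (V : lmodType F) (P : V -> Prop).
Hypothesis sP : subspace P.

Lemma subspace0 : P 0. Proof. by case: sP. Qed.
Lemma subspaceD u v : P u -> P v -> P (u + v).
Proof. by move=> Pu Pv; rewrite -[u]scale1r; apply: sP.2. Qed.
Lemma subspaceZ c u : P u -> P (c *: u).
Proof. by move=> Pu; rewrite -[_ *: _]addr0; apply: sP.2 subspace0. Qed.
Lemma subspaceN u : P u -> P (- u).
Proof. by move=> Pu; rewrite -scaleN1r; apply: subspaceZ. Qed.
Lemma subspaceB u v : P u -> P v -> P (u - v).
Proof. by move=> Pu Pv; apply: subspaceD => //; apply: subspaceN. Qed.
Lemma subspace_sum I (r : seq I) (Q : pred I) (f : I -> V) :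
  (forall i, Q i -> P (f i)) -> P (\sum_(i <- r | Q i) f i).
Proof.
by move=> h; elim/big_rec: _ => [|i u Qi Pu]; [exact: subspace0|apply: subspaceD; auto].
Qed.
End Subspace.

Variable g : vectType F.

Lemma subspace_mem (U : {vspace g}) : subspace (fun x => x \in U).
Proof. by split=> [|c u v uU vU]; rewrite ?mem0v // memvD ?memvZ. Qed.

(** A subspace of maximal dimension among those contained in P is P, since any vector of P outside
    would enlarge it. This gives orthogonals a dimension. *)
Lemma vspace_of_subspace (P : g -> Prop) :
  subspace P -> exists U : {vspace g}, forall x, x \in U <-> P x.
Proof.
move=> sP.
pose Q n := `[< exists U : {vspace g}, (\dim U = n)%N /\ forall x, x \in U -> P x >].
have Q0 : exists n, Q n.
  exists 0%N; apply/asboolP; exists 0%VS; split; first by rewrite dimv0.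
  by move=> x; rewrite memv0 => /eqP ->; apply: subspace0 sP.
have Qb n : Q n -> (n <= \dim {:g})%N.
  by move=> /asboolP[U [<- _]]; apply: dimvS; apply: subvf.
case: (ex_maxnP Q0 Qb) => n /asboolP[U [dU UP]] nmax.
exists U => x; split=> [/UP//|Px]; apply: contrapT => xU.
suff /nmax : Q (\dim (U + <[x]>)%VS).
  rewrite leqNgt -dU dimv_disjoint_sum ?dim_vline.
    have -> : x != 0 by apply: contra_notN xU => /eqP ->; rewrite mem0v.
    by rewrite addn1 ltnSn.
  apply/eqP; rewrite -subv0; apply/subvP => y; rewrite memv_cap => /andP[yU].
  move=> /vlineP[c cy]; rewrite memv0; case: (eqVneq c 0) cy => [->|c0] cy.
    by rewrite cy scale0r.
  by case: xU; rewrite -(scalerK c0 x) -cy memvZ.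
apply/asboolP; exists (U + <[x]>)%VS; split=> // y /memv_addP[u uU [_ /vlineP[c ->] ->]].
by apply: subspaceD => //; [apply: UP|apply: subspaceZ].
Qed.

Lemma hom_of_linear (f : g -> F) : (forall c x y, f (c *: x + y) = c * f x + f y) ->
  exists l : 'Hom(g, F^o), forall x, l x = f x.
Proof.
move=> f_lin.
pose fl := GRing.isLinear.Build F g F^o *:%R f f_lin.
pose f' : {linear g -> F^o} := HB.pack f fl.
by exists (linfun f') => x; rewrite lfunE.
Qed.

(** The form is a nonzero coordinate of the component of y off A, divided by its value. *)
Lemma separating_form (A : {vspace g}) y : y \notin A ->
  exists2 phi : 'Hom(g, F^o), phi y = 1 & forall a, a \in A -> phi a = 0.
Proof.
move=> yA; pose q x := x - projv A x.
have q_lin c x z : q (c *: x + z) = c *: q x + q z.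
  by rewrite /q linearP scalerBr opprD addrACA.
have qy : q y != 0.
  by apply: contraNneq yA => /eqP; rewrite subr_eq0 => /eqP ->; apply: memv_proj.
have [i ci] : exists i, coord (vbasis fullv) i (q y) != 0.
  apply: contrapT => nz; move: qy; rewrite (coord_vbasis (memvf (q y))).
  rewrite big1 ?eqxx // => i _; suff -> : coord (vbasis fullv) i (q y) = 0 by rewrite scale0r.
  by apply/eqP; apply: contrapT => /negP ni; apply: nz; exists i.
have [|phi phiE] := @hom_of_linear
  (fun x => coord (vbasis fullv) i (q x) / coord (vbasis fullv) i (q y)).
  by move=> c x z /=; rewrite q_lin linearP mulrDl mulrA.
exists phi; first by rewrite phiE divff.
by move=> a aA; rewrite phiE /q projv_id // subrr linear0 mul0r.
Qed.

End LinearAlgebra.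

(** * Lie's theorem *)

Section Brackets.
Variables (F : numFieldType) (g : lieSuperalg F).
Implicit Types (U W : {vspace g}).

Lemma brv_mem U W x y : x \in U -> y \in W -> br x y \in brv U W.
Proof.
move=> xU yW; rewrite (coord_vbasis xU) (coord_vbasis yW).
have hsum (n : nat) (f : 'I_n -> g) v :
    (forall i, br (f i) v \in brv U W) -> br (\sum_i f i) v \in brv U W.
  move=> h; elim/big_ind: _ => [|a b ha hb|i _]; rewrite ?br0l ?mem0v ?brDl ?memvD //.
have hsum' (n : nat) (f : 'I_n -> g) v :
    (forall i, br v (f i) \in brv U W) -> br v (\sum_i f i) \in brv U W.
  move=> h; elim/big_ind: _ => [|a b ha hb|i _]; rewrite ?br0r ?mem0v ?brDr ?memvD //.
apply: hsum => i; apply: hsum' => j; rewrite brZl brZr !memvZ // memv_span //.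
by apply/allpairsP; exists ((vbasis U)`_i, (vbasis W)`_j); rewrite !mem_nth ?size_tuple.
Qed.

Lemma brv_sub U W (T : {vspace g}) :
  (forall x y, x \in U -> y \in W -> br x y \in T) -> (brv U W <= T)%VS.
Proof.
move=> h; apply/span_subvP => _ /allpairsP[[x y] /= [xU yW ->]].
by apply: h; apply: vbasis_mem.
Qed.

Lemma brvS U1 U2 W1 W2 : (U1 <= U2)%VS -> (W1 <= W2)%VS -> (brv U1 W1 <= brv U2 W2)%VS.
Proof.
by move=> /subvP sU /subvP sW; apply: brv_sub => x y /sU xU /sW yW; apply: brv_mem.
Qed.

Lemma iter_brvS n U W : (U <= W)%VS ->
  (iter n (fun T => brv T T) U <= iter n (fun T => brv T T) W)%VS.
Proof. by move=> sUW; elim: n => //= n IH; apply: brvS. Qed.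

End Brackets.

Section Lie.
Variables (F : numClosedFieldType) (g : lieSuperalg F) (V : lmodType F).
Variable rho : g -> V -> V.
Hypotheses (rho_linr : forall x, linear (rho x)) (rho_linl : forall u, linear (rho^~ u)).
Hypothesis rho_br : forall x y u, x \in gr g false -> y \in gr g false ->
  rho (br x y) u = rho x (rho y u) - rho y (rho x u).
Variables (A : V -> Prop).
Hypothesis sA : subspace A.

Let rhoD x u v : rho x (u + v) = rho x u + rho x v.
Proof. by have := rho_linr x 1 u v; rewrite !scale1r. Qed.
Let rho0 x : rho x 0 = 0.
Proof. by apply: (addrI (rho x 0)); rewrite -rhoD !addr0. Qed.
Let rhoZ x c u : rho x (c *: u) = c *: rho x u.
Proof. by have := rho_linr x c u 0; rewrite rho0 !addr0. Qed.
Let rhoDl x y u : rho (x + y) u = rho x u + rho y u.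
Proof. by have := rho_linl u 1 x y; rewrite !scale1r. Qed.
Let rho0l u : rho 0 u = 0.
Proof. by apply: (addrI (rho 0 u)); rewrite -rhoDl !addr0. Qed.
Let rhoZl x c u : rho (c *: x) u = c *: rho x u.
Proof. by have := rho_linl u c x 0; rewrite rho0l !addr0. Qed.

Definition finspan (B : V -> Prop) : Prop :=
  exists n (b : 'I_n -> V), forall u, B u -> exists c : 'I_n -> F, A (u - \sum_i c i *: b i).

Section Eval.
Variables (z : g) (y : V).

(** This is p(rho z) y. Minimal polynomials of vectors modulo A take the place of matrices on a
    quotient. *)
Definition orbit_eval (p : {poly F}) : V := \sum_(i < size p) p`_i *: iter i (rho z) y.
Local Notation ev := orbit_eval.

Lemma orbit_evalE n (p : {poly F}) : (size p <= n)%N ->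
  ev p = \sum_(i < n) p`_i *: iter i (rho z) y.
Proof.
move=> sp; rewrite /ev (big_ord_widen n (fun i => p`_i *: iter i (rho z) y) sp).
rewrite [RHS](bigID (fun i : 'I_n => (i < size p)%N)) /=.
rewrite [X in _ = _ + X]big1 ?addr0 // => i; rewrite -leqNgt => /(nth_default 0) ->.
by rewrite scale0r.
Qed.

Lemma orbit_eval_lin c (p q : {poly F}) : ev (c *: p + q) = c *: ev p + ev q.
Proof.
have sn : (size (c *: p + q)%R <= maxn (size p) (size q))%N.
  by apply: leq_trans (size_polyD _ _) _; rewrite geq_max !leq_max size_scale_leq leqnn orbT.
rewrite (orbit_evalE sn) (orbit_evalE (leq_maxl (size p) (size q))).
rewrite (orbit_evalE (leq_maxr (size p) (size q))) scaler_sumr -big_split /=.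
by apply: eq_bigr => i _; rewrite coefD coefZ scalerDl scalerA.
Qed.

Lemma orbit_evalC c : ev c%:P = c *: y.
Proof. by rewrite (orbit_evalE (size_polyC_leq1 c)) big_ord1 coefC. Qed.
Lemma orbit_eval0 : ev 0 = 0.
Proof. by rewrite /ev size_poly0 big_ord0. Qed.
Lemma orbit_evalD (p q : {poly F}) : ev (p + q) = ev p + ev q.
Proof. by rewrite -[p]scale1r orbit_eval_lin !scale1r. Qed.
Lemma orbit_evalZ c (p : {poly F}) : ev (c *: p) = c *: ev p.
Proof. by rewrite -[_ *: p]addr0 orbit_eval_lin orbit_eval0 addr0. Qed.

Lemma orbit_evalMX (p : {poly F}) : ev (p * 'X) = rho z (ev p).
Proof.
rewrite (@orbit_evalE (size p).+1); last first.
  by case: (eqVneq p 0) => [->|p0]; rewrite ?mul0r ?size_poly0 // size_mulX.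
rewrite big_ord_recl coefMX /= scale0r add0r /ev (big_morph _ (rhoD z) (rho0 z)).
by apply: eq_bigr => i _; rewrite coefMX /= rhoZ.
Qed.

Lemma orbit_eval_mem (B : V -> Prop) p : subspace B -> (forall u, B u -> B (rho z u)) -> B y ->
  B (ev p).
Proof.
move=> sB Bz By; apply: subspace_sum => // i _; apply: subspaceZ => //.
by elim: (i : nat) => //= n; apply: Bz.
Qed.

(** Modulo A, the n + 1 first iterates of y have coordinates in n vectors, so a nontrivial
    combination of them lies in A. An annihilating polynomial of least size is the minimal
    polynomial of y modulo A. *)
Lemma orbit_eval_dep (B : V -> Prop) : subspace B -> (forall u, B u -> B (rho z u)) -> B y ->
  finspan B ->
  exists p, [/\ p != 0, A (ev p) & forall q, q != 0 -> A (ev q) -> (size p <= size q)%N].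
Proof.
move=> sB Bz By [n [b hb]].
have ez : exists m, `[< exists p, [/\ p != 0, A (ev p) & size p = m] >].
  have Bi i : B (iter i (rho z) y) by elim: i => //= i; apply: Bz.
  pose c (i : 'I_n.+1) := projT1 (cid (hb _ (Bi i))).
  have cP (i : 'I_n.+1) : A (iter i (rho z) y - \sum_j c i j *: b j).
    exact: projT2 (cid (hb _ (Bi i))).
  pose C := \matrix_(i < n.+1, j < n) c i j.
  have [v vC v0] : exists2 v : 'rV_n.+1, v *m C = 0 & v != 0.
    have : kermx C != 0.
      by rewrite kermx_eq0 /row_free neq_ltn ltnS rank_leq_col.
    by case/rowV0Pn => v /sub_kermxP vC v0; exists v.
  pose p := \poly_(i < n.+1) (v 0 (inord i)).
  have pE (i : 'I_n.+1) : p`_i = v 0 i by rewrite coef_poly ltn_ord inord_val.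
  exists (size p); apply/asboolP; exists p; split=> //.
    apply: contraNneq v0 => p0; apply/eqP/rowP => i; rewrite -pE p0 coef0 mxE //.
  rewrite (@orbit_evalE n.+1) ?size_poly //.
  have -> : \sum_(i < n.+1) p`_i *: iter i (rho z) y =
      \sum_(i < n.+1) p`_i *: (iter i (rho z) y - \sum_j c i j *: b j).
    apply/eqP; rewrite -subr_eq0 -sumrB; apply/eqP.
    under eq_bigr => i _ do rewrite -scalerBr opprB addrC subrK pE scaler_sumr.
    rewrite exchange_big big1 //= => j _.
    under eq_bigr => i _ do rewrite scalerA.
    rewrite -scaler_suml; have /rowP/(_ j) := vC; rewrite !mxE.
    by under eq_bigr => i _ do rewrite mxE; move=> ->; rewrite scale0r.
  by apply: subspace_sum => // i _; apply: subspaceZ.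
case: (ex_minnP ez) => m /asboolP[p [p0 Ap sp]] mmin.
exists p; split=> // q q0 Aq; rewrite sp; apply: mmin; apply/asboolP; by exists q.
Qed.

End Eval.

(** If p = q (X - c) is minimal for u modulo A, then q(z)u is an eigenvector, outside A because q is
    smaller than p. *)
Lemma eigenvector_mod (B : V -> Prop) z u : subspace B -> (forall v, B v -> B (rho z v)) ->
  finspan B -> B u -> ~ A u -> exists y c, [/\ B y, ~ A y & A (rho z y - c *: y)].
Proof.
move=> sB Bz fB Bu nAu.
have [p [p0 Ap pmin]] := orbit_eval_dep sB Bz Bu fB.
have [c /factor_theorem[q qE]] : exists c, root p c.
  apply/closed_rootP; apply/negP => /size_poly1P[c c0 pE].
  by apply: nAu; rewrite -(scalerK c0 u) -(orbit_evalC z u c) -pE; apply: subspaceZ.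
have q0 : q != 0 by apply: contraNneq p0 => q0; rewrite qE q0 mul0r.
exists (orbit_eval z u q), c; split.
- exact: orbit_eval_mem.
- move=> /(pmin q q0); rewrite qE size_mul ?polyXsubC_eq0 // size_XsubC addn2 /=.
  by rewrite ltnn.
- rewrite -orbit_evalMX -orbit_evalZ -scaleN1r -orbit_evalZ -orbit_evalD.
  by move: Ap; rewrite qE mulrBr -(mulrC c%:P) mul_polyC scaleN1r.
Qed.

Section Weight.
Variables (k : {vspace g}) (z : g) (y : V) (w : g -> F).
Hypotheses (kg : (k <= gr g false)%VS) (zg : z \in gr g false).
Hypothesis kz : forall a, a \in k -> br a z \in k.
Hypotheses (Ak : forall a u, a \in k -> A u -> A (rho a u)).
Hypothesis (Az : forall u, A u -> A (rho z u)).
Hypothesis wP : forall a, a \in k -> A (rho a y - w a *: y).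
Local Notation ev := (orbit_eval z y).

(* Modulo A, a in k acts on C[z] y by w a + w [a,z] d/dz + lower order terms. *)
Lemma weight_eval (p : {poly F}) a : a \in k -> exists r : {poly F},
  (size r <= (size p).-2)%N /\ A (rho a (ev p) - ev (w a *: p + w (br a z) *: p^`() + r)).
Proof.
elim/poly_ind: p a => [|q c IH] a ka.
  exists 0; rewrite size_poly0; split=> //.
  by rewrite deriv0 !scaler0 !addr0 orbit_eval0 rho0 subr0; apply: subspace0 sA.
have [r1 [s1 A1]] := IH a ka; have [r2 [s2 A2]] := IH _ (kz ka).
(* From az = za + [a,z]: the induction hypotheses for a and for [a,z] produce w(a) qX + w([a,z])
   (q'X + q), and this is what remains. *)
exists (r1 * 'X + w (br (br a z) z) *: q^`() + r2); split.
  have [q0|q0] := eqVneq q 0.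
    move: s1 s2; rewrite q0 size_poly0 /= !leqn0 !size_poly_eq0 => /eqP -> /eqP ->.
    by rewrite deriv0 scaler0 mul0r !addr0 size_poly0.
  rewrite -cons_poly_def size_cons_poly /nilp size_poly_eq0 (negPf q0) /=.
  have sq' : (size (w (br (br a z) z) *: q^`()) <= (size q).-1)%N.
    apply: leq_trans (size_scale_leq _ _) _; rewrite -ltnS prednK ?lt_size_deriv //.
    by rewrite size_poly_gt0.
  have s1' : (size (r1 * 'X)%R <= (size q).-1)%N.
    have [->|r10] := eqVneq r1 0; first by rewrite mul0r size_poly0.
    rewrite size_mulX //; case: (size q) s1 => [|[|n]] //=.
    by rewrite leqn0 size_poly_eq0 (negPf r10).
    by rewrite leqn0 size_poly_eq0 (negPf r10).
  apply: leq_trans (size_polyD _ _) _; rewrite geq_max; apply/andP; split.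
    by apply: leq_trans (size_polyD _ _) _; rewrite geq_max s1' sq'.
  by apply: leq_trans s2 _; case: (size q) => // -[].
have aE : rho a (ev (q * 'X + c%:P)) =
    rho z (rho a (ev q)) + rho (br a z) (ev q) + c *: rho a y.
  rewrite orbit_evalD orbit_evalC orbit_evalMX rhoD rhoZ (rho_br _ (subvP kg _ ka) zg).
  by rewrite [rho z _ + _]addrC subrK.
suff -> : rho a (ev (q * 'X + c%:P)) - ev (w a *: (q * 'X + c%:P) +
     w (br a z) *: (q * 'X + c%:P)^`() + (r1 * 'X + w (br (br a z) z) *: q^`() + r2)) =
   rho z (rho a (ev q) - ev (w a *: q + w (br a z) *: q^`() + r1)) +
   (rho (br a z) (ev q) - ev (w (br a z) *: q + w (br (br a z) z) *: q^`() + r2)) +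
   c *: (rho a y - w a *: y).
  by apply: subspaceD => //; [apply: subspaceD => //; apply: Az | apply: subspaceZ => //; apply:
    wP].
rewrite aE derivD derivC addr0 derivM derivX mulr1.
  rewrite !(orbit_evalD, orbit_evalZ, orbit_evalC, orbit_evalMX).
  rewrite -!scaleN1r !(rhoD, rhoZ).
by lmodule F.
Qed.

(** Replaces the usual trace argument. If p is minimal for y modulo A, applying a to p(z)y shows
    that w([a,z]) p' + r also annihilates y modulo A. In characteristic 0 it has degree deg p - 1
    unless w([a,z]) = 0, which contradicts minimality. *)
Lemma weight_bracket (B : V -> Prop) a : subspace B -> (forall u, B u -> B (rho z u)) ->
  finspan B -> B y -> ~ A y -> a \in k -> w (br a z) = 0.
Proof.
move=> sB Bz fB By nAy ka.
have [p [p0 Ap pmin]] := orbit_eval_dep sB Bz By fB.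
have [r [sr Ar]] := weight_eval p ka.
apply: contrapT => /eqP w0.
pose q := w (br a z) *: p^`() + r.
have Aq : A (ev q).
  have -> : ev q = rho a (ev p) - (rho a (ev p) - ev (w a *: p + q)) - w a *: ev p.
    by rewrite (orbit_evalD z y (w a *: p)) orbit_evalZ; lmodule F.
  apply: (subspaceB sA); last exact: subspaceZ.
  by apply: (subspaceB sA); [apply: Ak | rewrite /q addrA].
have p2 : (1 < size p)%N.
  rewrite ltnNge; apply/negP => /size1_polyC pE; apply: nAy.
  have c0 : p`_0 != 0 by apply: contraNneq p0 => c0; rewrite pE c0.
  rewrite -(scalerK c0 y); apply: subspaceZ => //.
  by rewrite -(orbit_evalC z y p`_0) -pE.
have sp : size p = (size p).-2.+2 by case: (size p) p2 => [|[]].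
have q0 : q != 0.
  have : q`_((size p).-2) != 0.
    rewrite coefD coefZ coef_deriv [r`__]nth_default // addr0 mulf_neq0 //.
    rewrite -mulr_natr mulf_neq0 ?pnatr_eq0 //.
    by have := p0; rewrite -lead_coef_eq0 lead_coefE sp.
  by apply: contraNneq => ->; rewrite coef0.
have := pmin q q0 Aq; apply/negP; rewrite -ltnNge.
apply: leq_ltn_trans (size_polyD _ _) _; rewrite gtn_max; apply/andP; split.
  apply: leq_ltn_trans (size_scale_leq _ _) _; exact: lt_size_deriv.
by apply: leq_ltn_trans sr _; rewrite {2}sp ltnS leqnSn.
Qed.

End Weight.

(** Induction on dim k through a hyperplane k' that contains [k,k]. By [weight_bracket] the weight
    space of k' modulo A is stable under a vector z outside k', and there z has an eigenvector.
    Working modulo A serves both the adjoint action on g1/H and modules (A = 0). *)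
Theorem lie_eigenvector n (k : {vspace g}) (B : V -> Prop) u :
  (k <= gr g false)%VS -> (forall a b, a \in k -> b \in k -> br a b \in k) ->
  iter n (fun T => brv T T) k = 0%VS ->
  (forall a v, a \in k -> A v -> A (rho a v)) ->
  subspace B -> (forall a v, a \in k -> B v -> B (rho a v)) -> finspan B -> B u -> ~ A u ->
  exists y, [/\ B y, ~ A y & forall a, a \in k -> exists c, A (rho a y - c *: y)].
Proof.
elim: {k}(\dim k) {-2}k (leqnn (\dim k)) => [|d IH] k.
  rewrite leqn0 dimv_eq0 => /eqP -> _ _ _ _ sB _ _ Bu nAu.
  exists u; split=> // a; rewrite memv0 => /eqP ->; exists 0.
  by rewrite rho0l scale0r subrr; apply: subspace0 sA.
move=> dk kg kk solk Ak sB Bk fB Bu nAu.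
have [k0|k0] := eqVneq k 0%VS.
  exists u; split=> // a; rewrite k0 memv0 => /eqP ->; exists 0.
  by rewrite rho0l scale0r subrr; apply: subspace0 sA.
have kks : (brv k k <= k)%VS by apply: brv_sub.
(* Otherwise the derived series would be constant, equal to k. *)
have /subvPn[z zk nzkk] : ~~ (k <= brv k k)%VS.
  apply: contra k0 => ks; rewrite -solk; apply/eqP.
  by elim: (n) => //= m <-; apply/eqP; rewrite eqEsubv ks kks.
have [phi phiz phikk] := separating_form nzkk.
pose k' := (k :&: lker phi)%VS.
have memk' a : (a \in k') = (a \in k) && (phi a == 0) by rewrite memv_cap memv_ker.
have k'k : (k' <= k)%VS by apply: capvSl.
have nzk' : z \notin k' by rewrite memk' phiz oner_eq0 andbF.
have [||||||y0 [By0 nAy0 ey0]] := IH k' _ _ _ _ _ sB _ fB Bu nAu.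
- rewrite -ltnS; apply: leq_trans dk; rewrite ltn_neqAle dimvS // andbT.
  apply: contraNneq nzk' => dkk; suff -> : k' = k by [].
  by apply/eqP; rewrite eqEdim k'k dkk leqnn.
- exact: subv_trans kg.
- move=> a b /(subvP k'k) ak /(subvP k'k) bk.
  by rewrite memk' kk // phikk ?eqxx // brv_mem.
- by apply/eqP; rewrite -subv0 -solk; apply: iter_brvS.
- by move=> a v /(subvP k'k); apply: Ak.
- by move=> a v /(subvP k'k); apply: Bk.
have {ey0} : forall a, exists c, a \in k' -> A (rho a y0 - c *: y0).
  by move=> a; have [/ey0[c]|_] := boolP (a \in k'); [exists c | exists 0].
move=> /choice[w wP].
have zk' a : a \in k' -> br a z \in k'.
  by move/(subvP k'k) => ak; rewrite memk' kk // phikk ?eqxx // brv_mem.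
have w0 a : a \in k' -> w (br a z) = 0.
  apply: (@weight_bracket k' z y0 w _ _ zk' _ _ wP B) => //.
  - exact: subv_trans kg.
  - exact: (subvP kg).
  - by move=> b v /(subvP k'k); apply: Ak.
  - by move=> v; apply: Ak.
  - by move=> v; apply: Bk.
pose B' v := B v /\ forall a, a \in k' -> A (rho a v - w a *: v).
have sB' : subspace B'.
  split=> [|c v1 v2 [B1 e1] [B2 e2]].
    split=> [|a _]; first exact: subspace0 sB.
    by rewrite rho0 scaler0 subrr; apply: subspace0 sA.
  split=> [|a ak]; first exact: sB.2.
  have -> : rho a (c *: v1 + v2) - w a *: (c *: v1 + v2) =
     c *: (rho a v1 - w a *: v1) + (rho a v2 - w a *: v2).
    by rewrite rhoD rhoZ; lmodule F.
  by apply: sA.2; [apply: e1|apply: e2].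
have [||y [c [[By ey] nAy yc]]] := @eigenvector_mod B' z y0 sB' _ _ (conj By0 wP) nAy0.
- move=> v [Bv ev]; split=> [|a ak]; first exact: Bk.
  have -> : rho a (rho z v) - w a *: rho z v =
      rho z (rho a v - w a *: v) + (rho (br a z) v - w (br a z) *: v).
    rewrite w0 // (rho_br _ (subvP kg _ (subvP k'k _ ak)) (subvP kg _ zk)).
    by rewrite -!scaleN1r rhoD !rhoZ; lmodule F.
  by apply: (subspaceD sA); [apply: Ak => //; apply: ev | apply: ev; apply: zk'].
- by have [m [b hb]] := fB; exists m, b => v [Bv _]; apply: hb.
exists y; split=> // a ak; exists (w (a - phi a *: z) + phi a * c).
have ak' : a - phi a *: z \in k'.
  by rewrite memk' memvB ?memvZ //= linearB linearZ /= phiz [_ *: _]mulr1 subrr.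
have -> : rho a y - (w (a - phi a *: z) + phi a * c) *: y =
   (rho (a - phi a *: z) y - w (a - phi a *: z) *: y) + phi a *: (rho z y - c *: y).
  by rewrite rhoDl -(scaleNr (phi a) z) rhoZl; lmodule F.
by apply: (subspaceD sA); [apply: ey | apply: subspaceZ].
Qed.

End Lie.

(** * Traces *)

Section Families.
Variables (F : numFieldType) (V : lmodType F).

(** Row convention: [phi (v i) = comb A v i] puts the coordinates of the image of the i-th vector in
    row i of A. *)
Definition comb m n (A : 'M[F]_(m, n)) (v : 'I_n -> V) (i : 'I_m) : V :=
  \sum_j A i j *: v j.

Definition independent n (v : 'I_n -> V) : Prop :=
  forall c : 'I_n -> F, \sum_i c i *: v i = 0 -> forall i, c i = 0.

Definition family_cat m n (v : 'I_m -> V) (w : 'I_n -> V) (i : 'I_(m + n)) : V :=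
  match split i with inl j => v j | inr j => w j end.

Lemma family_catl m n (v : 'I_m -> V) (w : 'I_n -> V) i : family_cat v w (lshift n i) = v i.
Proof. by rewrite /family_cat (unsplitK (inl i)). Qed.

Lemma family_catr m n (v : 'I_m -> V) (w : 'I_n -> V) i : family_cat v w (rshift m i) = w i.
Proof. by rewrite /family_cat (unsplitK (inr i)). Qed.

Lemma sum_family_cat m n (c : 'I_(m + n) -> F) (v : 'I_m -> V) (w : 'I_n -> V) :
  \sum_i c i *: family_cat v w i =
  \sum_i c (lshift n i) *: v i + \sum_i c (rshift m i) *: w i.
Proof.
rewrite big_split_ord; congr (_ + _); apply: eq_bigr => i _.
  by rewrite family_catl.
by rewrite family_catr.
Qed.

Lemma comb_mul m n p (A : 'M_(m, n)) (B : 'M_(n, p)) (v : 'I_p -> V) i :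
  comb (A *m B) v i = comb A (comb B v) i.
Proof.
rewrite /comb; under [RHS]eq_bigr => j _ do rewrite scaler_sumr.
rewrite exchange_big; apply: eq_bigr => k _ /=.
rewrite mxE scaler_suml; apply: eq_bigr => j _; by rewrite scalerA.
Qed.

Lemma comb1 n (v : 'I_n -> V) i : comb 1%:M v i = v i.
Proof.
rewrite /comb (bigD1 i) //= mxE eqxx scale1r big1 ?addr0 // => j ji.
by rewrite mxE eq_sym (negPf ji) scale0r.
Qed.

Lemma comb_inj m n (A B : 'M_(m, n)) (v : 'I_n -> V) :
  independent v -> (forall i, comb A v i = comb B v i) -> A = B.
Proof.
move=> iv AB; apply/matrixP => i j; apply/eqP; rewrite -subr_eq0; apply/eqP.
apply: (iv (fun j => A i j - B i j)).
under eq_bigr => k _ do rewrite scalerBl.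
by rewrite sumrB; apply/eqP; rewrite subr_eq0; apply/eqP/AB.
Qed.

Lemma comb_linear (phi : V -> V) m n (A : 'M_(m, n)) (v : 'I_n -> V) i : linear phi ->
  phi (comb A v i) = comb A (phi \o v) i.
Proof.
move=> lphi; pose f : {linear V -> V} := HB.pack phi (GRing.isLinear.Build _ _ _ _ phi lphi).
rewrite -[phi]/(f : V -> V) linear_sum; apply: eq_bigr => j _; exact: linearZ.
Qed.

Lemma eq_comb m n (A : 'M_(m, n)) (v w : 'I_n -> V) i : v =1 w -> comb A v i = comb A w i.
Proof. by move=> vw; apply: eq_bigr => j _; rewrite vw. Qed.

(** QP = 1, PQ = 1 and BP = PA give tr B = tr(BPQ) = tr(PAQ) = tr A. The sizes m and n are
    independent, so the identity map yields the invariance of the dimension. *)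
Lemma trace_basis (phi : V -> V) m n (v : 'I_m -> V) (w : 'I_n -> V)
    (P : 'M_(n, m)) (Q : 'M_(m, n)) (A : 'M_m) (B : 'M_n) :
  linear phi -> independent v -> independent w -> w =1 comb P v -> v =1 comb Q w ->
  (forall i, phi (v i) = comb A v i) -> (forall i, phi (w i) = comb B w i) ->
  \tr A = \tr B.
Proof.
move=> lphi iv iw wP vQ vA wB.
have QP : Q *m P = 1%:M.
  by apply: (comb_inj iv) => i; rewrite comb_mul comb1 vQ; apply: eq_comb => j; rewrite wP.
have BP : B *m P = P *m A.
  apply: (comb_inj iv) => i; rewrite !comb_mul.
  transitivity (phi (w i)); first by rewrite wB; apply: eq_comb => j; rewrite wP.
  rewrite wP comb_linear //; apply: eq_comb => j; exact: vA.
have PQ : P *m Q = 1%:M.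
  by apply: (comb_inj iw) => i; rewrite comb_mul comb1 wP; apply: eq_comb => j; rewrite vQ.
by rewrite -[B]mulmx1 -PQ mulmxA BP -mulmxA mxtrace_mulC -mulmxA QP mulmx1.
Qed.

End Families.

Section QuotientTrace.
Variables (F : numFieldType) (g : lieSuperalg F).
Implicit Types (U h : {vspace g}) (f : g -> g).

Lemma addv_pi1_mem U h u : addv_pi1 U h u \in (U :\: h)%VS.
Proof. exact: memv_pi. Qed.

Lemma addv_pi1_ker U h a : a \in h -> addv_pi1 U h a = 0.
Proof.
move=> ah; have := addv_pi1_pi2 (subvP (addvSr U h) a ah).
rewrite [X in _ + X = _](_ : _ = a) => [/eqP|]; first by rewrite -subr_eq0 addrK => /eqP.
by rewrite addv_pi2_id.
Qed.

Lemma addv_pi1_mod U h u : u \in U -> u - addv_pi1 U h u \in h.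
Proof.
move=> uU; rewrite -{1}(addv_pi1_pi2 (subvP (addvSl U h) u uU)).
by rewrite [_ + addv_pi2 _ _ _]addrC addrK memv_pi.
Qed.

Lemma addv_pi1_eq0 U h u : u \in U -> addv_pi1 U h u = 0 -> u \in h.
Proof. by move=> /(addv_pi1_mod h) + e; rewrite e subr0. Qed.

Lemma vbasis_independent U : independent (fun i : 'I_(\dim U) => (vbasis U)`_i).
Proof.
move=> c c0 i.
exact: (elimT freeP (basis_free (vbasisP U)) c c0 i).
Qed.

(** [trq] uses one basis of one complement; here y is any basis of U modulo h. Projecting y to the
    complement reduces the claim to [trace_basis]. *)
Lemma trq_basis U h f d (y : 'I_d -> g) (A : 'M_d) :
  linear f -> (forall a, a \in U -> a \in h -> f a \in h) ->
  (forall i, y i \in U) -> (forall i, f (y i) - comb A y i \in h) ->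
  (forall u, u \in U -> exists c : 'I_d -> F, u - \sum_i c i *: y i \in h) ->
  (forall c : 'I_d -> F, \sum_i c i *: y i \in h -> forall i, c i = 0) ->
  trq U h f = \tr A.
Proof.
move=> lf fh yU yA yspan yind.
pose p := addv_pi1 U h; pose W := (U :\: h)%VS; pose b i := (vbasis W)`_i.
have pW u : p u \in W by apply: addv_pi1_mem.
have WU u : u \in W -> u \in U by apply/subvP/diffvSl.
have pid u : u \in W -> p u = u by move=> uW; apply: daddv_pi_id; first exact: capv_diff.
have bW (i : 'I_(\dim W)) : b i \in W by apply/vbasis_mem/memt_nth.
have pmod u v : u - v \in h -> p u = p v.
  by move=> /(addv_pi1_ker U)/eqP; rewrite linearB subr_eq0 => /eqP.
have fD u v : f (u - v) = f u - f v.
  by rewrite -scaleN1r addrC lf scaleN1r addrC.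
have pf u : u \in U -> p (f u) = p (f (p u)).
  move=> uU; apply: pmod; rewrite -fD; apply: fh; last exact: addv_pi1_mod.
  by rewrite memvB // WU.
pose y' i := p (y i).
have combp m (M : 'M_(m, d)) i : p (comb M y i) = comb M y' i.
  by rewrite linear_sum; apply: eq_bigr => j _; apply: linearZ.
have yspan' u : exists c : 'I_d -> F, u \in W -> u = \sum_i c i *: y' i.
  have [uW|_] := boolP (u \in W); last by exists (fun=> 0).
  have [c uc] := yspan _ (WU _ uW); exists c => _.
  rewrite -{1}(pid _ uW) (pmod _ _ uc) linear_sum; apply: eq_bigr => i _; exact: linearZ.
have [c cP] := choice yspan'.
pose T := \matrix_(i < \dim W, j < \dim W) coord (vbasis W) j (p (f (b i))).
transitivity (\tr T); first by apply: eq_bigr => i _; rewrite mxE.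
symmetry; apply: (@trace_basis F g (fun u => p (f u)) d (\dim W) y' (fun i => b i)
   (\matrix_(i, j) c (b i) j) (\matrix_(i, j) coord (vbasis W) j (y' i)) A T).
- by move=> e u v; rewrite lf linearP.
- move=> e e0; apply: yind; apply: (@addv_pi1_eq0 U).
    by apply: memv_suml => i _; rewrite memvZ.
  by rewrite -[RHS]e0 linear_sum; apply: eq_bigr => i _; apply: linearZ.
- exact: vbasis_independent.
- move=> i; rewrite {1}(cP (b i) (bW i)); apply: eq_bigr => j _; by rewrite mxE.
- move=> i; rewrite /comb {1}(coord_vbasis (pW (y i) : y' i \in W)); apply: eq_bigr => j _; by
  rewrite mxE.
- by move=> i; rewrite -pf // (pmod _ _ (yA i)) combp.
- move=> i; rewrite /comb {1}(coord_vbasis (pW (f (b i)))); apply: eq_bigr => j _; by rewrite mxE.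
Qed.

Lemma trq_rank1 U h f (l : 'Hom(g, F^o)) y : y \in U ->
  (forall r, r \in U -> f r - l r *: y \in h) ->
  (forall a, a \in U -> a \in h -> l a = 0) -> trq U h f = l y.
Proof.
move=> yU fl lh; rewrite /trq; set W := (U :\: h)%VS; set p := addv_pi1 U h.
have bU (i : 'I_(\dim W)) : (vbasis W)`_i \in U.
  by apply: (subvP (diffvSl U h)); apply/vbasis_mem/memt_nth.
transitivity (l (p y)); last first.
  have : l (y - p y) = 0.
    apply: lh; last exact: addv_pi1_mod.
    by rewrite memvB // (subvP (diffvSl U h)) // addv_pi1_mem.
  by rewrite linearB => /eqP; rewrite subr_eq0 => /eqP ->.
rewrite [in RHS](coord_vbasis (addv_pi1_mem U h y)) linear_sum; apply: eq_bigr => i _.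
rewrite linearZ /= [RHS]mulrC; have /(addv_pi1_ker U)/eqP := fl _ (bU i).
by rewrite linearB linearZ /= subr_eq0 => /eqP ->; rewrite linearZ.
Qed.

(** In a basis of a complement of h + <y> followed by y, the matrix of f modulo h is block
    triangular with last diagonal entry c. *)
Lemma trq_step U h f y c : linear f -> (forall u, u \in U -> f u \in U) ->
  (forall a, a \in U -> a \in h -> f a \in h) -> y \in U -> y \notin h ->
  f y - c *: y \in h -> trq U h f = trq U (h + <[y]>)%VS f + c.
Proof.
move=> lf fU fh yU yh fy; set k := (h + <[y]>)%VS; pose W := (U :\: k)%VS.
pose b (i : 'I_(\dim W)) := (vbasis W)`_i; pose p := addv_pi1 U k.
have bW i : b i \in W by apply/vbasis_mem/memt_nth.
have bU i : b i \in U by apply: (subvP (diffvSl U k)).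
pose T := \matrix_(i < \dim W, j < \dim W) coord (vbasis W) j (p (f (b i))).
have TE i : p (f (b i)) = comb T b i.
  by rewrite {1}(coord_vbasis (addv_pi1_mem U k (f (b i)))); apply: eq_bigr => j _; rewrite mxE.
have kE u : u \in k -> exists d, u - d *: y \in h.
  by move=> /memv_addP[a ah [_ /vlineP[d ->] ->]]; exists d; rewrite addrK.
have /choice[s sP] i : exists d, f (b i) - comb T b i - d *: y \in h.
  by apply: kE; rewrite -TE; apply: addv_pi1_mod; apply: fU.
rewrite (@trq_basis U h f _ (family_cat b (fun _ : 'I_1 => y))
   (block_mx T (\col_i s i) 0 c%:M)) //.
- by rewrite mxtrace_block mxtrace_scalar mulr1n; congr (_ + _); apply: eq_bigr => i _; rewrite mxE.
- by move=> i; rewrite /family_cat; case: (split i).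
- move=> i; case: (split_ordP i) => j -> {i}.
    rewrite family_catl /comb sum_family_cat big_ord1.
    have -> : \sum_i block_mx T (\col_i0 s i0) 0 c%:M (lshift 1 j) (lshift 1 i) *: b i = comb T b j.
      by apply: eq_bigr => i _; rewrite block_mxEul.
    by rewrite block_mxEur mxE opprD addrA.
  rewrite family_catr /comb sum_family_cat big_ord1 big1 => [|i _].
    by rewrite block_mxEdr ord1 mxE eqxx mulr1n add0r.
  by rewrite block_mxEdl mxE scale0r.
- move=> u uU; have [d dP] := kE _ (addv_pi1_mod k uU).
  exists (fun i => match split i with inl j => coord (vbasis W) j (p u) | inr _ => d end).
  rewrite sum_family_cat big_ord1 (unsplitK (inr _)).
  have -> : \sum_i match split (lshift 1 i) with
     inl j => coord (vbasis W) j (p u) | inr _ => d end *: b i = p u.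
    rewrite [RHS](coord_vbasis (addv_pi1_mem U k u)).
    by apply: eq_bigr => i _; rewrite (unsplitK (inl _)).
  by rewrite opprD addrA.
move=> e; rewrite sum_family_cat big_ord1.
set sb := \sum_i _ => sh.
have sb0 : sb = 0.
  apply/eqP; rewrite -memv0 -(capv_diff U k) memv_cap memv_suml /=; last first.
    by move=> i _; rewrite memvZ.
  rewrite -[sb](addrK (e (rshift (\dim W) ord0) *: y)) memvB //.
    exact: (subvP (addvSl _ _)).
  by rewrite memvZ // (subvP (addvSr _ _)) // memv_line.
have el i : e (lshift 1 i) = 0.
  by apply: (@vbasis_independent W (fun i => e (lshift 1 i))).
move=> i; case: (split_ordP i) => j -> {i} //; rewrite ord1.
move: sh; rewrite sb0 add0r => ey; apply: contraNeq yh => e0.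
by rewrite -(scalerK e0 y) memvZ.
Qed.

Lemma trq_full U h f : (U <= h)%VS -> trq U h f = 0.
Proof.
move=> Uh; rewrite /trq; move: (vbasis _); have -> : (U :\: h = 0)%VS.
  apply/eqP; rewrite -subv0 -(capv_diff U h); apply/subvP => x xW.
  by rewrite memv_cap xW (subvP Uh) // (subvP (diffvSl U h)).
by rewrite dimv0 => b; rewrite big_ord0.
Qed.

End QuotientTrace.

(** * Submodules of the odd part *)

Section OddPart.
Variables (F : numClosedFieldType) (g : lieSuperalg F).
Implicit Types (H K h : {vspace g}) (l w : 'Hom(g, F^o)) (x y z r : g).
Local Notation g0 := (gr g false).
Local Notation g1 := (gr g true).

Lemma br00 z z' : z \in g0 -> z' \in g0 -> br z z' \in g0. Proof. exact: br_gr. Qed.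
Lemma br01 z x : z \in g0 -> x \in g1 -> br z x \in g1. Proof. exact: br_gr. Qed.
Lemma br11 x y : x \in g1 -> y \in g1 -> br x y \in g0. Proof. exact: br_gr. Qed.

Lemma brC1 x y : x \in g1 -> y \in g1 -> br x y = br y x.
Proof. by move=> x1 y1; rewrite (br_anti x1 y1) expr1 scaleN1r opprK. Qed.

Lemma brC0 b z u : z \in g0 -> u \in gr g b -> br z u = - br u z.
Proof. by move=> z0 ub; rewrite (br_anti z0 ub) expr0 scale1r. Qed.

Lemma jacobi0 b z y u : z \in g0 -> y \in gr g b ->
  br z (br y u) = br (br z y) u + br y (br z u).
Proof. by move=> z0 yb; rewrite (br_jacobi u z0 yb) expr0 scale1r. Qed.

Lemma jacobi1 x y u : x \in g1 -> y \in g1 -> br x (br y u) = br (br x y) u - br y (br x u).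
Proof. by move=> x1 y1; rewrite (br_jacobi u x1 y1) expr1 scaleN1r. Qed.

Lemma jacobi_odd x y r : x \in g1 -> y \in g1 -> r \in g1 ->
  br (br x y) r = - br (br y r) x - br (br r x) y.
Proof.
move=> x1 y1 r1; rewrite (brC0 (br11 y1 r1) x1) opprK jacobi1 // (brC1 r1 x1).
by rewrite (brC0 (br11 x1 r1) y1) opprK subrK.
Qed.

Lemma br_linear x : linear (br x). Proof. exact: br_linr. Qed.

Lemma memv_add_line H y u : u \in (H + <[y]>)%VS -> exists2 a, a \in H & exists c, u = a + c *: y.
Proof. by move=> /memv_addP[a aH [_ /vlineP[c ->] ->]]; exists a => //; exists c. Qed.

Lemma add_line_mem H y a c : a \in H -> a + c *: y \in (H + <[y]>)%VS.
Proof. by move=> aH; apply: memv_add => //; rewrite memvZ ?memv_line. Qed.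

Lemma dim_add_line H y : y \notin H -> \dim (H + <[y]>)%VS = (\dim H).+1.
Proof.
move=> yH; rewrite dimv_disjoint_sum ?dim_vline.
  by rewrite (_ : y != 0) ?addn1 //; apply: contraNneq yH => ->; rewrite mem0v.
apply/eqP; rewrite -subv0; apply/subvP => u; rewrite memv_cap => /andP[uH /vlineP[c uc]].
rewrite memv0 uc; have [->|c0] := eqVneq c 0; first by rewrite scale0r.
by case/negP: yH; rewrite -(scalerK c0 y) -uc memvZ.
Qed.

Lemma scale_notin H y c : y \notin H -> c *: y \in H -> c = 0.
Proof. by move=> yH; apply: contraTeq => c0; apply: contra yH => yc; rewrite -(scalerK c0 y)
  memvZ. Qed.

Definition gmod H : Prop := (H <= g1)%VS /\ forall z a, z \in g0 -> a \in H -> br z a \in H.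

Definition eigen H y w : Prop := forall z, z \in g0 -> br z y - w z *: y \in H.

Lemma gmod_odd H a : gmod H -> a \in H -> a \in g1. Proof. by case=> /subvP H1 _; apply: H1. Qed.

Lemma gmod_cap H K : gmod H -> gmod K -> gmod (H :&: K).
Proof.
move=> [H1 Hs] [K1 Ks]; split; first exact: subv_trans (capvSl _ _) H1.
by move=> z a z0; rewrite !memv_cap => /andP[aH aK]; rewrite Hs ?Ks.
Qed.

Lemma gmod0 : gmod 0%VS.
Proof. by split=> [|z a _]; rewrite ?sub0v // !memv0 => /eqP ->; rewrite br0r. Qed.

Lemma gmod1 : gmod g1. Proof. by split=> // z a; apply: br01. Qed.

Lemma gmod_add_line H y w : gmod H -> y \in g1 -> eigen H y w -> gmod (H + <[y]>)%VS.
Proof.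
move=> [H1 Hs] y1 ey; split; first by rewrite subv_add H1 -memvE.
move=> z a z0 /memv_add_line[b bH [c ->]].
have -> : br z (b + c *: y) = (br z b + c *: (br z y - w z *: y)) + (c * w z) *: y.
  by rewrite brDr brZr; lmodule F.
by apply: add_line_mem; rewrite memvD ?memvZ ?Hs // ey.
Qed.

Lemma gmod_br H x y a : gmod H -> x \in g1 -> y \in g1 -> a \in H -> br (br x y) a \in H.
Proof. by move=> [_ Hs] x1 y1; apply: Hs; apply: br11. Qed.

Lemma eigen_character H y w : gmod H -> y \in g1 -> y \notin H -> eigen H y w ->
  forall z z', z \in g0 -> z' \in g0 -> w (br z z') = 0.
Proof.
move=> [H1 Hs] y1 yH ey z z' z0 z0'; apply: (scale_notin yH).
have -> : w (br z z') *: y = - (br (br z z') y - w (br z z') *: y) +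
    (br z (br z' y - w z' *: y) + w z' *: (br z y - w z *: y)) -
    (br z' (br z y - w z *: y) + w z *: (br z' y - w z' *: y)).
  rewrite -!scaleN1r !(brDr, brZr) (jacobi0 y z0 z0'); lmodule F.
by rewrite memvB ?memvD ?memvN ?memvZ ?Hs ?ey // br00.
Qed.

Section Solvable.
Hypothesis solv : solvable_lsa g.

Lemma finspan_vspace (A : g -> Prop) K : subspace A -> finspan A (fun x => x \in K).
Proof.
move=> sA; exists (\dim K), (fun i => (vbasis K)`_i) => u uK.
exists (fun i => coord (vbasis K) i u); rewrite -coord_vbasis // subrr; exact: subspace0 sA.
Qed.

(** Lie's theorem for the adjoint action of g0 on K, modulo H. *)
Lemma gmod_eigen H K : gmod H -> gmod K -> ~~ (K <= H)%VS ->
  exists y w, [/\ y \in K, y \notin H, eigen H y w & inL w].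
Proof.
move=> gH gK /subvPn[u uK uH]; have [n sn] := solv.
have [||||||||||y [yK yH ey]] := @lie_eigenvector F g g (@br F g) (@br_linr F g) (@br_linl F g) _
   (fun x => x \in H) (subspace_mem H) n g0 (fun x => x \in K) u.
- move=> x y v x0 y0; rewrite (jacobi0 v x0 y0) addrK //.
- exact: subvv.
- exact: br00.
- by apply/eqP; rewrite -subv0 -sn; apply: iter_brvS; apply: subvf.
- by move=> a v a0; apply: gH.2.
- exact: subspace_mem.
- by move=> a v a0; apply: gK.2.
- exact: finspan_vspace (subspace_mem H).
- exact: uK.
- exact/negP.
move/negP: yH => yH.
have [phi phiy phiH] := separating_form yH.
(* phi reads off the coefficient of y, and [even_part] makes w vanish on g1, as membership in L
   requires. *)
have [|w wE] := @hom_of_linear F g (fun z => phi (br (even_part z) y)).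
  move=> c z z'; rewrite /even_part linearP brDl brZl linearP //.
have ew : eigen H y w.
  move=> z z0; have [c cz] := ey z z0; rewrite wE even_part_id //.
  suff -> : phi (br z y) = c by [].
  by have := phiH _ cz; rewrite linearB linearZ /= phiy => /eqP; rewrite subr_eq0 [_ *: _]mulr1
    => /eqP.
exists y, w; split=> //; split=> [x x1|]; first by rewrite wE even_part0 // br0l linear0.
exact: (@eigen_character H y w gH (gmod_odd gK yK) yH ew).
Qed.

(** The head of s is the top step, so an induction on s adds one weight vector above a smaller flag
    with the same bottom H. *)
Fixpoint flag_top H (s : seq (g * 'Hom(g, F^o))) : {vspace g} :=
  if s is yw :: s' then (flag_top H s' + <[yw.1]>)%VS else H.

Fixpoint is_flag H (s : seq (g * 'Hom(g, F^o))) : Prop :=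
  if s is yw :: s' then [/\ is_flag H s', yw.1 \in g1, yw.1 \notin flag_top H s' &
                            eigen (flag_top H s') yw.1 yw.2]
  else True.

Lemma gmod_flag H s : gmod H -> is_flag H s -> gmod (flag_top H s).
Proof.
by move=> gH; elim: s => //= -[y w] s IH [/IH gY y1 _ ey]; apply: gmod_add_line ey.
Qed.

Lemma flag_top_sub H s : (H <= flag_top H s)%VS.
Proof. by elim: s => //= yw s IH; apply: subv_trans (addvSl _ _). Qed.

Lemma flag_exists H K : gmod H -> gmod K -> (H <= K)%VS ->
  exists s, is_flag H s /\ flag_top H s = K.
Proof.
move=> gH gK HK.
(* A flag short of K can be lengthened, so either K is reached or the dimension passes any bound n;
   the bound dim K + 1 leaves only the first case. *)
suff ext n : exists s, [/\ is_flag H s, (flag_top H s <= K)%VS &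
    (flag_top H s == K) || (n <= \dim (flag_top H s))%N].
  have [s [fs sK /orP[/eqP sE|]]] := ext (\dim K).+1; first by exists s.
  by rewrite ltnNge dimvS.
elim: n => [|n [s [fs sK]]]; first by exists [::]; rewrite orbT.
have [sE _|sE /= dn] := boolP (flag_top H s == K); first by exists s; rewrite sE.
have gs := gmod_flag gH fs.
have [|y [w [yK ys ey _]]] := @gmod_eigen (flag_top H s) K gs gK.
  by apply: contra sE => Ks; rewrite eqEsubv sK Ks.
exists ((y, w) :: s); split=> /=; first by split=> //; apply: gmod_odd yK.
  by rewrite subv_add sK -memvE.
by rewrite dim_add_line // ltnS dn orbT.
Qed.

End Solvable.

(** The trace of ad z on g1/H. For h = g0 + H the quotient g/h is purely odd, so theta_h is -tau/2
    on g0. *)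
Definition tau H z : F := trq g1 H (br z).

Lemma tau_step H y c z : gmod H -> z \in g0 -> y \in g1 -> y \notin H ->
  br z y - c *: y \in H -> tau H z = tau (H + <[y]>)%VS z + c.
Proof.
move=> gH z0 y1 yH ey; apply: trq_step => //; first exact: br_linear.
  by move=> u; apply: br01.
by move=> a _; apply: gH.2.
Qed.

Lemma tau_flag H s z : gmod H -> is_flag H s -> flag_top H s = g1 -> z \in g0 ->
  tau H z = \sum_(yw <- s) yw.2 z.
Proof.
move=> gH fs sE z0.
suff -> : tau H z = tau (flag_top H s) z + \sum_(yw <- s) yw.2 z.
  by rewrite sE /tau trq_full ?add0r.
elim: s fs {sE} => [|[y w] s IH] /=; first by rewrite big_nil addr0.
case=> fs y1 ys ey; rewrite IH // big_cons (tau_step (gmod_flag gH fs) z0 y1 ys (ey z z0)).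
by rewrite -addrA.
Qed.

(** By Jacobi [[x,x'],r] = -[[x',r],x] - [[r,x],x'] lies in H, so the operator is zero on g1/H. *)
Lemma tau_isotropic H x x' : gmod H -> x \in H -> x' \in H -> tau H (br x x') = 0.
Proof.
move=> gH xH xH'; have x1 := gmod_odd gH xH; have x1' := gmod_odd gH xH'.
rewrite /tau (@trq_rank1 F g g1 H (br (br x x')) 0 0) ?mem0v ?lfunE //.
  move=> r r1; rewrite scaler0 subr0 jacobi_odd //.
  by rewrite memvB ?memvN ?gmod_br.
by move=> a _ _; rewrite lfunE.
Qed.

(* By the Jacobi identity, br x y acts on g1 / H with rank at most one in the two cases below. *)
Lemma tau_rank1 H x y w c : gmod H -> x \in g1 -> y \in g1 -> y \notin H ->
  (forall r, r \in g1 -> br (br x y) r + (c * w (br x r)) *: y \in H) -> w (br x y) = 0 ->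
  tau H (br x y) = 0.
Proof.
move=> gH x1 y1 yH op w0.
have [|l lE] := @hom_of_linear F g (fun r => - (c * w (br x r))).
  by move=> d r r'; rewrite brDr brZr linearP mulrDr opprD mulrN mulrCA.
rewrite /tau (@trq_rank1 F g g1 H _ l y) //; first by rewrite lE w0 mulr0 oppr0.
  by move=> r r1; rewrite lE scaleNr opprK op.
move=> a a1 aH; apply: (scale_notin yH).
have -> : l a *: y = br (br x y) a - (br (br x y) a + (c * w (br x a)) *: y).
  by rewrite lE; lmodule F.
by rewrite memvB ?op // gmod_br.
Qed.

(** Modulo H, Jacobi gives [[x,y],r] = -w([x,r]) y. For r = y this is -w([x,y]) y, but also w([x,y])
    y since y is an eigenvector; hence w([x,y]) = 0. *)
Lemma tau_eigen H x y w : gmod H -> y \in g1 -> y \notin H -> eigen H y w -> x \in H ->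
  tau H (br x y) = 0.
Proof.
move=> gH y1 yH ey xH; have x1 := gmod_odd gH xH.
have op r : r \in g1 -> br (br x y) r + (1 * w (br x r)) *: y \in H.
  move=> r1; rewrite jacobi_odd // (brC1 r1 x1).
  have -> : - br (br y r) x - br (br x r) y + (1 * w (br x r)) *: y =
    - br (br y r) x - (br (br x r) y - w (br x r) *: y) by lmodule F.
  by rewrite memvB ?memvN ?gmod_br // ey // br11.
apply: (tau_rank1 gH x1 y1 yH op).
have e : 2%:R * w (br x y) = 0.
  apply: (scale_notin yH).
  have -> : (2%:R * w (br x y)) *: y = (br (br x y) y + (1 * w (br x y)) *: y) -
     (br (br x y) y - w (br x y) *: y) by lmodule F.
  by rewrite memvB ?op // ey // br11.
by move/eqP: e; rewrite mulf_eq0 pnatr_eq0 => /eqP.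
Qed.

(** Here [[y,y],r] = -2 w([y,r]) y modulo H, and Jacobi gives 3 [[y,y],y] = 0, whence w([y,y]) =
    0. *)
Lemma tau_eigen_sq H y w : gmod H -> y \in g1 -> y \notin H -> eigen H y w ->
  tau H (br y y) = 0.
Proof.
move=> gH y1 yH ey.
have op r : r \in g1 -> br (br y y) r + (2%:R * w (br y r)) *: y \in H.
  move=> r1; rewrite jacobi_odd // (brC1 r1 y1).
  have -> : - br (br y r) y - br (br y r) y + (2%:R * w (br y r)) *: y =
    (-2%:R) *: (br (br y r) y - w (br y r) *: y) by lmodule F.
  by rewrite memvZ // ey // br11.
apply: (tau_rank1 gH y1 y1 yH op).
apply: (scale_notin yH).
have yy0 : br (br y y) y = 0.
  have /eqP := jacobi_odd y1 y1 y1; rewrite -subr_eq0.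
  have -> : br (br y y) y - (- br (br y y) y - br (br y y) y) = 3%:R *: br (br y y) y by lmodule F.
  by rewrite scaler_eq0 pnatr_eq0 => /eqP.
have -> : w (br y y) *: y = - (br (br y y) y - w (br y y) *: y) by rewrite yy0; lmodule F.
by rewrite memvN ey // br11.
Qed.

Lemma theta_even h z : (g0 <= h)%VS -> z \in g0 -> theta h z = - (2^-1 * tau h z).
Proof.
move=> h0 z0; rewrite thetaE even_part_id // /str_ad (trq_full _ h0) sub0r mulrN //.
Qed.

Lemma theta_odd h x : x \in g1 -> theta h x = 0.
Proof.
move=> x1; rewrite thetaE even_part0 // /str_ad /trq.
by rewrite !big1 ?subrr ?mulr0 // => i _; rewrite br0l !linear0.
Qed.

(** * Isotropic submodules *)

Lemma inL_even l x : inL l -> x \in g1 -> l x = 0. Proof. by case=> h _; apply: h. Qed.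

Lemma inL_br l z z' : inL l -> z \in g0 -> z' \in g0 -> l (br z z') = 0.
Proof. by case=> _; apply. Qed.

Lemma fform_inv l z x y : inL l -> z \in g0 -> x \in g1 -> y \in g1 ->
  l (br (br z x) y) = - l (br x (br z y)).
Proof.
move=> Ll z0 x1 y1; apply/eqP; rewrite -addr_eq0 -[_ + _]linearD /=.
by rewrite -(jacobi0 _ z0 x1) inL_br // br11.
Qed.

Lemma perp_subproof l H : subspace (fun r => r \in g1 /\ forall x, x \in H -> l (br x r) = 0).
Proof.
split=> [|c u v [u1 hu] [v1 hv]].
  by split=> [|x _]; rewrite ?mem0v ?br0r ?linear0.
by split=> [|x xH]; rewrite ?memvD ?memvZ // brDr brZr linearP /= hu // hv // addr0 [_ *: _]mulr0.
Qed.

Definition perp l H : {vspace g} := sval (cid (vspace_of_subspace (perp_subproof l H))).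

Lemma perpP l H r : r \in perp l H <-> r \in g1 /\ forall x, x \in H -> l (br x r) = 0.
Proof. exact: (svalP (cid (vspace_of_subspace (perp_subproof l H)))). Qed.

Lemma perp_odd l H r : r \in perp l H -> r \in g1. Proof. by move/perpP=> []. Qed.

Lemma perp_orth l H x r : x \in H -> r \in perp l H -> l (br x r) = 0.
Proof. by move=> xH /perpP[_]; apply. Qed.

Lemma gmod_perp l H : inL l -> gmod H -> gmod (perp l H).
Proof.
move=> Ll gH; split; first by apply/subvP => r /perp_odd.
move=> z a z0 aP; have a1 := perp_odd aP; apply/perpP; split; first exact: br01.
move=> x xH; apply/eqP; rewrite -oppr_eq0 -fform_inv // ?(gmod_odd gH) //; apply/eqP.
by apply: perp_orth aP; apply: gH.2.
Qed.

Lemma isotropic_perp l H V : isotropic l V -> (H <= V)%VS -> (V <= perp l H)%VS.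
Proof.
move=> [V1 Vi] /subvP HV; apply/subvP => r rV; apply/perpP; split; first exact: (subvP V1).
by move=> x /HV xV; apply: Vi.
Qed.

Lemma isotropic_add_line l H r : isotropic l H -> r \in perp l H -> l (br r r) = 0 ->
  isotropic l (H + <[r]>)%VS.
Proof.
move=> [H1 Hi] rP rr; have r1 := perp_odd rP; split; first by rewrite subv_add H1 -memvE.
move=> _ _ /memv_add_line[a aH [c ->]] /memv_add_line[b bH [d ->]].
rewrite /fform !(brDl, brDr, brZl, brZr) !linearD !linearZ /= rr -[l (br a b)]/(fform l a b) Hi //.
rewrite (perp_orth aH rP) (brC1 r1 (subvP H1 _ bH)) (perp_orth bH rP).
by rewrite !scaler0 !addr0.
Qed.

Lemma max_isotropic_perp l H r : max_isotropic l H -> r \in perp l H -> l (br r r) = 0 -> r \in H.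
Proof.
move=> [iH mH] rP rr; rewrite -(mH _ (isotropic_add_line iH rP rr) (addvSl _ _)).
by rewrite (subvP (addvSr _ _)) // memv_line.
Qed.

Lemma max_isotropic_sub l H : max_isotropic l H -> (H <= perp l H)%VS.
Proof. by case=> iH _; apply: isotropic_perp. Qed.

(** Invariance and symmetry give f_l([z,y], y) = 0, while [z,y] = cy modulo H and y is orthogonal to
    H. *)
Lemma zero_weight l H y c z : inL l -> gmod H -> isotropic l H -> z \in g0 -> y \in perp l H ->
  l (br y y) != 0 -> br z y - c *: y \in H -> c = 0.
Proof.
move=> Ll gH iH z0 yP yy ec; have y1 := perp_odd yP; have zy1 := br01 z0 y1.
have e : l (br (br z y) y) = 0.
  have /eqP := fform_inv Ll z0 y1 y1; rewrite (brC1 y1 zy1) -addr_eq0 -mulr2n -mulr_natr.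
  by rewrite mulf_eq0 pnatr_eq0 orbF => /eqP.
have /eqP := perp_orth ec yP; rewrite brDl -scaleNr brZl linearD linearZ /= e add0r.
by rewrite [_ *: _]mulNr oppr_eq0 mulf_eq0 (negPf yy) orbF => /eqP.
Qed.

Lemma isotropic_combination (a b : F) : b != 0 -> exists s, a + s ^+ 2 * b = 0.
Proof.
by move=> b0; exists (sqrtC (- a / b)); rewrite sqrtCK divfK // subrr.
Qed.

(* perp l H / H is an anisotropic form, and over a closed field a plane contains isotropic
   vectors. *)
Lemma perp_cases l H : inL l -> gmod H -> max_isotropic l H ->
  perp l H = H \/
  exists y, [/\ y \notin H, perp l H = (H + <[y]>)%VS, l (br y y) != 0 &
                forall z, z \in g0 -> br z y \in H].
Proof.
move=> Ll gH mH; have sHP := max_isotropic_sub mH.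
have [PH|/subvPn[y yP yH]] := boolP (perp l H <= H)%VS.
  by left; apply/eqP; rewrite eqEsubv PH.
have y1 := perp_odd yP.
have yy : l (br y y) != 0 by apply: contra yH => /eqP; apply: max_isotropic_perp yP.
have yline : (H + <[y]> <= perp l H)%VS by rewrite subv_add sHP -memvE.
have PE : perp l H = (H + <[y]>)%VS.
  apply/eqP; rewrite eqEsubv yline andbT; apply/subvP => r rP; have r1 := perp_odd rP.
  have [u uE] : exists u, u = r - (l (br r y) / l (br y y)) *: y by eexists.
  have uy : l (br u y) = 0.
    rewrite uE brDl -scaleNr brZl linearD linearZ /= [_ *: _]mulNr divfK // subrr //.
  have uP : u \in perp l H by rewrite uE memvB ?memvZ.
  have u1 := perp_odd uP.
  have [s sE] := isotropic_combination (l (br u u)) yy.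
  have vP : u + s *: y \in perp l H by rewrite memvD ?memvZ.
  have vH : u + s *: y \in H.
    apply: (max_isotropic_perp mH vP).
    rewrite !(brDl, brDr, brZl, brZr) !linearD !linearZ /= (brC1 y1 u1) uy.
    by rewrite !scaler0 addr0 add0r -[RHS]sE scalerA expr2.
  have -> : r = (u + s *: y) + (l (br r y) / l (br y y) - s) *: y by rewrite uE; lmodule F.
  exact: add_line_mem.
right; exists y; split=> // z z0.
have := (gmod_perp Ll gH).2 z y z0 yP; rewrite PE => /memv_add_line[a aH [c zy]].
have -> : br z y = a + c *: y by [].
suff -> : c = 0 by rewrite scale0r addr0.
by apply: (zero_weight Ll gH mH.1 z0 yP yy); rewrite zy addrK.
Qed.

Section Extension.
Hypothesis solv : solvable_lsa g.

(** [max_isotropic] compares with all subspaces; this lemma shows that comparing with submodules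
    suffices. An eigenvector y of H^perp modulo H works if it is isotropic. Otherwise it has weight
    0, so its orthogonal in H^perp is a submodule, not contained in H. An eigenvector u there is
    isotropic, or also has weight 0, and then some u + sy is isotropic of weight 0. *)
Lemma isotropic_extend l H : inL l -> gmod H -> isotropic l H -> ~ max_isotropic l H ->
  exists y w, [/\ y \in g1, y \notin H, eigen H y w, inL w & isotropic l (H + <[y]>)%VS].
Proof.
move=> Ll gH iH nmH; have gP := gmod_perp Ll gH; have sHP : (H <= perp l H)%VS := isotropic_perp
  iH (subvv H).
have [V [iV HV VH]] : exists V, [/\ isotropic l V, (H <= V)%VS & ~~ (V <= H)%VS].
  apply: contrapT => nV; apply: nmH; split=> // V iV HV; apply/eqP; rewrite eqEsubv HV andbT.
  by apply: contrapT => /negP VH; apply: nV; exists V.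
have VP := isotropic_perp iV HV.
have [|y [w [yP yH ey Lw]]] := gmod_eigen solv gH gP.
  by apply: contra VH; apply: subv_trans.
have y1 := perp_odd yP.
have [yy|yy] := eqVneq (l (br y y)) 0.
  by exists y, w; split=> //; apply: isotropic_add_line.
pose B := (perp l H :&: perp l <[y]>)%VS.
have memB u : u \in B <-> u \in perp l H /\ l (br y u) = 0.
  rewrite memv_cap; split=> [/andP[uP uy]|[uP uy]].
    by split=> //; apply: perp_orth uy; apply: memv_line.
  rewrite uP; apply/perpP; split; first exact: perp_odd uP.
  by move=> _ /vlineP[c ->]; rewrite brZl linearZ /= uy [_ *: _]mulr0.
have zyH z : z \in g0 -> br z y \in H.
  move=> z0; have := ey z z0; rewrite (zero_weight Ll gH iH z0 yP yy (ey z z0)).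
  by rewrite scale0r subr0.
have gB : gmod B.
  split; first exact: subv_trans (capvSl _ _) gP.1.
  move=> z a z0 /memB[aP ay]; apply/memB; split; first exact: gP.2.
  apply/eqP; rewrite -oppr_eq0 -fform_inv // ?(perp_odd aP) //; apply/eqP.
  by apply: perp_orth aP; apply: zyH.
have /subvPn[r rV rH] := VH.
have BH : ~~ (B <= H)%VS.
  (* The component orthogonal to y of a vector r of V outside H. If it were in H, isotropy of r
     would force r = u. *)
  pose u := r - (l (br y r) / l (br y y)) *: y.
  apply/subvPn; exists u.
    apply/memB; split; first by rewrite memvB ?memvZ // (subvP VP).
    by rewrite /u brDr -scaleNr brZr linearD linearZ /= [_ *: _]mulNr divfK // subrr.
  apply: contra rH => uH.
  have rE : r = u + (l (br y r) / l (br y y)) *: y by rewrite /u subrK.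
  suff e : l (br y r) = 0 by rewrite rE e mul0r scale0r addr0.
  have := iV.2 r r rV rV; rewrite /fform {1}rE brDl brZl linearD linearZ /=.
  have -> : l (br u r) = 0 by apply: perp_orth uH _; apply: (subvP VP).
  rewrite add0r => /eqP; rewrite [_ *: _]mulrAC -expr2 mulf_eq0 invr_eq0 (negPf yy) orbF.
  by rewrite sqrf_eq0 => /eqP.
have [u [w1 [uB uH eu Lw1]]] := gmod_eigen solv gH gB BH.
have /memB[uP yu] := uB; have u1 := perp_odd uP.
have [uu|uu] := eqVneq (l (br u u)) 0.
  by exists u, w1; split=> //; apply: isotropic_add_line.
have [s sE] := isotropic_combination (l (br u u)) yy.
have s0 : s != 0 by apply: contraNneq uu => s0; rewrite -sE s0 expr0n /= mul0r addr0.
exists (u + s *: y), w1; split.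
- by rewrite memvD ?memvZ.
- apply/negP => vH; have := perp_orth vH yP.
  rewrite brDl brZl linearD linearZ /= (brC1 u1 y1) yu add0r => /eqP.
  by rewrite mulf_eq0 (negPf s0) (negPf yy).
- move=> z z0; have w10 : w1 z = 0 := zero_weight Ll gH iH z0 uP uu (eu z z0).
  rewrite w10 scale0r subr0 brDr brZr memvD ?memvZ ?zyH //.
  by have := eu z z0; rewrite w10 scale0r subr0.
- by [].
- apply: isotropic_add_line => //; first by rewrite memvD ?memvZ.
  rewrite !(brDl, brDr, brZl, brZr) !linearD !linearZ /= (brC1 u1 y1) yu.
  by rewrite !scaler0 addr0 add0r -[RHS]sE scalerA expr2.
Qed.

Lemma max_isotropic_exists l : inL l -> exists H, gmod H /\ max_isotropic l H.
Proof.
move=> Ll; apply: contrapT => nH.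
suff ext n : exists H, [/\ gmod H, isotropic l H & (n <= \dim H)%N].
  have [H [_ _]] := ext (\dim {:g}).+1; rewrite ltnNge dimvS //; exact: subvf.
elim: n => [|n [H [gH iH dH]]].
  exists 0%VS; split=> //; first exact: gmod0.
  by split=> [|x y]; rewrite ?sub0v // memv0 => /eqP -> _; rewrite /fform br0l linear0.
have [|y [w [y1 yH ey _ iy]]] := isotropic_extend Ll gH iH.
  by move=> mH; apply: nH; exists H.
exists (H + <[y]>)%VS; split=> //; first exact: gmod_add_line ey.
by rewrite dim_add_line.
Qed.

End Extension.

End OddPart.

(** * Polarizations *)

Section Polarizations.
Variables (F : numClosedFieldType) (g : lieSuperalg F).
Implicit Types (H K h : {vspace g}) (l w : 'Hom(g, F^o)) (x y z r : g).
Local Notation g0 := (gr g false).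
Local Notation g1 := (gr g true).
Hypothesis solv : solvable_lsa g.

Lemma homvD l x y : l (x + y) = l x + l y :> F. Proof. by rewrite linearD. Qed.
Lemma homvZ l c x : l (c *: x) = c * l x :> F. Proof. by rewrite linearZ. Qed.
Lemma homvB l x y : l (x - y) = l x - l y :> F. Proof. by rewrite linearB. Qed.

Lemma memv_add0 H x : (H <= g1)%VS -> x \in (g0 + H)%VS -> odd_part x \in H.
Proof.
move=> H1 /memv_addP[a a0 [b bH ->]]; rewrite /odd_part linearD /=.
by rewrite -!/(odd_part _) odd_part0 // odd_part_id ?add0r // (subvP H1).
Qed.

Lemma add0_cap H : (H <= g1)%VS -> ((g0 + H) :&: g1 = H)%VS.
Proof.
move=> H1; apply/eqP; rewrite eqEsubv subv_cap addvSr H1 !andbT.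
by apply/subvP => x; rewrite memv_cap => /andP[/(memv_add0 H1) + x1]; rewrite odd_part_id.
Qed.

Lemma add0_odd H x : (H <= g1)%VS -> x \in (g0 + H)%VS -> x \in g1 -> x \in H.
Proof. by move=> H1 xh x1; rewrite -(add0_cap H1) memv_cap xh. Qed.

Lemma polarization_gmod l h : polarization l h ->
  [/\ gmod (h :&: g1)%VS, max_isotropic l (h :&: g1)%VS & h = (g0 + (h :&: g1))%VS].
Proof.
case=> [[hE hs] _ h0 mh]; split=> //; last first.
  by rewrite {1}hE (capv_idPr h0).
split=> [|z a z0]; first exact: capvSr.
by rewrite !memv_cap => /andP[ah a1]; rewrite br01 // hs // (subvP h0).
Qed.

Lemma gmod_polarization l H : inL l -> gmod H -> max_isotropic l H -> polarization l (g0 + H)%VS.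
Proof.
move=> Ll gH mH; have H1 := gH.1; rewrite /polarization add0_cap //; split=> //.
- split; first by rewrite add0_cap // (capv_idPr (addvSl _ _)).
  move=> _ _ /memv_addP[a a0 [b bH ->]] /memv_addP[c c0 [d dH ->]].
  rewrite !(brDl, brDr) [br b c](_ : _ = - br c b); last first.
    by rewrite (brC0 c0 (gmod_odd gH bH)) opprK.
  have e1 : br a c + br b d \in g0 by apply: memvD; [apply: br00 | apply: br11; apply: gmod_odd
    gH _].
  have e2 : br a d - br c b \in H by apply: memvB; apply: gH.2.
  have -> : br a c + br a d + (- br c b + br b d) = (br a c + br b d) + (br a d - br c b).
    by lmodule F.
  exact: memv_add.
- move=> _ _ /memv_addP[a a0 [b bH ->]] /memv_addP[c c0 [d dH ->]].
  rewrite !(brDl, brDr) [br b c](_ : _ = - br c b); last first.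
    by rewrite (brC0 c0 (gmod_odd gH bH)) opprK.
  rewrite !linearD linearN /= (inL_br Ll a0 c0) [l (br b d)]mH.1.2 //.
  rewrite !(inL_even Ll (br01 _ (gmod_odd gH _))) //; first by rewrite oppr0 !addr0.
- exact: addvSl.
Qed.

Lemma polarization_exists l : inL l -> exists h, polarization l h.
Proof.
move=> Ll; have [H [gH mH]] := max_isotropic_exists solv Ll.
by exists (g0 + H)%VS; apply: gmod_polarization.
Qed.

Lemma some_polarizationP l : inL l -> polarization l (some_polarization l).
Proof.
move=> Ll; have [h ph] := polarization_exists Ll.
exact: (@xgetPex _ _ _ (ex_intro _ h ph)).
Qed.

(** The complements [U :\: h] and [U :\: (h :&: U)] may differ, but a basis of either is a basis of
    U modulo h. *)
Lemma trq_cap (U h : {vspace g}) (f : g -> g) : linear f -> (forall u, u \in U -> f u \in U) ->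
  (forall a, a \in U -> a \in h -> f a \in h) -> trq U h f = trq U (h :&: U)%VS f.
Proof.
move=> lf fU fh; set k := (h :&: U)%VS; pose W := (U :\: k)%VS; pose p := addv_pi1 U k.
have kE u : u \in U -> (u \in k) = (u \in h) by rewrite memv_cap => ->; rewrite andbT.
pose b (i : 'I_(\dim W)) := (vbasis W)`_i.
have bW i : b i \in W by apply/vbasis_mem/memt_nth.
have bU i : b i \in U by apply: (subvP (diffvSl U k)).
pose T := \matrix_(i < \dim W, j < \dim W) coord (vbasis W) j (p (f (b i))).
transitivity (\tr T); last by apply: eq_bigr => i _; rewrite mxE.
have kh u : u \in k -> u \in h by apply/subvP/capvSl.
apply: (@trq_basis F g U h f _ b T) => //.
- move=> i; apply: kh.
  have -> : comb T b i = p (f (b i)).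
    by rewrite [RHS](coord_vbasis (addv_pi1_mem U k (f (b i)))); apply: eq_bigr => j _; rewrite mxE.
  by apply: addv_pi1_mod; apply: fU.
- move=> u uU; exists (fun i => coord (vbasis W) i (p u)); apply: kh.
  by rewrite -(coord_vbasis (addv_pi1_mem U k u)); apply: addv_pi1_mod.
- move=> c ch; apply: (@vbasis_independent F g W c); apply/eqP.
  rewrite -memv0 -(capv_diff U k) memv_cap memv_suml /=; last by move=> i _; rewrite memvZ // bW.
  by rewrite kE ?ch // memv_suml // => i _; rewrite memvZ // bU.
Qed.

Lemma theta_tau h z : gmod (h :&: g1)%VS -> (g0 <= h)%VS -> z \in g0 ->
  theta h z = - (2^-1 * tau (h :&: g1) z).
Proof.
move=> gH h0 z0; rewrite theta_even //; congr (- (_ * _)); apply: trq_cap.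
- exact: br_linear.
- by move=> u; apply: br01.
- by move=> a a1 ah; apply: (subvP (capvSl h g1)); apply: gH.2 => //; rewrite memv_cap ah.
Qed.

Lemma tau_character H z z' : gmod H -> z \in g0 -> z' \in g0 -> tau H (br z z') = 0.
Proof.
move=> gH z0 z0'; have [s [fs sE]] := flag_exists solv gH (gmod1 g) gH.1.
rewrite (tau_flag gH fs sE) ?br00 //.
elim: s fs {sE} => [|[y w] s IH] /=; first by rewrite big_nil.
case=> fs y1 ys ey; rewrite big_cons IH // addr0.
exact: (eigen_character (gmod_flag gH fs) y1 ys ey).
Qed.

Lemma theta_inL l h : polarization l h -> inL (theta h).
Proof.
move=> ph; have [gH _ _] := polarization_gmod ph; have [_ _ h0 _] := ph.
split=> [x|z z' z0 z0']; first exact: theta_odd.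
by rewrite theta_tau ?br00 // tau_character // mulr0 oppr0.
Qed.

Lemma inLD l m : inL l -> inL m -> inL (l + m).
Proof.
move=> [l1 l2] [m1 m2]; split=> [x x1|x y x0 y0]; rewrite lfunE /=.
  by rewrite l1 // m1 // addr0.
by rewrite l2 // m2 // addr0.
Qed.

Lemma inLN l : inL l -> inL (- l).
Proof.
move=> [l1 l2]; split=> [x x1|x y x0 y0]; rewrite lfunE /=.
  by rewrite l1 // oppr0.
by rewrite l2 // oppr0.
Qed.

Lemma inL_eq l m : inL l -> inL m -> (forall z, z \in g0 -> l z = m z) -> l = m.
Proof.
move=> Ll Lm lm; apply/lfunP => x; rewrite (even_odd_part x) !linearD /=.
by rewrite lm ?even_part_in // (inL_even Ll (odd_part_in x)) (inL_even Lm (odd_part_in x)).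
Qed.

(** The quotient of [perp l H] by H is zero or a line of weight 0. *)
Lemma tau_perp l H z : inL l -> gmod H -> max_isotropic l H -> z \in g0 ->
  tau H z = tau (perp l H) z.
Proof.
move=> Ll gH mH z0; have [->//|[y [yH PE yy zy]]] := perp_cases Ll gH mH.
have y1 : y \in g1.
  by apply: (@perp_odd _ _ l H); rewrite PE (subvP (addvSr _ _)) // memv_line.
by rewrite PE (@tau_step F g H y 0 z) ?addr0 // scale0r subr0 zy.
Qed.

(* Adding a multiple of tau H to l changes the form, but by tau_eigen the forms of l and m agree on pairs of an element of H and an eigenvector
   modulo perp l H. *)
Lemma perp_tau_sub l m H c : inL l -> inL m -> gmod H -> max_isotropic l H ->
  (forall z, z \in g0 -> m z = l z + c * tau H z) -> (perp m H <= perp l H)%VS.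
Proof.
move=> Ll Lm gH mH mE; have H1 := gmod_odd gH.
have gP := gmod_perp Ll gH; have gK := gmod_perp Lm gH; have HP := max_isotropic_sub mH.
apply: contrapT => /negP nKP; have gKP := gmod_cap gK gP.
have [|y [w [yK yKP ey _]]] := gmod_eigen solv gKP gK.
  by apply: contra nKP => s; apply: subv_trans s (capvSr _ _).
have y1 := perp_odd yK.
have yP : y \notin perp l H by move: yKP; rewrite memv_cap yK.
have eP : eigen (perp l H) y w by move=> z /ey; apply: (subvP (capvSr _ _)).
case/negP: (yP); apply/perpP; split=> // x xH; have x1 := H1 x xH.
have := perp_orth xH yK; rewrite mE ?br11 // (tau_perp Ll gH mH) ?br11 //.
by rewrite (tau_eigen gP y1 yP eP (subvP HP x xH)) mulr0 addr0.
Qed.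

(** An m-isotropic V above H lies in [perp m H], hence in [perp l H], which is H or H + <y>. If V
    were larger than H it would contain y, but m([y,y]) = l([y,y]) is nonzero by [tau_eigen_sq]. *)
Lemma max_isotropic_tau l m H c : inL l -> inL m -> gmod H -> max_isotropic l H ->
  (forall z, z \in g0 -> m z = l z + c * tau H z) -> max_isotropic m H.
Proof.
move=> Ll Lm gH mH mE; have H1 := gmod_odd gH.
split.
  split=> [|x y xH yH]; first exact: gH.1.
  rewrite /fform mE ?br11 ?H1 // tau_isotropic // mulr0 addr0; exact: mH.1.2.
move=> V iV HV; apply/eqP; rewrite eqEsubv HV andbT.
have VP : (V <= perp l H)%VS := subv_trans (isotropic_perp iV HV) (perp_tau_sub Ll Lm gH mH mE).
have [<-//|[y [yH PE yy zy]]] := perp_cases Ll gH mH.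
apply/subvP => r rV; have := subvP VP r rV; rewrite PE => /memv_add_line[a aH [d rE]].
have [d0|d0] := eqVneq d 0; first by rewrite rE d0 scale0r addr0.
have yV : y \in V.
  have -> : y = d^-1 *: (r - a) by rewrite rE [a + _]addrC addrK scalerK.
  by rewrite memvZ // memvB // (subvP HV).
have y1 := subvP iV.1 _ yV.
have ey : eigen H y 0 by move=> z z0; rewrite lfunE scale0r subr0 zy.
case/eqP: yy; have := iV.2 _ _ yV yV.
by rewrite /fform mE ?br11 // (tau_eigen_sq gH y1 yH ey) mulr0 addr0.
Qed.

Lemma polarization_theta l h s : inL l -> polarization l h -> polarization (l + s *: theta h) h.
Proof.
move=> Ll ph; have [gH mH hE] := polarization_gmod ph; have [_ _ h0 _] := ph.
have Lt := theta_inL ph.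
have Lm : inL (l + s *: theta h).
  apply: inLD => //; case: Lt => t1 t2.
  split=> [x x1|x y x0 y0]; rewrite lfunE /=; first by rewrite t1 // scaler0.
  by rewrite t2 // scaler0.
suff mm : max_isotropic (l + s *: theta h) (h :&: g1)%VS.
  by have := gmod_polarization Lm gH mm; rewrite -hE.
(* The constant comes from theta = -tau/2 on g0. *)
apply: (max_isotropic_tau Ll Lm gH mH (c := - (s * 2^-1))) => z z0.
rewrite lfunE /= lfunE /= theta_tau // mulNr -mulrA; congr (_ + _); exact: mulrN.
Qed.

(** * Exchange of one dimension in a polarization *)

Section Adjacent.
Variables (l : 'Hom(g, F^o)) (H : {vspace g}) (x : g) (w : 'Hom(g, F^o)).
Hypotheses (Ll : inL l) (gH : gmod H) (mH : max_isotropic l H).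
Hypotheses (x1 : x \in g1) (xH : x \notin H) (xx : l (br x x) = 0).
Let K := (H :&: perp l <[x]>)%VS.
Hypothesis ex : eigen K x w.

Definition adjacent : {vspace g} := (K + <[x]>)%VS.

Let memK a : a \in K <-> a \in H /\ l (br x a) = 0.
Proof.
rewrite memv_cap; split=> [/andP[aH ax]|[aH ax]].
  by split=> //; apply: perp_orth ax; apply: memv_line.
rewrite aH; apply/perpP; split; first exact: gmod_odd aH.
by move=> _ /vlineP[c ->]; rewrite brZl homvZ ax mulr0.
Qed.

Lemma adjacent_pair : exists2 y, y \in H & l (br x y) = 1.
Proof.
have [y yH xy] : exists2 y, y \in H & l (br x y) != 0.
  apply: contrapT => n; case/negP: xH; apply: (max_isotropic_perp mH _ xx).
  apply/perpP; split=> // a aH; apply/eqP; apply: contrapT => /negP e; apply: n.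
  by exists a; rewrite // (brC1 x1 (gmod_odd gH aH)).
by exists ((l (br x y))^-1 *: y); rewrite ?memvZ // brZr homvZ mulVf.
Qed.

Let gK : gmod K.
Proof.
split; first exact: subv_trans (capvSl _ _) gH.1.
move=> z a z0 /memK[aH ax]; apply/memK; split; first exact: gH.2.
have a1 := gmod_odd gH aH.
apply/eqP; rewrite -oppr_eq0 -fform_inv //; apply/eqP.
have -> : br z x = (br z x - w z *: x) + w z *: x by rewrite subrK.
rewrite brDl brZl homvD homvZ ax mulr0 addr0.
by have /memK[eH _] := ex z0; apply: mH.1.2.
Qed.

Lemma adjacent_gmod : gmod adjacent.
Proof. exact: gmod_add_line ex. Qed.

Lemma adjacent_cap : (H :&: adjacent = K)%VS.
Proof.
apply/eqP; rewrite eqEsubv subv_cap capvSl addvSl !andbT.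
apply/subvP => a; rewrite memv_cap => /andP[aH /memv_add_line[b bK [c aE]]].
have /memK[bH _] := bK.
suff c0 : c = 0 by rewrite aE c0 scale0r addr0.
apply: (scale_notin xH); have -> : c *: x = a - b by rewrite aE [b + _]addrC addrK.
by rewrite memvB.
Qed.

(** For r in an isotropic space above, u = r - l([y,r]) x is isotropic and orthogonal to y and to K,
    hence to H, so u is in H by maximality of H; being orthogonal to x, it is in K. *)
Lemma adjacent_max_isotropic : max_isotropic l adjacent.
Proof.
have [y yH xy] := adjacent_pair; have y1 := gmod_odd gH yH.
have iK : isotropic l K.
  split; first exact: gK.1.
  by move=> a b /memK[aH _] /memK[bH _]; apply: mH.1.2.
have iA : isotropic l adjacent.
  apply: isotropic_add_line => //; apply/perpP; split=> // a aK.
  by have /memK[aH ax] := aK; rewrite (brC1 (gmod_odd gH aH) x1).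
split=> // V iV AV; apply/eqP; rewrite eqEsubv AV andbT; apply/subvP => r rV.
have r1 := subvP iV.1 _ rV.
have xA : x \in adjacent by rewrite (subvP (addvSr _ _)) // memv_line.
have xV := subvP AV _ xA.
have rx : l (br x r) = 0 by apply: iV.2.
pose d := l (br y r).
have [u uE] : exists u, u = r - d *: x by eexists.
have u1 : u \in g1 by rewrite uE memvB ?memvZ.
have uy : l (br y u) = 0.
  by rewrite uE brDr -scaleNr brZr homvD homvZ (brC1 y1 x1) xy mulr1 subrr.
have ux : l (br x u) = 0.
  by rewrite uE brDr -scaleNr brZr homvD homvZ rx xx mulr0 addr0.
have uu : l (br u u) = 0.
  have uV : u \in V by rewrite uE memvB ?memvZ.
  exact: iV.2.
suff uH : u \in H.
  have -> : r = u + d *: x by rewrite uE subrK.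
  by apply: add_line_mem; apply/memK.
apply: (max_isotropic_perp mH _ uu); apply/perpP; split=> // a aH.
have a1 := gmod_odd gH aH.
have aE : a = (a - l (br x a) *: y) + l (br x a) *: y by rewrite subrK.
have aK : a - l (br x a) *: y \in K.
  apply/memK; split; first by rewrite memvB ?memvZ.
  by rewrite brDr -scaleNr brZr homvD homvZ xy mulr1 subrr.
have aKV : a - l (br x a) *: y \in V by apply: (subvP AV); apply: (subvP (addvSl _ _)).
rewrite aE brDl brZl homvD homvZ uy mulr0 addr0 uE.
rewrite brDr -(scaleNr d x) brZr homvD homvZ.
rewrite [l (br _ r)](iV.2 _ _ aKV rV) add0r.
have /memK[eH e] := aK; rewrite (brC1 (gmod_odd gH eH) x1) e; exact: mulr0.
Qed.

(** H + <x> and [adjacent] + <y> coincide. The first adds to H the vector x of weight w, the second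
    adds y, whose weight is -w by invariance of f_l. *)
Lemma adjacent_tau z : z \in g0 -> tau H z = tau adjacent z + 2%:R * w z.
Proof.
move=> z0; have [y yH xy] := adjacent_pair; have y1 := gmod_odd gH yH.
have KH : (K <= H)%VS := capvSl _ _.
have xK : x \notin K by apply: contra xH => /memK[].
have yK : y \notin K by apply/negP => /memK[_]; rewrite xy => /eqP; rewrite oner_eq0.
have HE : H = (K + <[y]>)%VS.
  apply/eqP; rewrite eqEsubv subv_add KH -memvE yH !andbT; apply/subvP => a aH.
  have -> : a = (a - l (br x a) *: y) + l (br x a) *: y by rewrite subrK.
  apply: add_line_mem; apply/memK; split; first by rewrite memvB ?memvZ.
  by rewrite brDr -scaleNr brZr homvD homvZ xy mulr1 subrr.
have yA : y \notin adjacent.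
  apply: contra yK => yA; rewrite -/K -adjacent_cap memv_cap yH; exact: yA.
have ey : br z y - (- w z) *: y \in K.
  apply/memK; split; first by rewrite memvB ?memvZ ?gH.2.
  have /memK[eH e] := ex z0.
  rewrite brDr -scaleNr opprK brZr homvD homvZ xy.
  have -> : l (br x (br z y)) = - l (br (br z x) y) by rewrite fform_inv // opprK.
  have -> : br z x = (br z x - w z *: x) + w z *: x by rewrite subrK.
  rewrite brDl brZl homvD homvZ xy [l (br (br z x - _) y)](mH.1.2 _ _ eH yH) add0r.
  by rewrite addrC subrr.
rewrite (@tau_step F g H x (w z) z) ?(subvP KH _ (ex z0)) //.
rewrite (@tau_step F g adjacent y (- w z) z) ?(subvP (addvSl _ _) _ ey) //; last first.
  exact: adjacent_gmod.
have -> : (H + <[x]> = adjacent + <[y]>)%VS by rewrite HE /adjacent -addvA [(<[y]> + _)%VS]addvC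
  addvA.
ring.
Qed.

End Adjacent.

End Polarizations.

(** * Modules generated by singular vectors *)

Section Representations.
Variables (F : numClosedFieldType) (g : lieSuperalg F).
Implicit Types (H K Y : {vspace g}) (x y z r : g).
Local Notation g0 := (gr g false).
Local Notation g1 := (gr g true).

(** The bracket relation is imposed on K only, so representations of a subalgebra are still families
    of operators indexed by all of g. *)
Record is_rep (V : lmodType F) K (rho : g -> V -> V) : Prop := IsRep {
  rep_linr : forall x, linear (rho x);
  rep_linl : forall u, linear (rho^~ u);
  rep_br : forall a b x y u, x \in gr g a -> y \in gr g b -> x \in K -> y \in K ->
    rho (br x y) u = rho x (rho y u) - (-1) ^+ (a && b) *: rho y (rho x u) }.

Section Rep.
Variables (V : lmodType F) (K : {vspace g}) (rho : g -> V -> V).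
Hypothesis rep : is_rep K rho.

Lemma repDr x u v : rho x (u + v) = rho x u + rho x v.
Proof. by have := rep_linr rep x 1 u v; rewrite !scale1r. Qed.
Lemma rep0r x : rho x 0 = 0.
Proof. by apply: (addrI (rho x 0)); rewrite -repDr !addr0. Qed.
Lemma repZr x c u : rho x (c *: u) = c *: rho x u.
Proof. by have := rep_linr rep x c u 0; rewrite rep0r !addr0. Qed.
Lemma repDl x y u : rho (x + y) u = rho x u + rho y u.
Proof. by have := rep_linl rep u 1 x y; rewrite !scale1r. Qed.
Lemma rep0l u : rho 0 u = 0.
Proof. by apply: (addrI (rho 0 u)); rewrite -repDl !addr0. Qed.
Lemma repZl x c u : rho (c *: x) u = c *: rho x u.
Proof. by have := rep_linl rep u c x 0; rewrite rep0l !addr0. Qed.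
Lemma repNr x u : rho x (- u) = - rho x u.
Proof. by rewrite -(scaleN1r u) repZr scaleN1r. Qed.
Lemma repNl x u : rho (- x) u = - rho x u.
Proof. by rewrite -(scaleN1r x) repZl scaleN1r. Qed.

Lemma rep_even b z y u : z \in g0 -> y \in gr g b -> z \in K -> y \in K ->
  rho z (rho y u) = rho y (rho z u) + rho (br z y) u.
Proof.
move=> z0 yb zK yK; rewrite (rep_br rep u z0 yb zK yK) expr0 scale1r.
by rewrite addrC subrK.
Qed.

Lemma rep_odd x y u : x \in g1 -> y \in g1 -> x \in K -> y \in K ->
  rho x (rho y u) = rho (br x y) u - rho y (rho x u).
Proof.
move=> x1 y1 xK yK; rewrite (rep_br rep u x1 y1 xK yK) expr1 scaleN1r opprK.
by rewrite addrK.
Qed.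

Lemma rep_sq x u : x \in g1 -> x \in K -> rho x (rho x u) = 2^-1 *: rho (br x x) u.
Proof.
move=> x1 xK; rewrite (rep_br rep u x1 x1 xK xK) expr1 scaleN1r opprK.
by rewrite -mulr2n -scaler_nat scalerA mulVf ?scale1r ?pnatr_eq0.
Qed.
End Rep.

Section Singular.
Variables (V : lmodType F) (rho : g -> V -> V).
Hypothesis rep : is_rep fullv rho.
Variables (l : 'Hom(g, F^o)) (H : {vspace g}) (E : V -> Prop).
Hypotheses (gH : gmod H) (gP : gmod (perp l H)) (HP : (H <= perp l H)%VS).
Hypotheses (sE : subspace E) (EH : forall x u, x \in H -> E u -> rho x u = 0).
Hypothesis E0 : forall z u, z \in g0 -> E u -> rho z u = l z *: u.
Hypothesis EP : forall a u, a \in perp l H -> E u -> E (rho a u).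

(** Spanned by the ordered monomials in the flag vectors applied to E, with exponents 0 or 1 since y
    acts with square [y,y]/2. [linear_top] keeps the monomials of degree at most one. *)
Fixpoint module_top (s : seq (g * 'Hom(g, F^o))) : V -> Prop :=
  if s is yw :: s' then
    fun u => exists a b, [/\ module_top s' a, module_top s' b & u = rho yw.1 a + b]
  else E.

Fixpoint linear_top (s : seq (g * 'Hom(g, F^o))) : V -> Prop :=
  if s is yw :: s' then
    fun u => exists a b, [/\ E a, linear_top s' b & u = rho yw.1 a + b]
  else E.

Let H1 x : x \in H -> x \in g1. Proof. exact: gmod_odd gH. Qed.

Lemma module_top_subspace s : subspace (module_top s).
Proof.
elim: s => //= yw s IH; split.
  by exists 0, 0; split; rewrite ?(rep0r rep) ?addr0 //; apply: subspace0 IH.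
move=> c _ _ [a1 [b1 [Ma1 Mb1 ->]]] [a2 [b2 [Ma2 Mb2 ->]]].
exists (c *: a1 + a2), (c *: b1 + b2); split; try exact: IH.2.
by rewrite (repDr rep) (repZr rep) scalerDr addrACA.
Qed.

Lemma module_top_sub yw s u : module_top s u -> module_top (yw :: s) u.
Proof.
move=> Mu; exists 0, u; split=> //; first exact: subspace0 (module_top_subspace s).
by rewrite (rep0r rep) add0r.
Qed.

Lemma module_top_base s u : E u -> module_top s u.
Proof. by move=> Eu; elim: s => //= yw s IH; apply: module_top_sub. Qed.

Lemma linear_top_sub s u : linear_top s u -> module_top s u.
Proof.
elim: s u => //= yw s IH _ [a [b [Ea Tb ->]]].
by exists a, b; split=> //; [apply: module_top_base | apply: IH].
Qed.

Lemma module_top_stable s : is_flag (perp l H) s ->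
  (forall z u, z \in g0 -> module_top s u -> module_top s (rho z u)) /\
  (forall r u, r \in flag_top (perp l H) s -> module_top s u -> module_top s (rho r u)).
Proof.
elim: s => [_|[y w] s IH] /=.
  by split=> [z u z0 Eu|r u]; [rewrite E0 //; apply: subspaceZ | apply: EP].
move=> [fs y1 ys ey]; have [IH0 IH1] := IH fs; have gs := gmod_flag gP fs.
have sM := module_top_subspace s; have sM' := module_top_subspace ((y, w) :: s).
split=> [z _ z0 [a [b [Ma Mb ->]]]|].
  exists (rho z a + w z *: a), (rho z b + rho (br z y - w z *: y) a); split.
  - by apply: (subspaceD sM); [apply: IH0 | apply: subspaceZ].
  - by apply: (subspaceD sM); [apply: IH0 | apply: IH1 => //; apply: ey].
  - rewrite (repDr rep) (rep_even rep a z0 y1) ?memvf // (repDl rep) -scaleNr (repZl rep).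
    by rewrite (repDr rep) (repZr rep); lmodule F.
move=> r u rY Mu; case/memv_add_line: rY => r' r'Y [c ->].
rewrite (repDl rep) (repZl rep); have r1 := gmod_odd gs r'Y.
move: Mu => [a [b [Ma Mb ->]]]; apply: (subspaceD sM'); last apply: (subspaceZ sM').
  exists (- rho r' a), (rho r' b + rho (br r' y) a); split.
  - by apply: (subspaceN sM); apply: IH1.
  - by apply: (subspaceD sM); [apply: IH1 | apply: IH0 => //; apply: br11].
  - rewrite (repDr rep) (rep_odd rep a r1 y1) ?memvf // (repNr rep) /=; lmodule F.
exists b, (2^-1 *: rho (br y y) a); split=> //.
  by apply: (subspaceZ sM); apply: IH0 => //; apply: br11.
by rewrite (repDr rep) (rep_sq rep a y1) ?memvf // addrC.
Qed.

(** Biorthogonality: a flag space Y contains the orthogonal of the vectors of H orthogonal to Y. To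
    pass to Y + <y>, choose x0 in H orthogonal to Y with l([x0,y]) = 1; then r is corrected by a
    multiple of y and each test vector x by a multiple of x0. *)
Lemma perp_dual s r : is_flag (perp l H) s -> r \in g1 ->
  (forall x, x \in H -> (forall v, v \in flag_top (perp l H) s -> l (br x v) = 0) -> l (br x r) =
    0) ->
  r \in flag_top (perp l H) s.
Proof.
elim: s r => [|[y w] s IH] r /=.
  move=> _ r1 h; apply/perpP; split=> // x xH; apply: h => // v vP; exact: perp_orth vP.
move=> [fs y1 ys ey] r1 h.
have [x0 [x0H x0Y x0y]] : exists x0, [/\ x0 \in H,
    forall v, v \in flag_top (perp l H) s -> l (br x0 v) = 0 & l (br x0 y) = 1].
  have [x [xH xY xy]] : exists x, [/\ x \in H,
      forall v, v \in flag_top (perp l H) s -> l (br x v) = 0 & l (br x y) != 0].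
    apply: contrapT => n; case/negP: ys; apply: IH => // x xH xY; apply/eqP.
    by apply: contrapT => /negP xy; apply: n; exists x.
  exists ((l (br x y))^-1 *: x); split; first by rewrite memvZ.
    by move=> v vY; rewrite brZl homvZ (xY v vY) mulr0.
  by rewrite brZl homvZ mulVf.
have -> : r = (r - l (br x0 r) *: y) + l (br x0 r) *: y by rewrite subrK.
apply: add_line_mem; apply: IH => //; first by rewrite memvB ?memvZ.
move=> x xH xY; rewrite brDr -scaleNr brZr homvD homvZ.
have -> : br x r = br (x - l (br x y) *: x0) r + l (br x y) *: br x0 r.
  by rewrite brDl -scaleNr brZl; lmodule F.
rewrite homvD homvZ h; first by rewrite add0r; ring.
  by rewrite memvB ?memvZ.
move=> v /memv_add_line[a aY [c ->]].
rewrite brDl -scaleNr brZl !brDr !brZr !homvD !homvZ !homvD !homvZ xY // x0Y // x0y; ring.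
Qed.

Lemma flag_dual y s : is_flag (perp l H) s -> y \in g1 -> y \notin flag_top (perp l H) s ->
  exists x, [/\ x \in H, forall v, v \in flag_top (perp l H) s -> l (br x v) = 0 & l (br x y) = 1].
Proof.
move=> fs y1 ys; have [x [xH xY xy]] : exists x, [/\ x \in H,
    forall v, v \in flag_top (perp l H) s -> l (br x v) = 0 & l (br x y) != 0].
  apply: contrapT => n; case/negP: ys; apply: perp_dual => // x xH xY; apply/eqP.
  by apply: contrapT => /negP xy; apply: n; exists x.
exists ((l (br x y))^-1 *: x); split; first by rewrite memvZ.
  by move=> v vY; rewrite brZl homvZ (xY v vY) mulr0.
by rewrite brZl homvZ mulVf.
Qed.

Lemma linear_top_kill s x u : is_flag (perp l H) s -> x \in H ->
  (forall v, v \in flag_top (perp l H) s -> l (br x v) = 0) -> linear_top s u -> rho x u = 0.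
Proof.
elim: s u => [|[y w] s IH] u /=; first by move=> _ xH _; apply: EH.
move=> [fs y1 ys ey] xH xY [a [b [Ea Tb ->]]].
rewrite (repDr rep) (rep_odd rep a (H1 xH) y1) ?memvf // (EH xH Ea) (rep0r rep) subr0.
rewrite (E0 (br11 (H1 xH) y1) Ea) xY; last by rewrite (subvP (addvSr _ _)) // memv_line.
by rewrite scale0r add0r; apply: IH => // v vY; apply: xY; apply: (subvP (addvSl _ _)).
Qed.

(* The four properties are proved together along the flag: the first for Y + <y> uses the
   last, which uses the first three for Y. *)
Lemma singular_vectors s : is_flag (perp l H) s ->
  [/\ forall W : V -> Prop, subspace W -> (forall u, W u -> module_top s u) ->
        (forall x u, x \in H -> W u -> W (rho x u)) -> (exists2 u, W u & u <> 0) ->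
        exists u, [/\ W u, u <> 0 & forall x, x \in H -> rho x u = 0],
      forall u, module_top s u -> (forall x, x \in H -> E (rho x u)) -> linear_top s u,
      forall u, module_top s u -> (forall x, x \in H -> rho x u = 0) -> E u
    & if s is yw :: s' then
        forall c, module_top s' c -> module_top s' (rho yw.1 c) -> c = 0
      else True].
Proof.
elim: s => [_|[y w] s IH] /=.
  split=> // W sW WE WH [u Wu u0]; exists u; split=> // x xH; apply: EH => //; exact: WE.
move=> [fs y1 ys ey]; have [C1 C2 C3 _] := IH fs; have [M0 MY] := module_top_stable fs.
have sM := module_top_subspace s.
have [x0 [x0H x0Y x0y]] := flag_dual fs y1 ys.
have MH x u : x \in H -> module_top s u -> module_top s (rho x u).
  by move=> xH; apply: MY; apply: (subvP (flag_top_sub _ _)); apply: (subvP HP).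
have xy x a : x \in H -> rho x (rho y a) = rho (br x y) a - rho y (rho x a).
  by move=> xH; rewrite (rep_odd rep a (H1 xH) y1) ?memvf.
have xyE x a : x \in H -> E a -> rho x (rho y a) = l (br x y) *: a.
  by move=> xH Ea; rewrite xy // (EH xH Ea) (rep0r rep) subr0 (E0 (br11 (H1 xH) y1) Ea).
(* The u with u and yu in the smaller module form an H-stable space; if nonzero, it contains a
   nonzero singular u in E. Then H maps yu into E, so yu has degree at most one and is killed by x0,
   although x0 y u = u. *)
have C4 c : module_top s c -> module_top s (rho y c) -> c = 0.
  move=> Mc Myc; apply: contrapT => c0.
  pose W u := module_top s u /\ module_top s (rho y u).
  have sW : subspace W.
    split=> [|d u v [Mu Myu] [Mv Myv]].
      by split; rewrite ?(rep0r rep); apply: subspace0 sM.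
    by split; rewrite ?(repDr rep) ?(repZr rep); apply: sM.2.
  have [|u [[Mu Myu] u0 uH]] := C1 W sW (fun u Wu => proj1 Wu) _ (ex_intro2 _ _ c (conj Mc Myc) c0).
    move=> x u xH [Mu Myu]; split; first exact: MH.
    have -> : rho y (rho x u) = rho (br x y) u - rho x (rho y u) by rewrite xy //; lmodule F.
    by apply: (subspaceB sM); [apply: M0 => //; apply: br11 => //; apply: H1 | apply: MH].
  have Eu := C3 u Mu uH.
  apply: u0; rewrite -[u]scale1r -x0y -xyE //; apply: (linear_top_kill fs) => //.
  by apply: C2 => // x xH; rewrite xyE //; apply: subspaceZ.
(* For x in H, x(ya + b) is in E, so y(xa) is in the smaller module and xa = 0 by C4; thus a is in
   E. *)
have C2' u : module_top ((y, w) :: s) u -> (forall x, x \in H -> E (rho x u)) ->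
    linear_top ((y, w) :: s) u.
  move=> [a [b [Ma Mb ->]]] ux.
  have xa x : x \in H -> rho x a = 0.
    move=> xH; apply: C4; first exact: MH.
    have -> : rho y (rho x a) = rho (br x y) a + rho x b - rho x (rho y a + b).
      by rewrite (repDr rep) xy //; lmodule F.
    apply: (subspaceB sM); last by apply: module_top_base; apply: ux.
    by apply: (subspaceD sM); [apply: M0 => //; apply: br11 => //; apply: H1 | apply: MH].
  have Ea := C3 a Ma xa; exists a, b; split=> //; apply: C2 => // x xH.
  have -> : rho x b = rho x (rho y a + b) - l (br x y) *: a.
    by rewrite (repDr rep) xyE //; lmodule F.
  by apply: (subspaceB sE); [apply: ux | apply: subspaceZ].
split=> // [W sW WM WH Wn|u Mu ux].
  have [[v [Wv Mv v0]]|nv] := pselect (exists u, [/\ W u, module_top s u & u <> 0]).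
    have [||||u [[Wu Mu] u0 uH]] := C1 (fun u => W u /\ module_top s u).
    - split; first by split; [apply: subspace0 sW | apply: subspace0 sM].
      by move=> c u1 u2 [W1 M1] [W2 M2]; split; [apply: sW.2 | apply: sM.2].
    - by move=> u [].
    - by move=> x u xH [Wu Mu]; split; [apply: WH | apply: MH].
    - by exists v.
    - by exists u.
  have WM0 u : W u -> module_top s u -> u = 0.
    by move=> Wu Mu; apply: contrapT => u0; apply: nv; exists u.
  (* When W meets the smaller module only in 0, consider the leading coefficients a of its elements.
     If a is singular, H maps ya + b into both W and the smaller module, hence to 0. *)
  pose A a := module_top s a /\ exists2 b, module_top s b & W (rho y a + b).
  have [||||a [[Ma [b Mb Wab]] a0 aH]] := C1 A.
  - split; first by split; [apply: subspace0 sM | exists 0; rewrite ?(rep0r rep) ?addr0;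
      [apply: subspace0 sM | apply: subspace0 sW]].
    move=> c a1 a2 [M1 [b1 Mb1 W1]] [M2 [b2 Mb2 W2]]; split; first exact: sM.2.
    exists (c *: b1 + b2); first exact: sM.2.
    have -> : rho y (c *: a1 + a2) + (c *: b1 + b2) = c *: (rho y a1 + b1) + (rho y a2 + b2).
      by rewrite (repDr rep) (repZr rep); lmodule F.
    exact: sW.2.
  - by move=> a [].
  - move=> x a xH [Ma [b Mb Wab]]; split; first exact: MH.
    exists (- (rho (br x y) a + rho x b)).
      by apply: (subspaceN sM); apply: (subspaceD sM); [apply: M0 => //; apply: br11 => //;
        apply: H1 | apply: MH].
    have -> : rho y (rho x a) + - (rho (br x y) a + rho x b) = - rho x (rho y a + b).
      by rewrite (repDr rep) xy //; lmodule F.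
    by apply: (subspaceN sW); apply: WH.
  - have [u Wu u0] := Wn; have [a [b [Ma Mb uE]]] := WM u Wu.
    exists a; first by split=> //; exists b; rewrite // -uE.
    move=> a0; apply: u0; apply: WM0 => //; rewrite uE a0 (rep0r rep) add0r //.
  exists (rho y a + b); split=> //.
    move=> e; apply: a0; apply: C4 => //.
    have -> : rho y a = - b by apply/eqP; rewrite -addr_eq0; apply/eqP.
    exact: subspaceN.
  move=> x xH; apply: WM0; first exact: WH.
  rewrite (repDr rep) xy // (aH x xH) (rep0r rep) subr0.
  by apply: (subspaceD sM); [apply: M0 => //; apply: br11 => //; apply: H1 | apply: MH].
have Tu : linear_top ((y, w) :: s) u.
  by apply: C2' => // x xH; rewrite ux //; apply: subspace0 sE.
move: Tu ux => [a [b [Ea Tb ->]]] ux.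
(* x0 kills b and recovers a from ya. *)
have a0 : a = 0.
  have := ux x0 x0H; rewrite (repDr rep) xyE // x0y scale1r.
  by rewrite (linear_top_kill fs x0H x0Y Tb) addr0.
have Mb := linear_top_sub Tb.
rewrite a0 (rep0r rep) add0r; apply: C3 => // x xH.
by have := ux x xH; rewrite a0 (rep0r rep) add0r.
Qed.

End Singular.
End Representations.

(** * Extension of a representation by one odd dimension *)

Section Step.
Variables (F : numClosedFieldType) (g : lieSuperalg F).
Local Notation g0 := (gr g false).
Local Notation g1 := (gr g true).
Variables (V : lmodType F) (Y : {vspace g}) (y : g) (w phi : 'Hom(g, F^o)) (rho : g -> V -> V).
Hypotheses (gY : gmod Y) (y1 : y \in g1) (yY : y \notin Y) (ey : eigen Y y w).
Hypotheses (phiy : phi y = 1) (phiY : forall a, a \in Y -> phi a = 0).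
Hypothesis rep : is_rep (g0 + Y)%VS rho.

(* The induced representation of g0 + Y + <y> lives on V + y V, written as V * V. *)
Definition step_even (z : g) (u : V * V) : V * V :=
  (rho z u.1 + rho (br z y - w z *: y) u.2, rho z u.2 + w z *: u.2).
(** With (u1,u2) read as u1 + y u2, the formulas are by = [b,y] - yb and, for [step_new], yy =
    [y,y]/2. *)
Definition step_odd (b : g) (u : V * V) : V * V :=
  (rho b u.1 + rho (br b y) u.2, - rho b u.2).
Definition step_new (u : V * V) : V * V := (2^-1 *: rho (br y y) u.2, u.1).
(** phi takes the coefficient of y, so an odd element of Y + <y> is split into its part in Y and a
    multiple of y. *)
Definition step_rep (x : g) (u : V * V) : V * V :=
  step_even (even_part x) u + step_odd (odd_part x - phi (odd_part x) *: y) u +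
  phi (odd_part x) *: step_new u.

Let Y1 b : b \in Y -> b \in g1. Proof. exact: gmod_odd gY. Qed.
Let gK z : z \in g0 -> z \in (g0 + Y)%VS. Proof. exact/subvP/addvSl. Qed.
Let YK b : b \in Y -> b \in (g0 + Y)%VS. Proof. exact/subvP/addvSr. Qed.

Let rE z b u : z \in g0 -> b \in Y -> rho z (rho b u) = rho b (rho z u) + rho (br z b) u.
Proof. by move=> z0 bY; apply: (rep_even rep u z0 (Y1 bY)); [apply: gK | apply: YK]. Qed.
Let rEE z z' u : z \in g0 -> z' \in g0 -> rho z (rho z' u) = rho z' (rho z u) + rho (br z z') u.
Proof. by move=> z0 z0'; apply: (rep_even rep u z0 z0'); apply: gK. Qed.
Let rO b b' u : b \in Y -> b' \in Y -> rho b (rho b' u) = rho (br b b') u - rho b' (rho b u).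
Proof. by move=> bY bY'; apply: (rep_odd rep u (Y1 bY) (Y1 bY')); apply: YK. Qed.

Let repE := (repDr rep, repZr rep, repNr rep, repDl rep, repZl rep, repNl rep).

Lemma step_even_even z z' u : z \in g0 -> z' \in g0 ->
  step_even (br z z') u = step_even z (step_even z' u) - step_even z' (step_even z u).
Proof.
move=> z0 z0'; have wzz : w (br z z') = 0 by apply: (eigen_character gY y1 yY ey).
have kY := ey z0; have kY' := ey z0'.
have key : br (br z z') y = br z (br z' y - w z' *: y) - br z' (br z y - w z *: y) +
   w z' *: (br z y - w z *: y) - w z *: (br z' y - w z' *: y).
  rewrite -!scaleN1r !(brDr, brZr) (jacobi0 y z0 z0'); lmodule F.
congr (_, _); rewrite /=; last by rewrite wzz !repE (rEE _ z0 z0'); lmodule F.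
rewrite wzz scale0r subr0 key; move: (br z y - _) (br z' y - _) kY kY' => k k' kY kY'.
by rewrite !repE (rEE _ z0 z0') (rE _ z0 kY') (rE _ z0' kY); lmodule F.
Qed.

Lemma step_even_odd z b u : z \in g0 -> b \in Y ->
  step_odd (br z b) u = step_even z (step_odd b u) - step_odd b (step_even z u).
Proof.
move=> z0 bY; have kY := ey z0; have b1 := Y1 bY.
have key : br (br z b) y = br z (br b y) - br b (br z y - w z *: y) - w z *: br b y.
  by rewrite (jacobi0 y z0 b1) -!scaleN1r !(brDr, brZr); lmodule F.
congr (_, _); rewrite /=; last by rewrite !repE (rE _ z0 bY); lmodule F.
rewrite key; move: (br z y - _) kY => k kY.
by rewrite !repE (rE _ z0 bY) (rEE _ z0 (br11 b1 y1)) (rO _ bY kY); lmodule F.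
Qed.

Lemma step_even_new z u : z \in g0 ->
  step_odd (br z y - w z *: y) u + w z *: step_new u =
  step_even z (step_new u) - step_new (step_even z u).
Proof.
move=> z0; have kY := ey z0; have k1 := Y1 kY.
have key : br z (br y y) = 2%:R *: br (br z y - w z *: y) y + (2%:R * w z) *: br y y.
  rewrite (jacobi0 y z0 y1) -scaleNr brDl brZl (brC1 y1 (br01 z0 y1)); lmodule F.
congr (_, _); rewrite /=; last by lmodule F.
rewrite !repE (rEE _ z0 (br11 y1 y1)) key; move: (br z y - _) kY k1 => k kY k1.
rewrite !repE; lmodule F.
Qed.

Lemma step_odd_odd b b' u : b \in Y -> b' \in Y ->
  step_even (br b b') u = step_odd b (step_odd b' u) + step_odd b' (step_odd b u).
Proof.
move=> bY bY'; have b1 := Y1 bY; have b1' := Y1 bY'.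
have jac : br (br b b') y = br b (br b' y) + br b' (br b y).
  by rewrite (jacobi1 y b1 b1') subrK.
have swap c c' : c \in Y -> c' \in g1 -> br c (br c' y) = - br (br c' y) c.
  by move=> cY c1; rewrite (brC0 (br11 c1 y1) (Y1 cY)) opprK.
(* The second components agree only if this weight vanishes; it does because Jacobi puts [[b,b'],y]
   in Y. *)
have w0 : w (br b b') = 0.
  apply: (scale_notin yY).
  have -> : w (br b b') *: y = br (br b b') y - (br (br b b') y - w (br b b') *: y).
    by lmodule F.
  rewrite memvB ?ey ?br11 // jac !swap // memvD // memvN gY.2 ?br11 //.
congr (_, _); rewrite /=.
  rewrite w0 scale0r subr0 jac (swap b b') // (swap b' b) //.
  rewrite !repE (rO _ bY bY') (rE _ (br11 b1 y1) bY') (rE _ (br11 b1' y1) bY); lmodule F.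
by rewrite w0 !repE (rO _ bY bY'); lmodule F.
Qed.

Lemma step_odd_new b u : b \in Y ->
  step_even (br b y) u = step_odd b (step_new u) + step_new (step_odd b u).
Proof.
move=> bY; have b1 := Y1 bY; have by0 := br11 b1 y1.
have key : br (br y y) b = - 2%:R *: br (br b y) y.
  rewrite (jacobi_odd y1 y1 b1) (brC1 y1 b1); lmodule F.
(* [[b,y],y] is a multiple of [[y,y],b], which is in Y, so the eigenvalue of [b,y] on y modulo Y is
   0. *)
have w0 : w (br b y) = 0.
  apply: (scale_notin yY).
  have -> : w (br b y) *: y = br (br b y) y - (br (br b y) y - w (br b y) *: y) by lmodule F.
  have -> : br (br b y) y = (- 2^-1) *: br (br y y) b.
    by rewrite key scalerA mulrNN mulVf ?scale1r // pnatr_eq0.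
  by rewrite memvB ?memvZ ?gY.2 ?br11 // key scalerA mulrNN mulVf ?scale1r ?pnatr_eq0 ?ey.
congr (_, _); rewrite /=; last by rewrite w0; lmodule F.
rewrite w0 scale0r subr0 (repNr rep) (repZr rep) (rE _ (br11 y1 y1) bY) key !repE.
have h2 : 2%:R != 0 :> F by rewrite pnatr_eq0.
have half : 2^-1 * 2%:R = 1 :> F by rewrite mulVf.
rewrite scalerN scalerDr scalerA mulrN half; lmodule F.
Qed.

Lemma step_new_new u : step_even (br y y) u = step_new (step_new u) + step_new (step_new u).
Proof.
have yy := br11 y1 y1.
have yyy : br (br y y) y = 0.
  have /eqP := jacobi_odd y1 y1 y1; rewrite -subr_eq0.
  have -> : br (br y y) y - (- br (br y y) y - br (br y y) y) = 3%:R *: br (br y y) y by lmodule F.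
  by rewrite scaler_eq0 pnatr_eq0 => /eqP.
have w0 : w (br y y) = 0.
  apply: (scale_notin yY).
  have -> : w (br y y) *: y = - (br (br y y) y - w (br y y) *: y) by rewrite yyy; lmodule F.
  by rewrite memvN ey.
have half v : 2^-1 *: v + 2^-1 *: v = v :> V.
  by lmodule F.
by congr (_, _); rewrite /= half w0 ?yyy scale0r ?subr0 ?(rep0l rep) addr0.
Qed.


Lemma step_even_lin z : linear (step_even z).
Proof.
by move=> c [n m] [n' m']; congr (_, _); rewrite /= !repE; lmodule F.
Qed.
Lemma step_odd_lin b : linear (step_odd b).
Proof.
by move=> c [n m] [n' m']; congr (_, _); rewrite /= !repE; lmodule F.
Qed.
Lemma step_new_lin : linear step_new.
Proof.
by move=> c [n m] [n' m']; congr (_, _); rewrite /= ?repE; lmodule F.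
Qed.

Lemma step_even_linl u : linear (step_even^~ u).
Proof.
by move=> c z z'; congr (_, _); rewrite /= homvD homvZ ?brDl ?brZl !repE; lmodule F.
Qed.
Lemma step_odd_linl u : linear (step_odd^~ u).
Proof.
by move=> c b b'; congr (_, _); rewrite /= ?brDl ?brZl !repE; lmodule F.
Qed.

Lemma step_rep_even z u : z \in g0 -> step_rep z u = step_even z u.
Proof.
move=> z0; rewrite /step_rep even_part_id // odd_part0 // linear0 !scale0r subr0 addr0.
by rewrite [step_odd 0 u](_ : _ = 0) ?addr0 //; congr (_, _); rewrite /= ?br0l !(rep0l rep)
  ?addr0 ?oppr0.
Qed.

Lemma step_rep_odd a c u : a \in Y -> step_rep (a + c *: y) u = step_odd a u + c *: step_new u.
Proof.
move=> aY; have b1 : a + c *: y \in g1 by rewrite memvD ?memvZ // Y1.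
rewrite /step_rep odd_part_id // even_part0 // homvD homvZ phiY // phiy mulr1 add0r addrK.
rewrite [step_even 0 u](_ : _ = 0) ?add0r //; congr (_, _); rewrite /= ?br0l ?linear0 ?scale0r
  ?subr0 ?(rep0l rep) ?addr0 //.
Qed.

(** By bilinearity the homogeneous cases reduce to the six relations above among g0, Y and y; the
    odd-even case is the even-odd one up to sign. *)
Lemma step_is_rep : is_rep (g0 + (Y + <[y]>))%VS step_rep.
Proof.
have gZ := gmod_add_line gY y1 ey.
have lin u : linear (step_rep^~ u).
  move=> c x x'.
  have pE : even_part (c *: x + x') = c *: even_part x + even_part x' by exact: linearP.
  have pO : odd_part (c *: x + x') = c *: odd_part x + odd_part x' by exact: linearP.
  rewrite /step_rep pE pO step_even_linl homvD homvZ.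
  have -> : c *: odd_part x + odd_part x' - (c * phi (odd_part x) + phi (odd_part x')) *: y =
    c *: (odd_part x - phi (odd_part x) *: y) + (odd_part x' - phi (odd_part x') *: y).
    by lmodule F.
  by rewrite step_odd_linl; lmodule F.
have l0 u : step_rep 0 u = 0.
  by apply: (addrI (step_rep 0 u)); have := lin u 1 0 0; rewrite !scale1r !addr0.
split=> [x c u v|//|].
- by rewrite /step_rep step_even_lin step_odd_lin step_new_lin; lmodule F.
have eo z b u : z \in g0 -> b \in (Y + <[y]>)%VS ->
    step_rep (br z b) u = step_rep z (step_rep b u) - step_rep b (step_rep z u).
  move=> z0 /memv_add_line[a aY [c ->]].
  have kY : c *: (br z y - w z *: y) + br z a \in Y by rewrite memvD ?memvZ ?ey ?gY.2.
  have -> : br z (a + c *: y) = (c *: (br z y - w z *: y) + br z a) + (c * w z) *: y.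
    by rewrite brDr brZr; lmodule F.
  rewrite !step_rep_odd // !step_rep_even // step_odd_linl (step_even_odd u z0 aY).
  have e := step_even_new u z0.
  rewrite [step_odd a u + _]addrC step_even_lin.
  have -> : step_odd (br z y - w z *: y) u =
     step_even z (step_new u) - step_new (step_even z u) - w z *: step_new u.
    by rewrite -e addrK.
  by lmodule F.
move=> [] [] x x' u xa xb xK xK'.
- rewrite expr1 scaleN1r opprK.
  have /memv_add_line[a aY [c ->]] := add0_odd gZ.1 xK xa.
  have /memv_add_line[a' aY' [c' ->]] := add0_odd gZ.1 xK' xb.
  have a1 := Y1 aY; have a1' := Y1 aY'.
  have -> : br (a + c *: y) (a' + c' *: y) =
     c' *: br a y + (c *: br a' y + ((c * c') *: br y y + br a a')).
    by rewrite !(brDl, brDr, brZl, brZr) (brC1 y1 a1'); lmodule F.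
  rewrite !step_rep_odd // step_rep_even; last by rewrite !memvD ?memvZ ?br11.
  rewrite !step_even_linl /= (step_odd_odd u aY aY') (step_odd_new u aY) (step_odd_new u aY')
    step_new_new.
  rewrite [step_odd a' u + _]addrC [step_odd a u + _]addrC !step_odd_lin !step_new_lin.
  by lmodule F.
- rewrite expr0 scale1r; have xY := add0_odd gZ.1 xK xa.
  have -> : br x x' = - br x' x by rewrite (brC0 xb xa) opprK.
  have N v : step_rep (- v) u = - step_rep v u.
    by have := lin u (-1) v 0; rewrite !scaleN1r addr0 => ->; rewrite l0 addr0.
  by rewrite N eo // opprB.
- by rewrite expr0 scale1r; apply: eo => //; apply: add0_odd gZ.1 xK' xb.
- by rewrite expr0 scale1r !step_rep_even ?br00 //; apply: step_even_even.
Qed.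

End Step.

(** * Induced modules *)

Section Existence.
Variables (F : numClosedFieldType) (g : lieSuperalg F).
Local Notation g0 := (gr g false).
Local Notation g1 := (gr g true).
Hypothesis solv : solvable_lsa g.

Lemma g0_add_g1 : (g0 + g1)%VS = fullv. Proof. exact: gr_add. Qed.

(** Starts from the line on which g0 + H acts through l, a representation because H is isotropic,
    and adds one odd dimension at a time along a flag from H to g1. *)
Lemma singular_module_exists (l : 'Hom(g, F^o)) (H : {vspace g}) : inL l -> gmod H ->
  isotropic l H -> exists (V : lmodType F) (rho : g -> V -> V) (v : V),
    [/\ is_rep fullv rho, v <> 0, forall z, z \in g0 -> rho z v = l z *: v &
        forall x, x \in H -> rho x v = 0].
Proof.
move=> Ll gH iH; have [s [fs sE]] := flag_exists solv gH (gmod1 g) gH.1.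
rewrite -g0_add_g1 -sE; elim: s fs {sE} => [_|[y w] s IH] /=.
  exists F^o, (fun x c => l (even_part x) *: c), (1 : F); split.
  - have lin (u : F^o) : linear (fun x => l (even_part x) *: u).
      move=> c x x'; have -> : even_part (c *: x + x') = c *: even_part x + even_part x' by
        exact: linearP.
      by rewrite homvD homvZ; lmodule F.
    split=> [x c u v|//|]; first by lmodule F.
    have e x : x \in g1 -> l (even_part x) = 0 :> F by move=> x1; rewrite even_part0 ?linear0.
    move=> [] [] x x' u xa xb xK xK'.
    + rewrite (e x xa) (e x' xb) !scale0r scaler0 subr0 even_part_id ?br11 //.
      by rewrite [l _](iH.2 _ _ (add0_odd gH.1 xK xa) (add0_odd gH.1 xK' xb)) scale0r.
    + by rewrite (e x xa) (e _ (br_gr xa xb)) !scale0r !scaler0 subr0.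
    + by rewrite (e x' xb) (e _ (br_gr xa xb)) !scale0r !scaler0 subr0.
    + rewrite !even_part_id ?br00 // inL_br //; lmodule F.
  - by apply/eqP; rewrite oner_eq0.
  - by move=> z z0; rewrite even_part_id.
  - by move=> x xH; rewrite (_ : l _ = 0 :> F) ?scale0r // even_part0 ?linear0 // (gmod_odd gH).
move=> [fs y1 ys ey]; have [V [rho [v [rep v0 v0l vH]]]] := IH fs.
have gs := gmod_flag gH fs; have [phi phiy phiY] := separating_form ys.
exists (V * V)%type, (step_rep y w phi rho), (v, 0); split.
- exact: step_is_rep gs y1 ys ey phiy phiY rep.
- by case.
- move=> z z0; rewrite (step_rep_even _ _ _ rep) //; congr (_, _); rewrite /= !(rep0r rep) ?addr0
  ?scaler0 ?addr0 //.
  exact: v0l.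
- move=> x xH; have xY := subvP (flag_top_sub H s) x xH.
  rewrite -[x]addr0 -(scale0r y) (step_rep_odd w gs y1 phiy phiY rep) // scale0r addr0.
  by congr (_, _); rewrite /= ?(rep0r rep) ?oppr0 // vH // addr0.
Qed.

End Existence.

(** * The action of the enveloping algebra and the universal property of induction *)

Section Universal.
Variables (F : numClosedFieldType) (g : lieSuperalg F) (V : lmodType F) (rho : g -> V -> V).
Hypothesis rep : is_rep fullv rho.

Fixpoint uact_term (t : uterm g) (v : V) : V :=
  match t with
  | UGen x => rho x v
  | UScal c => c *: v
  | UAdd s t => uact_term s v + uact_term t v
  | UMul s t => uact_term s (uact_term t v)
  end.

Lemma uact_term_linear t : linear (uact_term t).
Proof.
elim: t => [x|c|s IHs t IHt|s IHs t IHt] d u v /=.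
- exact: (rep_linr rep).
- by lmodule F.
- by rewrite IHs IHt; lmodule F.
- by rewrite IHt IHs.
Qed.

Let tD t u v : uact_term t (u + v) = uact_term t u + uact_term t v.
Proof. by have := uact_term_linear t 1 u v; rewrite !scale1r. Qed.
Let t0 t : uact_term t 0 = 0.
Proof. by apply: (addrI (uact_term t 0)); rewrite -tD !addr0. Qed.
Let tZ t c u : uact_term t (c *: u) = c *: uact_term t u.
Proof. by have := uact_term_linear t c u 0; rewrite t0 !addr0. Qed.

Lemma uact_term_ueq s t v : ueq s t -> uact_term s v = uact_term t v.
Proof.
move=> e; elim: e v => //=.
- by move=> r t' q _ IH1 _ IH2 v; rewrite IH1 IH2.
- by move=> r r' t' q _ IH1 _ IH2 v; rewrite IH1 IH2.
- by move=> r r' t' q _ IH1 _ IH2 v; rewrite IH1 IH2.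
- by move=> *; rewrite addrA.
- by move=> *; rewrite addrC.
- by move=> *; rewrite scale0r add0r.
- by move=> *; rewrite scale1r.
- by move=> *; rewrite !scale0r.
- by move=> *; rewrite scalerDl.
- by move=> *; rewrite scalerA.
- by move=> *; rewrite (repDl rep).
- by move=> *; rewrite (repZl rep).
- by move=> a b x y xa yb v; rewrite (rep_br rep v xa yb) ?memvf // subrK.
Qed.

Definition uact (u : Ug g) (v : V) : V := uact_term (repr u) v.

Lemma uactE t v : uact (upi t) v = uact_term t v.
Proof. exact/uact_term_ueq/ueq_repr. Qed.
Lemma uact_iota x v : uact (Defs.iota x) v = rho x v.
Proof. exact: uactE. Qed.
Lemma uactD u u' v : uact (u + u') v = uact u v + uact u' v.
Proof. by elim/Ug_ind: u => s; elim/Ug_ind: u' => t; rewrite -[_ + _]/(uadd _ _) uaddE !uactE. Qed.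
Lemma uactM u u' v : uact (u * u') v = uact u (uact u' v).
Proof. by elim/Ug_ind: u => s; elim/Ug_ind: u' => t; rewrite -[_ * _]/(umul _ _) umulE !uactE. Qed.
Lemma uactZ c u v : uact (c *: u) v = c *: uact u v.
Proof. by rewrite -[c *: u]/(uscal g c * u) uactM [uact (uscal _ _) _]uactE. Qed.
Lemma uact1 v : uact 1 v = v.
Proof. by rewrite [LHS]uactE /= scale1r. Qed.
Lemma uact0 v : uact 0 v = 0.
Proof. by rewrite [LHS]uactE /= scale0r. Qed.
Lemma uactZr c u v : uact u (c *: v) = c *: uact u v.
Proof. exact: tZ. Qed.

Lemma uact_stable (W : V -> Prop) u v : subspace W -> (forall x w, W w -> W (rho x w)) ->
  W v -> W (uact u v).
Proof.
move=> sW Wr; elim/Ug_ind: u => t; rewrite uactE.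
elim: t v => [x|c|s IHs t IHt|s IHs t IHt] v Wv /=.
- exact: Wr.
- exact: subspaceZ.
- by apply: subspaceD => //; [apply: IHs | apply: IHt].
- by apply: IHs; apply: IHt.
Qed.

Section Lift.
Variables (h : {vspace g}) (l : 'Hom(g, F^o)) (v0 : V).
Hypothesis v0P : forall a x, x \in h -> x \in gr g a -> rho x v0 = (if a then 0 else l x) *: v0.

Fixpoint ind_lift_term (t : tterm g) : V :=
  match t with
  | TTens u c => c *: uact u v0
  | TAdd s t => ind_lift_term s + ind_lift_term t
  | TScal c s => c *: ind_lift_term s
  end.

Lemma ind_lift_teq s t : teq h l s t -> ind_lift_term s = ind_lift_term t.
Proof.
elim=> //=.
- by move=> r t' q _ -> _ ->.
- by move=> r r' t' q _ -> _ ->.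
- by move=> c r r' _ ->.
- by move=> *; rewrite addrA.
- by move=> *; rewrite addrC.
- by move=> *; rewrite scale0r add0r.
- by move=> *; rewrite scalerA.
- by move=> *; rewrite scale1r.
- by move=> *; rewrite !scale0r.
- by move=> *; rewrite scalerDl.
- by move=> *; rewrite scalerDr.
- by move=> *; rewrite uactD scalerDr.
- by move=> *; rewrite scalerDl.
- by move=> *; rewrite uactZ; lmodule F.
- by move=> *; rewrite scalerA.
- by move=> a x u c xh xa; rewrite uactM uact_iota (v0P xh xa) uactZr scalerA mulrC.
Qed.

Definition ind_lift (m : indT h l) : V := ind_lift_term (repr m).

Lemma ind_lift_pi t : ind_lift (tpi h l t) = ind_lift_term t.
Proof. exact/ind_lift_teq/teq_repr. Qed.
Lemma ind_lift_tens u c : ind_lift (tens h l u c) = c *: uact u v0.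
Proof. exact: ind_lift_pi. Qed.
Lemma ind_liftD m n : ind_lift (m + n) = ind_lift m + ind_lift n.
Proof. by elim/indT_ind: m => s; elim/indT_ind: n => t; rewrite -[_ + _]/(tadd _ _) taddE
  !ind_lift_pi. Qed.
Lemma ind_liftZ c m : ind_lift (c *: m) = c *: ind_lift m.
Proof. by elim/indT_ind: m => s; rewrite -[_ *: _]/(tscal _ _) tscalE !ind_lift_pi. Qed.
Lemma ind_lift_linear : linear ind_lift.
Proof. by move=> c m n; rewrite ind_liftD ind_liftZ. Qed.
Lemma ind_lift_act x m : ind_lift (ind_act x m) = rho x (ind_lift m).
Proof.
elim/indT_tens_ind: m => [u c|m n Hm Hn|c m Hm].
- by rewrite ind_actE !ind_lift_tens uactM uact_iota (repZr rep).
- by rewrite ind_actD !ind_liftD Hm Hn (repDr rep).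
- by rewrite ind_actZ !ind_liftZ Hm (repZr rep).
Qed.
End Lift.
End Universal.

Section Supermodules.
Variables (F : numClosedFieldType) (g : lieSuperalg F).
Local Notation g0 := (gr g false).
Local Notation g1 := (gr g true).

Lemma supermod_is_rep (M : supermod g) (K : {vspace g}) : is_rep K (@act F g M).
Proof. by split=> [||a b x y u xa yb _ _]; [exact: act_linr | exact: act_linl | exact: act_br]. Qed.

Lemma inv_subspaceP (M : supermod g) (W : M -> Prop) : inv_subspace W -> subspace W.
Proof. by case. Qed.

Lemma mgr_subspace (M : supermod g) a : subspace (mgr M a).
Proof. by split=> [|c u v]; [exact: mgr0 | exact: mgrP]. Qed.

Lemma uact_mgr (N : supermod g) a b u (v : N) : udeg a u -> mgr N b v ->
  mgr N (a (+) b) (uact (@act F g N) u v).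
Proof.
have repN := supermod_is_rep N fullv.
move=> ua; elim: ua b v => {a u}.
- by move=> a x xa b v vb; rewrite (uact_iota repN); apply: act_mgr.
- by move=> a b v vb; rewrite (uact0 repN); apply: mgr0.
- by move=> b v vb; rewrite (uact1 repN).
- move=> a c u u' _ IH _ IH' b v vb; rewrite (uactD repN) (uactZ repN).
  by apply: mgrP; [apply: IH | apply: IH'].
- by move=> a a' u u' _ IH _ IH' b v vb; rewrite (uactM repN) -addbA; apply: IH; apply: IH'.
Qed.

Section Ind.
Variables (h : {vspace g}) (l : 'Hom(g, F^o)).
Definition vac : Ind h l := tens h l 1 1.

Lemma vac_even : mgr (Ind h l) false vac.
Proof. exact: ind_gr_tens (udeg_1 g). Qed.

Lemma vacP a x : x \in h -> x \in gr g a -> act x vac = (if a then 0 else l x) *: vac.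
Proof.
move=> xh xa; rewrite -[LHS]/(ind_act x (tens h l 1 1)) ind_actE mulr1 -[Defs.iota x]mul1r.
by rewrite (tens_bal l _ _ xh xa) tensZr.
Qed.

Lemma vac_generates (W : Ind h l -> Prop) : inv_subspace W -> W vac -> forall m, W m.
Proof.
move=> iW Wv; have sW := inv_subspaceP iW; have [_ _ Wx] := iW.
have repI := supermod_is_rep (Ind h l) fullv.
have E u w c : uact (@act F g (Ind h l)) u (tens h l w c) = tens h l (u * w) c.
  elim/Ug_ind: u w c => t; elim: t => [x|d|s IHs t IHt|s IHs t IHt] w c.
  - by rewrite (uact_iota repI); apply: ind_actE.
  - by rewrite [LHS](uactE repI) /= -tensZl; congr tens.
  - by rewrite -uaddE (uactD repI) IHs IHt -tensDl -mulrDl.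
  - by rewrite -umulE (uactM repI) IHt IHs mulrA.
move=> m; elim/indT_tens_ind: m => [u c|m n|c m]; [|exact: subspaceD|exact: subspaceZ].
rewrite -[c]mulr1 tensZr -[u]mulr1 -E; apply: (subspaceZ sW).
exact: (uact_stable repI).
Qed.

(** The relations of [Ind] do not collapse it: [ind_lift] sends [vac] to the nonzero vector of
    [singular_module_exists]. *)
Lemma vac_neq0 : solvable_lsa g -> inL l -> polarization l h -> vac <> 0.
Proof.
move=> solv Ll ph; have [gH mH hE] := polarization_gmod ph.
have [V [rho [v [rep v0 v0l vH]]]] := singular_module_exists solv Ll gH mH.1.
have vP a x : x \in h -> x \in gr g a -> rho x v = (if a then 0 else l x) *: v.
  by case: a => xh xa; [rewrite scale0r vH // memv_cap xh | rewrite v0l].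
move=> e; apply: v0; have := ind_lift_tens rep vP 1 1.
rewrite -[tens h l 1 1]/(vac) e scale1r (uact1 rep) => <-.
by rewrite -(scale0r (0 : indT h l)) (ind_liftZ rep vP) scale0r.
Qed.
End Ind.

End Supermodules.

(** * Irreducibility and type *)

Section Irreducible.
Variables (F : numClosedFieldType) (g : lieSuperalg F).
Implicit Types (h H : {vspace g}) (l : 'Hom(g, F^o)).
Local Notation g0 := (gr g false).
Local Notation g1 := (gr g true).
Hypothesis solv : solvable_lsa g.

Section ActFacts.
Variable N : supermod g.
Let repN := supermod_is_rep N fullv.
Lemma actDr x (u v : N) : act x (u + v) = act x u + act x v. Proof. exact: repDr repN _ _ _. Qed.
Lemma actZr x c (u : N) : act x (c *: u) = c *: act x u. Proof. exact: repZr repN _ _ _. Qed.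
Lemma act0r x : act x (0 : N) = 0. Proof. exact: rep0r repN _. Qed.
Lemma actDl x y (u : N) : act (x + y) u = act x u + act y u. Proof. exact: repDl repN _ _ _. Qed.
Lemma actZl c x (u : N) : act (c *: x) u = c *: act x u. Proof. exact: repZl repN _ _ _. Qed.
Lemma act_even b z y (u : N) : z \in g0 -> y \in gr g b ->
  act z (act y u) = act y (act z u) + act (br z y) u.
Proof. by move=> z0 yb; apply: (rep_even repN u z0 yb); apply: memvf. Qed.
Lemma act_odd x y (u : N) : x \in g1 -> y \in g1 ->
  act x (act y u) = act (br x y) u - act y (act x u).
Proof. by move=> x1 y1; apply: (rep_odd repN u x1 y1); apply: memvf. Qed.
Lemma act_sq x (u : N) : x \in g1 -> act x (act x u) = 2^-1 *: act (br x x) u.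
Proof. by move=> x1; apply: (rep_sq repN u x1); apply: memvf. Qed.
End ActFacts.

Section Closure.
Variables (N : supermod g) (l : 'Hom(g, F^o)) (H : {vspace g}) (E : N -> Prop).
Hypotheses (Ll : inL l) (gH : gmod H) (mH : max_isotropic l H).
Hypotheses (sE : subspace E) (EH : forall x u, x \in H -> E u -> act x u = 0).
Hypothesis E0 : forall z u, z \in g0 -> E u -> act z u = l z *: u.
Hypothesis EP : forall a u, a \in perp l H -> E u -> E (act a u).
Let repN := supermod_is_rep N fullv.
Let gP := gmod_perp Ll gH.
Let HP := max_isotropic_sub mH.

Lemma module_top_inv s : is_flag (perp l H) s -> flag_top (perp l H) s = g1 ->
  inv_subspace (module_top (@act F g N) E s).
Proof.
move=> fs sE1; have [M0 MY] := module_top_stable repN gP sE E0 EP fs.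
have sM := module_top_subspace repN sE s.
split=> [||x u Mu]; [exact: sM.1 | exact: sM.2 |].
rewrite (even_odd_part x) actDl; apply: (subspaceD sM).
  by apply: M0 => //; apply: even_part_in.
by apply: MY => //; rewrite sE1 odd_part_in.
Qed.

(** T is [module_top] for a flag that reaches g1, hence an invariant subspace. *)
Lemma singular_closure : exists T : N -> Prop,
  [/\ inv_subspace T, forall u, E u -> T u,
      forall u, T u -> (forall x, x \in H -> act x u = 0) -> E u &
      forall W, inv_subspace W -> (forall u, W u -> T u) -> (exists2 u, W u & u <> 0) ->
        exists u, [/\ W u, u <> 0 & E u]].
Proof.
have [s [fs sE1]] := flag_exists solv gP (gmod1 g) gP.1.
have [C1 _ C3 _] := singular_vectors repN gH gP HP sE EH E0 EP fs.
exists (module_top (@act F g N) E s); split=> //; first exact: module_top_inv.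
  by move=> u; apply: (module_top_base repN).
move=> W iW WT Wn; have [|u [Wu u0 uH]] := C1 W (inv_subspaceP iW) WT _ Wn.
  by move=> x u _; have [_ _] := iW; apply.
by exists u; split=> //; apply: C3 => //; apply: WT.
Qed.

(** A basis d of the smaller module gives the basis d, yd, independent by the last property of
    [singular_vectors]. As zy = yz + w(z) y up to an element of the smaller flag space, z is block
    triangular and its trace goes from T to 2T + m w(z). *)
Lemma module_top_basis n (b : 'I_n -> N) s : is_flag (perp l H) s ->
  (0 < n)%N -> independent b -> (forall u, E u <-> exists c : 'I_n -> F, u = \sum_i c i *: b i) ->
  exists m (d : 'I_m -> N), [/\ (0 < m)%N, independent d,
    forall u, module_top (@act F g N) E s u <-> exists c : 'I_m -> F, u = \sum_i c i *: d i &
    forall z, z \in g0 -> exists A : 'M_m, (forall i, act z (d i) = comb A d i) /\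
      \tr A = m%:R * (l z + 2^-1 * \sum_(yw <- s) yw.2 z)].
Proof.
move=> + n0 ib bE; elim: s => [_|[y w] s IH] /=.
  exists n, b; split=> // z z0; exists (l z)%:M; split.
    move=> i; rewrite E0 //; last first.
      by apply/bE; exists (fun j => (1%:M : 'M[F]_n) i j); rewrite -[LHS](comb1 b i).
    by rewrite -scalemx1 /comb -[b i in LHS](comb1 b i) scaler_sumr; apply: eq_bigr => j _;
      rewrite scalerA !mxE.
  by rewrite mxtrace_scalar big_nil mulr0 addr0 mulr_natl.
move=> fs'; have [fs y1 ys ey] := fs'; have [m [d [m0 id dE dz]]] := IH fs.
have [_ _ _ C4] := singular_vectors repN gH gP HP sE EH E0 EP (s := (y, w) :: s) fs'.
have [M0 MY] := module_top_stable repN gP sE E0 EP fs.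
have dM i : module_top (@act F g N) E s (d i).
  by apply/dE; exists (fun j => (1%:M : 'M[F]_m) i j); rewrite -[LHS](comb1 d i).
have ysum (c : 'I_m -> F) : \sum_i c i *: act y (d i) = act y (\sum_i c i *: d i).
  by rewrite (big_morph _ (@actDr N y) (@act0r N y)); apply: eq_bigr => i _; rewrite actZr.
exists (m + m)%N, (family_cat d (fun i => act y (d i))); split.
- by rewrite addn_gt0 m0.
- move=> c; rewrite sum_family_cat ysum => e.
  have Mc (e' : 'I_m -> F) : module_top (@act F g N) E s (\sum_i e' i *: d i) by apply/dE; exists
    e'.
  have r0 : \sum_i c (rshift m i) *: d i = 0.
    apply: C4; first exact: (Mc (fun i => c (rshift m i))).
    rewrite /=.
    move: e => /eqP; rewrite addrC addr_eq0 => /eqP ->.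
    apply: (subspaceN (module_top_subspace repN sE s)).
    exact: (Mc (fun i => c (lshift m i))).
  move: e; rewrite r0 act0r addr0 => l0 i.
  by case: (split_ordP i) => j -> {i}; [apply: (id (fun j => c (lshift m j))) |
    apply: (id (fun j => c (rshift m j)))].
- move=> u; split=> [[a [b' [/dE[ca ->] /dE[cb ->] ->]]]|[c ->]].
    exists (fun i => match split i with inl j => cb j | inr j => ca j end).
    rewrite sum_family_cat addrC ysum; congr (_ + act _ _).
      by apply: eq_bigr => i _; rewrite (unsplitK (inl _)).
    by apply: eq_bigr => i _; rewrite (unsplitK (inr _)).
  rewrite sum_family_cat ysum addrC; exists (\sum_i c (rshift m i) *: d i), (\sum_i c (lshift m
    i) *: d i).
  by split=> //; apply/dE; [exists (fun i => c (rshift m i)) | exists (fun i => c (lshift m i))].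
- move=> z z0; have [A [Az Atr]] := dz z z0.
  have /choice[B BE] i : exists c : 'I_m -> F, act (br z y - w z *: y) (d i) = \sum_j c j *: d j.
    by apply/dE; apply: MY => //; apply: ey.
  exists (block_mx A 0 (\matrix_(i, j) B i j) (A + (w z)%:M)); split; last first.
    rewrite mxtrace_block mxtraceD mxtrace_scalar Atr big_cons /= natrD -mulr_natl.
    by field.
  move=> i; case: (split_ordP i) => j -> {i}; rewrite /comb sum_family_cat.
    rewrite family_catl Az [X in _ = _ + X]big1 ?addr0 => [|i _].
      by apply: eq_bigr => i _; rewrite block_mxEul.
    by rewrite block_mxEur mxE scale0r.
  rewrite family_catr (act_even _ z0 y1).
  have -> : br z y = (br z y - w z *: y) + w z *: y by rewrite subrK.
  rewrite actDl BE actZl Az addrCA; congr (_ + _).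
    by apply: eq_bigr => i _; rewrite block_mxEdl mxE.
  rewrite /comb -ysum.
  have -> : w z *: act y (d j) = \sum_i (w z)%:M j i *: act y (d i).
    rewrite -scalemx1 -[act y (d j) in LHS](comb1 (fun i => act y (d i)) j) /comb scaler_sumr.
    by apply: eq_bigr => i _; rewrite scalerA !mxE.
  by rewrite -big_split; apply: eq_bigr => i _; rewrite block_mxEdr [(A + _) j i]mxE scalerDl.
Qed.

End Closure.
End Irreducible.

(** * Modules induced from a polarization *)

Section InducedFromPolarization.
Variables (F : numClosedFieldType) (g : lieSuperalg F).
Local Notation g0 := (gr g false).
Local Notation g1 := (gr g true).
Hypothesis solv : solvable_lsa g.
Variables (h : {vspace g}) (l : 'Hom(g, F^o)).
Hypotheses (Ll : inL l) (ph : polarization l h).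
Local Notation H := (h :&: g1)%VS.
Local Notation v := (vac h l).
Let gH : gmod H. Proof. by have [] := polarization_gmod ph. Qed.
Let mH : max_isotropic l H. Proof. by have [] := polarization_gmod ph. Qed.
Let h0 : (g0 <= h)%VS. Proof. by case: ph. Qed.
Let v0 : v <> 0. Proof. exact: vac_neq0 solv Ll ph. Qed.

Lemma vac_odd x : x \in H -> act x v = 0.
Proof. by rewrite memv_cap => /andP[xh x1]; rewrite (vacP l xh x1) scale0r. Qed.

Lemma vac_weight z : z \in g0 -> act z v = l z *: v.
Proof. by move=> z0; rewrite (vacP l (subvP h0 z z0) z0). Qed.

Section Line.
Variable u : Ind h l.
Hypotheses (uH : forall x, x \in H -> act x u = 0) (u0 : forall z, z \in g0 -> act z u = l z *: u).
Hypothesis uP : forall a, a \in perp l H -> exists c, act a u = c *: u.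

Definition line (w : Ind h l) : Prop := exists c, w = c *: u.

Lemma line_subspace : subspace line.
Proof.
split=> [|c _ _ [d ->] [e ->]]; first by exists 0; rewrite scale0r.
by exists (c * d + e); rewrite scalerDl scalerA.
Qed.

Lemma line_closure : exists T : Ind h l -> Prop,
  [/\ inv_subspace T, T u,
      forall w, T w -> (forall x, x \in H -> act x w = 0) -> line w &
      forall W, inv_subspace W -> (forall w, W w -> T w) -> (exists2 w, W w & w <> 0) -> W u].
Proof.
have [|||T [iT ET TE TW]] := @singular_closure F g solv (Ind h l) l H line Ll gH mH line_subspace.
- by move=> x _ xH [c ->]; rewrite actZr uH // scaler0.
- by move=> z _ z0 [c ->]; rewrite actZr u0 // !scalerA mulrC.
- by move=> a _ aP [c ->]; have [d e] := uP aP; exists (c * d); rewrite actZr e scalerA.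
exists T; split=> //; first by apply: ET; exists 1; rewrite scale1r.
move=> W iW WT Wn; have [w [Ww w0 [c wE]]] := TW W iW WT Wn.
have c0 : c != 0 by apply/negP => /eqP c0; apply: w0; rewrite wE c0 scale0r.
by rewrite -(scalerK c0 u) -wE; apply: subspaceZ => //; apply: inv_subspaceP.
Qed.
End Line.

(** The singular vectors form the line of [vac], so every nonzero invariant subspace, graded or not,
    contains the generator [vac]. *)
Lemma vac_G_type : perp l H = H -> G_type (Ind h l).
Proof.
move=> PH; split; first by exists v; apply/eqP.
have [|T [iT Tv _ TW]] := line_closure vac_odd vac_weight.
  by move=> a; rewrite PH => aH; exists 0; rewrite vac_odd // scale0r.
move=> W iW [[w Ww /eqP w0] [w' nW]]; apply: nW; apply: vac_generates => //.
by apply: TW => //; [move=> u _; apply: vac_generates | exists w].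
Qed.

Section OddRank.
Variable y : g.
Hypotheses (PE : perp l H = (H + <[y]>)%VS) (yy : l (br y y) != 0).
Hypothesis zy : forall z, z \in g0 -> br z y \in H.
Local Notation v' := (act y v).

Let yP : y \in perp l H. Proof. by rewrite PE (subvP (addvSr _ _)) // memv_line. Qed.
Let y1 : y \in g1. Proof. exact: perp_odd yP. Qed.

Lemma vac'_odd x : x \in H -> act x v' = 0.
Proof.
move=> xH; have x1 := gmod_odd gH xH.
by rewrite act_odd // (vac_odd xH) act0r subr0 vac_weight ?br11 // (perp_orth xH yP) scale0r.
Qed.

Lemma vac'_weight z : z \in g0 -> act z v' = l z *: v'.
Proof. by move=> z0; rewrite (act_even _ z0 y1) vac_weight // actZr (vac_odd (zy z0)) addr0. Qed.

Lemma vac'_act : act y v' = (2^-1 * l (br y y)) *: v.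
Proof. by rewrite act_sq // vac_weight ?br11 // scalerA. Qed.

Let k0 : 2^-1 * l (br y y) != 0.
Proof. by rewrite mulf_neq0 // invr_eq0 pnatr_eq0. Qed.

Lemma vac'_mgr : mgr (Ind h l) true v'.
Proof. by have := act_mgr y1 (vac_even h l). Qed.

Lemma vac'_neq0 : v' <> 0.
Proof.
move=> e; have := vac'_act; rewrite e act0r => /esym/eqP; rewrite scaler_eq0 (negPf k0) /=.
by move/eqP.
Qed.

Lemma vac_pair c c' : c *: v + c' *: v' = 0 -> c = 0 /\ c' = 0.
Proof.
move=> e; have ev : c *: v = 0.
  apply: (@mgr_cap F g (Ind h l)); first exact: (subspaceZ (mgr_subspace _ _) _ (vac_even h l)).
  have -> : c *: v = (- c') *: v' by apply/eqP; rewrite scaleNr -addr_eq0; apply/eqP.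
  exact: (subspaceZ (mgr_subspace _ _) _ vac'_mgr).
move: (e); rewrite ev add0r => /eqP; move/eqP: ev; rewrite !scaler_eq0.
by move=> /orP[/eqP ->|/eqP//] /orP[/eqP ->|/eqP/vac'_neq0].
Qed.

Lemma vac_perp a c c' : a \in perp l H -> exists d d', act a (c *: v + c' *: v') = d *: v + d' *:
  v'.
Proof.
rewrite PE => /memv_add_line[b bH [e ->]].
exists (e * (c' * (2^-1 * l (br y y)))), (e * c).
rewrite actDl actZl !actDr !actZr (vac_odd bH) (vac'_odd bH) vac'_act; lmodule F.
Qed.

Definition plane (u : Ind h l) : Prop := exists c c', u = c *: v + c' *: v'.

Lemma plane_subspace : subspace plane.
Proof.
split=> [|c _ _ [d [d' ->]] [e [e' ->]]]; first by exists 0, 0; rewrite !scale0r addr0.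
by exists (c * d + e), (c * d' + e'); lmodule F.
Qed.

Lemma planeH x u : x \in H -> plane u -> act x u = 0.
Proof. by move=> xH [c [c' ->]]; rewrite actDr !actZr (vac_odd xH) (vac'_odd xH) !scaler0 addr0.
  Qed.

Lemma plane0 z u : z \in g0 -> plane u -> act z u = l z *: u.
Proof.
move=> z0 [c [c' ->]]; rewrite actDr !actZr vac_weight // vac'_weight //; lmodule F.
Qed.

Lemma planeP a u : a \in perp l H -> plane u -> plane (act a u).
Proof. by move=> aP [c [c' ->]]; apply: vac_perp. Qed.

(** v is even and v' is odd, so W contains both terms of u; if only the second is nonzero, y brings
    v' back to a nonzero multiple of v. *)
Lemma plane_graded W u : inv_subspace W -> graded_subspace W -> W u -> u <> 0 -> plane u -> W v.
Proof.
move=> iW grW Wu u0 [c [c' uE]]; have sW := inv_subspaceP iW.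
have [|||Wc Wc'] := grW (c *: v) (c' *: v') _ _ _.
- exact: (subspaceZ (mgr_subspace _ _) _ (vac_even h l)).
- exact: (subspaceZ (mgr_subspace _ _) _ vac'_mgr).
- by rewrite -uE.
have [c0|c0] := eqVneq c 0; last first.
  by rewrite -(scalerK c0 v); apply: subspaceZ.
have c'0 : c' != 0.
  by apply/negP => /eqP c'0; apply: u0; rewrite uE c0 c'0 !scale0r addr0.
have Wv' : W v' by rewrite -(scalerK c'0 v'); apply: subspaceZ.
have [_ _ /(_ y _ Wv')] := iW; rewrite vac'_act => Wv.
by rewrite -(scalerK k0 v); apply: subspaceZ.
Qed.

Lemma plane_basis : exists b : 'I_2 -> Ind h l,
  independent b /\ forall u, plane u <-> exists c : 'I_2 -> F, u = \sum_i c i *: b i.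
Proof.
exists (fun i => if i == 0 then v else v'); split=> [c|u].
  rewrite !big_ord_recl big_ord0 addr0 /= => /vac_pair[c0 c1] i.
  case: (unliftP 0 i) => [j ->|->] //; rewrite ord1; exact: c1.
split=> [[c [c' ->]]|[c ->]].
  exists (fun i => if i == 0 then c else c').
  by rewrite !big_ord_recl big_ord0 addr0.
by rewrite !big_ord_recl big_ord0 addr0 /=; exists (c 0), (c (lift 0 0)).
Qed.

(* y acts on v and v' with square a nonzero scalar k0; an eigenvector v + s v' generates
   a proper submodule, not graded. *)
Lemma vac_Q_subspace : exists W : Ind h l -> Prop,
  [/\ inv_subspace W, ~ graded_subspace W & nontrivial_proper W].
Proof.
have [s sE] : exists s, s ^+ 2 * (2^-1 * l (br y y)) = 1.
  by exists (sqrtC (2^-1 * l (br y y))^-1); rewrite sqrtCK mulVf.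
have s0 : s != 0 by apply/negP => /eqP s0; move/eqP: sE; rewrite s0 expr0n mul0r eq_sym oner_eq0.
(* The choice of s gives yw = s^-1 w, so the line of w is stable under [perp l H]. *)
pose w := v + s *: v'.
have [|||T [iT Tw TE _]] := @line_closure w.
- by move=> x xH; rewrite /w actDr actZr (vac_odd xH) (vac'_odd xH) scaler0 addr0.
- by move=> z z0; rewrite /w actDr actZr vac_weight // vac'_weight // scalerDr !scalerA mulrC.
- rewrite PE => a /memv_add_line[b bH [c ->]]; exists (c * s^-1).
  rewrite /w actDl actZl !actDr !actZr (vac_odd bH) (vac'_odd bH) vac'_act.
  have -> : s^-1 = s * (2^-1 * l (br y y)) by apply: (mulfI s0); rewrite mulfV // -[LHS]sE; ring.
  have e : s * (2^-1 * l (br y y)) * s = 1 by rewrite -[RHS]sE; ring.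
  have e' : c * (s * (2^-1 * l (br y y))) * s = c by rewrite -mulrA e mulr1.
  by rewrite [RHS]scalerDr [_ *: (s *: _) in RHS]scalerA e'; lmodule F.
(* A singular vector of T is a multiple of w, and v is not. *)
have nTv : ~ T v.
  move=> /TE[|c vE]; first exact: vac_odd.
  have [|c0 cs] := @vac_pair (1 - c) (- (c * s)).
    have -> : (1 - c) *: v + (- (c * s)) *: v' = v - c *: w by rewrite /w; lmodule F.
    by rewrite -vE subrr.
  move/eqP: cs; rewrite oppr_eq0 mulf_eq0 (negPf s0) orbF => /eqP c00.
  by move/eqP: c0; rewrite c00 subr0 oner_eq0.
exists T; split=> //.
- move=> grT; apply: nTv; have [||] := grT v (s *: v') _ _ Tw => //; first exact: vac_even.
  exact: (subspaceZ (mgr_subspace _ _) _ vac'_mgr).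
- split; last by exists v.
  exists w => //; apply/eqP => w0.
  have [|e _] := @vac_pair 1 s; first by rewrite scale1r.
  by move/eqP: e; rewrite oner_eq0.
Qed.

End OddRank.

(** Treats both parities of the rank at once: E is the line of [vac], or the plane of [vac] and
    [act y vac]. *)
Lemma ind_vac_space : exists (E : Ind h l -> Prop) n (b : 'I_n -> Ind h l),
  [/\ [/\ subspace E, forall x u, x \in H -> E u -> act x u = 0,
          forall z u, z \in g0 -> E u -> act z u = l z *: u &
          forall a u, a \in perp l H -> E u -> E (act a u)], E v,
      [/\ (0 < n)%N, independent b & forall u, E u <-> exists c : 'I_n -> F, u = \sum_i c i *: b
        i] &
      forall W u, inv_subspace W -> graded_subspace W -> W u -> u <> 0 -> E u -> W v].
Proof.
have [PH|[y [yH PE yy zy]]] := perp_cases Ll gH mH.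
  exists (line v), 1%N, (fun=> v); split.
  - split; first exact: line_subspace.
    + by move=> x u xH [c ->]; rewrite actZr vac_odd // scaler0.
    + by move=> z u z0 [c ->]; rewrite actZr vac_weight // !scalerA mulrC.
    + move=> a u; rewrite PH => aH [c ->]; rewrite actZr vac_odd // scaler0.
      by exists 0; rewrite scale0r.
  - by exists 1; rewrite scale1r.
  - split=> // [c|u].
      rewrite big_ord1 => /eqP; rewrite scaler_eq0 => /orP[/eqP c0 i|/eqP//].
      by rewrite ord1.
    split=> [[c ->]|[c ->]]; first by exists (fun=> c); rewrite big_ord1.
    by rewrite big_ord1; exists (c 0).
  - move=> W u iW _ Wu u0 [c uE].
    have c0 : c != 0 by apply/negP => /eqP c0; apply: u0; rewrite uE c0 scale0r.
    by rewrite -(scalerK c0 v) -uE; apply: subspaceZ => //; apply: inv_subspaceP.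
have [b [ib bE]] := plane_basis PE yy.
exists (plane y), 2%N, b; split=> //.
- split; first exact: plane_subspace.
  + exact: planeH PE.
  + exact: plane0 PE zy.
  + exact: planeP PE.
- by exists 1, 0; rewrite scale1r scale0r addr0.
- exact: plane_graded PE yy.
Qed.

Lemma ind_irreducible : irreducible (Ind h l).
Proof.
have [E [n [b [[sE EH E0 EP] Ev _ EW]]]] := ind_vac_space.
have [T [iT ET _ TW]] := singular_closure solv Ll gH mH sE EH E0 EP.
split; first by exists v; apply/eqP.
move=> W iW grW [[w Ww /eqP w0] [w' nW]]; apply: nW; apply: vac_generates => //.
have [||u [Wu u0 Eu]] := TW W iW.
- by move=> u _; apply: vac_generates => //; apply: ET.
- by exists w.
exact: EW grW Wu u0 Eu.
Qed.

(** The weights of a flag from [perp l H] to g1 add up to tau of [perp l H], which equals tau H = -2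
    theta_h on g0. *)
Lemma ind_trace : exists n (b : 'I_n -> Ind h l),
  [/\ (0 < n)%N, independent b, forall u, exists c : 'I_n -> F, u = \sum_i c i *: b i &
     forall z, z \in g0 -> exists A : 'M_n, (forall i, act z (b i) = comb A b i) /\
       \tr A = n%:R * (l - theta h) z].
Proof.
have [E [n [b [[sE EH E0 EP] Ev [n0 ib bE] _]]]] := ind_vac_space.
have gP := gmod_perp Ll gH.
have [s [fs sE1]] := flag_exists solv gP (gmod1 g) gP.1.
have [m [d [m0 id dE dz]]] := module_top_basis Ll gH mH sE EH E0 EP fs n0 ib bE.
have iT := module_top_inv Ll gH sE E0 EP fs sE1.
exists m, d; split=> // [u|z z0].
  apply/dE; apply: vac_generates => //; apply: (module_top_base (supermod_is_rep _ fullv)) => //.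
have [A [Az Atr]] := dz z z0; exists A; split=> //.
rewrite Atr -(tau_flag gP fs sE1 z0) -(tau_perp Ll gH mH z0) lfunE /= lfunE /= theta_tau //.
by rewrite opprK.
Qed.

Lemma ind_fin_dim : fin_dim (Ind h l).
Proof. by have [n [b [_ _ bs _]]] := ind_trace; exists n, b. Qed.

End InducedFromPolarization.

(** * Isomorphisms *)

Section Isomorphisms.
Variables (F : numClosedFieldType) (g : lieSuperalg F).
Implicit Types (M N : supermod g) (h t : {vspace g}) (l m : 'Hom(g, F^o)).
Local Notation g0 := (gr g false).
Local Notation g1 := (gr g true).

(** Isomorphism up to [Pi] with the shift as a boolean, so that composition adds shifts. *)
Definition parity_iso M N : Prop := exists b (f : {linear M -> N}),
  [/\ bijective f, forall a u, mgr M a u -> mgr N (a (+) b) (f u)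
    & forall x u, f (act x u) = act x (f u)].

Lemma parity_isoP M N : smod_iso_Pi M N <-> parity_iso M N.
Proof.
split=> [[[f [bf gf af]]|[f [bf gf af]]]|[[] [f [bf gf af]]]].
- by exists false, f; split=> // a u; rewrite addbF; apply: gf.
- by exists true, f; split=> // a u; rewrite addbT; apply: gf.
- by right; exists f; split=> // a u /gf; rewrite addbT.
- by left; exists f; split=> // a u /gf; rewrite addbF.
Qed.

Lemma mgr_opposite M a u v : mgr M a u -> mgr M (~~ a) v -> mgr M a (u + v) -> v = 0.
Proof.
move=> ua va uva; have va' : mgr M a v.
  by rewrite -[v](addKr u) addrC; apply: (subspaceB (mgr_subspace M a)).
by case: a {ua uva} va va' => ? ?; apply: (@mgr_cap F g M).
Qed.

Lemma parity_iso_refl M : parity_iso M M.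
Proof.
exists false, (idfun : {linear M -> M}); split=> //; first by exists idfun.
by move=> a u; rewrite addbF.
Qed.

Lemma parity_iso_trans M N (K : supermod g) : parity_iso M N -> parity_iso N K -> parity_iso M K.
Proof.
move=> [b [f [bf gf af]]] [c [f' [bf' gf' af']]].
exists (b (+) c), (f' \o f : {linear M -> K}); split.
- exact: bij_comp.
- by move=> a u /gf/gf'; rewrite addbA.
- by move=> x u; rewrite /= af af'.
Qed.

(** Homogeneity of the inverse is obtained by splitting a preimage: the component of the wrong
    degree has image 0. *)
Lemma parity_iso_sym M N : parity_iso M N -> parity_iso N M.
Proof.
move=> [b [f [[f' fK f'K] gf af]]].
have f'_lin : linear f'.
  by move=> c u v; apply: (can_inj fK); rewrite f'K linearP !f'K.
pose k : {linear N -> M} := HB.pack f' (GRing.isLinear.Build _ _ _ _ f' f'_lin).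
exists b, k; split.
- by exists f.
- move=> c w wc; rewrite -[k w]/(f' w).
  have [u0 [u1 [h0 h1 e]]] := mgr_add (f' w).
  have fe : w = f u0 + f u1 by rewrite -linearD -e f'K.
  have := gf _ _ h0; have := gf _ _ h1; rewrite /= => f1 f0.
  have [cb|cb] := eqVneq c b.
    have fu1 : f u1 = 0 by apply: (mgr_opposite f0 f1); rewrite -fe -cb.
    by rewrite e cb addbb (can_inj fK (etrans fu1 (esym (linear0 f)))) addr0.
  have cE : c = ~~ b by case: (c) (b) cb => [] [].
  have fu0 : f u0 = 0.
    by apply: (@mgr_opposite N (~~ b) (f u1) (f u0)); rewrite ?negbK // addrC -fe -cE.
  by rewrite e cE addNb addbb (can_inj fK (etrans fu0 (esym (linear0 f)))) add0r.
- by move=> x u; apply: (can_inj fK); rewrite af -![k _]/(f' _) !f'K.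
Qed.

(** The map that sends [vac] to w shifts degrees by b, so its kernel and image are graded
    submodules; irreducibility of both sides makes it bijective. *)
Lemma frobenius_iso h l N b (w : N) : irreducible (Ind h l) -> irreducible N ->
  mgr N b w -> w <> 0 ->
  (forall a x, x \in h -> x \in gr g a -> act x w = (if a then 0 else l x) *: w) ->
  parity_iso (Ind h l) N.
Proof.
move=> [_ irrI] [_ irrN] wb w0 wP; have repN := supermod_is_rep N fullv.
pose f' := @ind_lift F g N (@act F g N) h l w.
have f'_lin : linear f' := ind_lift_linear repN wP.
pose f : {linear Ind h l -> N} := HB.pack f' (GRing.isLinear.Build _ _ _ _ f' f'_lin).
have fA x u : f (act x u) = act x (f u) := ind_lift_act repN wP x u.
have ft u c : f (tens h l u c) = c *: uact (@act F g N) u w := ind_lift_tens repN wP u c.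
have fv : f (vac h l) = w by rewrite ft scale1r (uact1 repN).
have fgr a u : mgr (Ind h l) a u -> mgr N (a (+) b) (f u).
  elim=> [u' c ua|c m n _ Hm _ Hn]; last by rewrite linearP; apply: mgrP.
  by rewrite ft; apply: (subspaceZ (mgr_subspace N _)); apply: uact_mgr.
have f_inj u : f u = 0 -> u = 0.
  move=> fu; apply: contrapT => /eqP u0; apply: (irrI (fun u => f u = 0)).
  - split=> [|c u' v fu' fv'|x u' fu']; first exact: linear0.
      by rewrite linearP fu' fv' scaler0 addr0.
    by rewrite fA fu' act0r.
  - move=> u0' u1 h0 h1 e; have e0 := fgr _ _ h0; have e1 := fgr _ _ h1.
    have f1 : f u1 = 0.
      apply: (mgr_opposite e0); first by rewrite -addNb.
      by rewrite -linearD e; apply: mgr0.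
    by split=> //; move: e; rewrite linearD f1 addr0.
  - by split; [exists u | exists (vac h l); rewrite fv].
have f_surj w' : exists u, f u = w'.
  apply: contrapT => nw; apply: (irrN (fun w' => exists u, f u = w')).
  - split=> [|c _ _ [u <-] [v <-]|x _ [u <-]]; first by exists 0; rewrite linear0.
      by exists (c *: u + v); rewrite linearP.
    by exists (act x u); rewrite fA.
  - move=> w0' w1 h0 h1 [u e]; have [u0 [u1 [k0 k1 uE]]] := mgr_add u.
    have e0 := fgr _ _ k0; have e1 := fgr _ _ k1; rewrite /= in e0 e1.
    move: e; rewrite uE linearD => e.
    have sN c := mgr_subspace N c.
    have [bE|bE] := boolP b; rewrite ?bE ?(negbTE bE) /= in e0 e1.
      have d1 : w1 - f u0 = 0.
        apply: (@mgr_cap F g N); last exact: (subspaceB (sN _)).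
        have -> : w1 - f u0 = f u1 - w0' by apply/eqP; rewrite subr_eq addrAC [f u1 + _]addrC e
          addrC addKr.
        exact: (subspaceB (sN _)).
      have w1E : w1 = f u0 by apply/eqP; rewrite -subr_eq0 d1.
      split; last by exists u0.
      by exists u1; move: e; rewrite w1E addrC => /addIr.
    have d1 : w0' - f u0 = 0.
      apply: (@mgr_cap F g N); first exact: (subspaceB (sN _)).
      have -> : w0' - f u0 = f u1 - w1.
        by apply/eqP; rewrite subr_eq addrAC [f u1 + _]addrC e addrK.
      exact: (subspaceB (sN _)).
    have w0E : w0' = f u0 by apply/eqP; rewrite -subr_eq0 d1.
    split; first by exists u0.
    by exists u1; move: e; rewrite w0E => /addrI.
  - by split; [exists w; [exists (vac h l) | apply/eqP] | exists w'].
have [k kP] := choice f_surj.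
exists b, f; split=> //; exists k => // u; apply/eqP; rewrite -subr_eq0; apply/eqP.
by apply: f_inj; rewrite linearB kP subrr.
Qed.

Section Solvable.
Hypothesis solv : solvable_lsa g.

(** Compares the traces of [ind_trace]; the dimensions are first identified through the trace of the
    identity. *)
Lemma ind_iso_weight l m h t : inL l -> polarization l h -> inL m -> polarization m t ->
  parity_iso (Ind h l) (Ind t m) -> l - theta h = m - theta t.
Proof.
move=> Ll ph Lm pt [b [f [[f' fK f'K] _ af]]].
have [n [v [n0 iv vs vz]]] := ind_trace solv Ll ph.
have [n' [w [n0' iw ws wz]]] := ind_trace solv Lm pt.
pose fv i := f (v i).
have f_sum k (c : 'I_k -> F) (d : 'I_k -> Ind h l) : f (\sum_i c i *: d i) = \sum_i c i *: f (d i).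
  by rewrite linear_sum; apply: eq_bigr => i _; apply: linearZ.
have ifv : independent fv.
  move=> c; rewrite -f_sum => e; apply: iv; apply: (can_inj fK); rewrite e linear0 //.
have /choice[P PE] i : exists c : 'I_n -> F, w i = \sum_j c j *: fv j.
  by have [c e] := vs (f' (w i)); exists c; rewrite -f_sum -e f'K.
have /choice[Q QE] i := ws (fv i).
have wP : w =1 comb (\matrix_(i, j) P i j) fv.
  by move=> i; rewrite PE; apply: eq_bigr => j _; rewrite mxE.
have vQ : fv =1 comb (\matrix_(i, j) Q i j) w.
  by move=> i; rewrite QE; apply: eq_bigr => j _; rewrite mxE.
have nn : n%:R = n'%:R :> F.
  have lid : linear (@id (Ind t m)) by [].
  have := @trace_basis F (Ind t m) id n n' fv w _ _ 1%:M 1%:M lid ifv iw wP vQ.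
  by rewrite !mxtrace1 => e; apply: e => i; rewrite comb1.
apply: inL_eq.
- by apply: inLD => //; apply: inLN; exact: (theta_inL solv ph).
- by apply: inLD => //; apply: inLN; exact: (theta_inL solv pt).
move=> z z0; have [A [Az Atr]] := vz z z0; have [B [Bz Btr]] := wz z z0.
have := @trace_basis F (Ind t m) (act z) n n' fv w _ _ A B (act_linr z) ifv iw wP vQ _ Bz.
rewrite Atr Btr -nn => e; apply: (mulfI (x := n%:R)); first by rewrite pnatr_eq0 -lt0n.
by apply: e => i; rewrite /fv -af Az f_sum.
Qed.

(** With v the vacuum of I_h(l), the vector xv is odd, of weight l + theta_h + w = l + theta_t by
    [adjacent_tau]. K and x kill it because theta_h vanishes on [a,x] for a in H and on [x,x]. It is
    nonzero since yxv = l([x,y]) v = v for the dual vector y. *)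
Lemma adjacent_iso l h x w : inL l -> polarization l h -> x \in g1 -> x \notin (h :&: g1)%VS ->
  l (br x x) = 0 -> inL w -> eigen (h :&: g1 :&: perp l <[x]>) x w ->
  parity_iso (Ih (g0 + adjacent l (h :&: g1) x) l) (Ih h l).
Proof.
move=> Ll ph x1 xH xx Lw ex; have [gH mH hE] := polarization_gmod ph; have [_ _ h0 _] := ph.
have gA : gmod (adjacent l (h :&: g1) x) := adjacent_gmod Ll gH mH x1 ex.
have mA : max_isotropic l (adjacent l (h :&: g1) x) := adjacent_max_isotropic Ll gH mH x1 xH xx ex.
set t := (g0 + _)%VS; have pt : polarization l t by apply: gmod_polarization.
have tE : (t :&: g1)%VS = adjacent l (h :&: g1) x by apply: add0_cap; apply: gA.1.
have t0 : (g0 <= t)%VS by apply: addvSl.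
have polD k : polarization l k -> polarization (l + theta k) k.
  by move=> pk; rewrite -[theta k]scale1r; apply: polarization_theta.
have LD k : polarization l k -> inL (l + theta k).
  by move=> pk; apply: inLD => //; exact: (theta_inL solv pk).
have eH : eigen (h :&: g1) x w by move=> z z0; apply: (subvP (capvSl _ (perp l <[x]>))); apply: ex.
have hw u : u \in g0 -> tau (h :&: g1) u = 0 -> (l + theta h) u = l u.
  by move=> u0 e; rewrite lfunE /= theta_tau // e mulr0 oppr0 addr0.
have [y yH xy] := adjacent_pair gH mH x1 xH xx.
have y1 := gmod_odd gH yH.
have vH a : a \in (h :&: g1)%VS -> act a (vac h (l + theta h)) = 0 by apply: vac_odd.
have v0 z : z \in g0 -> act z (vac h (l + theta h)) = (l + theta h) z *: vac h (l + theta h).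
  by apply: vac_weight; apply: polD.
apply: (@frobenius_iso _ _ _ true (act x (vac h (l + theta h)))).
- exact: (ind_irreducible solv (LD _ pt) (polD _ pt)).
- exact: (ind_irreducible solv (LD _ ph) (polD _ ph)).
- by have := act_mgr x1 (vac_even h (l + theta h)).
- move=> e; have : act y (act x (vac h (l + theta h))) = 0 by rewrite e act0r.
  rewrite act_odd // (vH _ yH) act0r subr0 v0 ?br11 // hw ?br11 //; last exact: (tau_eigen gH x1
    xH eH yH).
  by rewrite (brC1 y1 x1) xy scale1r; exact: (vac_neq0 solv (LD _ ph) (polD _ ph)).
- case=> u ut ua; last first.
    rewrite (act_even _ ua x1) v0 // actZr.
    have -> : br u x = (br u x - w u *: x) + w u *: x by rewrite subrK.
    rewrite actDl (vH (br u x - _)) ?eH // add0r actZl -scalerDl; congr (_ *: _).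
    rewrite !lfunE /= !theta_tau ?tE // (adjacent_tau Ll gH mH x1 xH xx ex ua).
    by field.
  rewrite scale0r; have : u \in adjacent l (h :&: g1) x by rewrite -tE memv_cap ut.
  case/memv_add_line=> a aK [c ->]; have /andP[aH ax] : (a \in h :&: g1)%VS && (a \in perp l <[x]>).
    by rewrite -memv_cap.
  have a1 := gmod_odd gH aH.
  rewrite actDl actZl act_odd // (vH a aH) act0r subr0 v0 ?br11 // hw ?br11 //; last first.
    exact: (tau_eigen gH x1 xH eH aH).
  rewrite (brC1 a1 x1) (perp_orth (memv_line x) ax) scale0r add0r act_sq // v0 ?br11 //.
  rewrite hw ?br11 //; last exact: (tau_eigen_sq gH x1 xH eH).
  by rewrite xx scale0r !scaler0.
Qed.

(** Let H and T be the odd parts and x an eigenvector of T modulo their intersection. T being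
    isotropic, that intersection is orthogonal to x, so the adjacent polarization contains it
    together with x and is closer to T. *)
Lemma polarization_independence l h t : inL l -> polarization l h -> polarization l t ->
  parity_iso (Ih h l) (Ih t l).
Proof.
move=> Ll + pt; have [gT mT tE] := polarization_gmod pt.
have [n] := ubnP (\dim (t :&: g1) - \dim (h :&: g1 :&: (t :&: g1))).
elim: n h => // n IH h; rewrite ltnS => dn ph; have [gH mH hE] := polarization_gmod ph.
have [TH|nTH] := boolP (t :&: g1 <= h :&: g1)%VS.
  have -> : h = t by rewrite hE tE (mT.2 _ mH.1 TH).
  exact: parity_iso_refl.
have gHT := gmod_cap gH gT.
have [|x [w [xT xHT ex Lw]]] := gmod_eigen solv gHT gT.
  by apply: contra nTH => s; apply: subv_trans s (capvSl _ _).
have x1 := gmod_odd gT xT.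
have xH : x \notin (h :&: g1)%VS by apply: contra xHT => xH; rewrite memv_cap xH.
have xx : l (br x x) = 0 by apply: mT.1.2.
have HTK : (h :&: g1 :&: (t :&: g1) <= h :&: g1 :&: perp l <[x]>)%VS.
  rewrite subv_cap capvSl; apply/subvP => a; rewrite memv_cap => /andP[aH aT].
  apply/perpP; split; first exact: gmod_odd gH aH.
  by move=> _ /vlineP[c ->]; rewrite brZl homvZ [l (br x a)]mT.1.2 // mulr0.
have eK : eigen (h :&: g1 :&: perp l <[x]>) x w by move=> z z0; apply: (subvP HTK); apply: ex.
apply: parity_iso_trans (parity_iso_sym (adjacent_iso Ll ph x1 xH xx Lw eK)) _.
have gA : gmod (adjacent l (h :&: g1) x) := adjacent_gmod Ll gH mH x1 eK.
have mA : max_isotropic l (adjacent l (h :&: g1) x) := adjacent_max_isotropic Ll gH mH x1 xH xx eK.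
apply: IH; last exact: gmod_polarization.
rewrite add0_cap ?gA.1 //; apply: leq_trans dn.
have lt1 : (\dim (h :&: g1 :&: (t :&: g1)) < \dim (adjacent l (h :&: g1) x :&: (t :&: g1)))%N.
  rewrite -(dim_add_line xHT); apply: dimvS; rewrite subv_add.
  apply/andP; split; last by rewrite -memvE memv_cap xT (subvP (addvSr _ _)) ?memv_line.
  by apply/subvP => a aHT; rewrite memv_cap (subvP (subv_trans HTK (addvSl _ _))) // (subvP
    (capvSr _ _) _ aHT).
have le2 : (\dim (adjacent l (h :&: g1) x :&: (t :&: g1)) <= \dim (t :&: g1))%N.
  by apply: dimvS; apply: capvSr.
by apply: ltn_sub2l => //; apply: leq_trans lt1 le2.
Qed.

End Solvable.
End Isomorphisms.

(** * Classification *)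

Section Classification.
Variables (F : numClosedFieldType) (g : lieSuperalg F).
Implicit Types (h t H : {vspace g}) (l m : 'Hom(g, F^o)).
Local Notation g0 := (gr g false).
Local Notation g1 := (gr g true).
Hypothesis solv : solvable_lsa g.

Lemma dim_hyperplane (K K' : {vspace g}) x (phi : 'Hom(g, F^o)) : x \in K -> phi x = 1 ->
  (forall y, y \in K' <-> y \in K /\ phi y = 0) -> \dim K = (\dim K').+1.
Proof.
move=> xK px KP; have xK' : x \notin K'.
  by apply/negP => /KP[_]; rewrite px => /eqP; rewrite oner_eq0.
rewrite -(dim_add_line xK'); congr (\dim _); apply/eqP; rewrite eqEsubv subv_add -memvE xK andbT.
apply/andP; split; last by apply/subvP => y /KP[].
apply/subvP => y yK; have -> : y = (y - phi y *: x) + phi y *: x by rewrite subrK.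
apply: add_line_mem; apply/KP; split; first by rewrite memvB ?memvZ.
by rewrite homvB homvZ px mulr1 subrr.
Qed.

(** In coordinates the radical is the kernel of the Gram matrix. *)
Lemma radical_dim l : (rk_fform l + \dim (perp l g1) = \dim g1)%N.
Proof.
rewrite /rk_fform; set G := \matrix_(i, j) _; set R := perp l g1.
pose b (i : 'I_(\dim g1)) := (vbasis g1)`_i; pose r (i : 'I_(\dim R)) := (vbasis R)`_i.
have b1 i : b i \in g1 by apply/vbasis_mem/memt_nth.
have rR i : r i \in R by apply/vbasis_mem/memt_nth.
pose Rm := \matrix_(i < \dim R, j < \dim g1) coord (vbasis g1) j (r i).
have rE i : r i = comb Rm b i.
  by rewrite {1}(coord_vbasis (perp_odd (rR i))); apply: eq_bigr => j _; rewrite mxE.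
have GE (u : 'rV_(\dim g1)) k : (u *m G) 0 k = l (br (\sum_j u 0 j *: b j) (b k)).
  rewrite mxE; elim/big_ind2: _ => [|x1 x2 y1 y2 -> ->|j _]; first by rewrite br0l linear0.
    by rewrite brDl homvD.
  by rewrite mxE brZl homvZ.
have kerR : (kermx G :=: Rm)%MS.
  apply/eqmxP/andP; split; apply/rV_subP => u.
    move/sub_kermxP => uG; pose x := \sum_j u 0 j *: b j.
    have x1 : x \in g1 by apply: memv_suml => j _; rewrite memvZ // b1.
    have xR : x \in R.
      apply/perpP; split=> // y y1; rewrite (brC1 y1 x1) (coord_vbasis y1).
      elim/big_ind: _ => [|y2 y3 e2 e3|k _]; first by rewrite br0r linear0.
        by rewrite brDr homvD e2 e3 addr0.
      by rewrite brZr homvZ -GE uG mxE mulr0.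
    apply/submxP; exists (\row_i coord (vbasis R) i x).
    apply: (comb_inj (vbasis_independent (U := g1))) => i; rewrite ord1 comb_mul.
    transitivity x; first by [].
    by rewrite {1}(coord_vbasis xR); apply: eq_bigr => j _; rewrite mxE -rE.
  case/submxP => D ->; apply/sub_kermxP; apply/matrixP => i k; rewrite ord1 [RHS]mxE GE.
  have -> : \sum_j (D *m Rm) 0 j *: b j = \sum_j D 0 j *: r j.
    by rewrite -/(comb (D *m Rm) b 0) comb_mul; apply: eq_bigr => j _; rewrite -rE.
  have xR : \sum_j D 0 j *: r j \in R by apply: memv_suml => j _; rewrite memvZ.
  by rewrite (brC1 (perp_odd xR) (b1 k)); apply: perp_orth xR; apply: b1.
have free : row_free Rm.
  rewrite -kermx_eq0; apply/eqP/row_matrixP => i; rewrite row0; set u := row i _.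
  have uR : u *m Rm = 0 by apply/sub_kermxP; apply: row_sub.
  apply: (comb_inj (vbasis_independent (U := R))) => j; rewrite ord1.
  rewrite [RHS]big1 => [|k _]; last by rewrite mxE scale0r.
  transitivity (comb (u *m Rm) b 0); last by rewrite uR [LHS]big1 // => k _; rewrite mxE scale0r.
  by rewrite comb_mul; apply: eq_bigr => k _; rewrite -rE.
have := mxrank_ker G; rewrite kerR (eqP free) => ->.
by rewrite subnKC // rank_leq_row.
Qed.

(** Along a flag s from [perp l H] to g1, each step adds a dimension above and removes one from the
    orthogonal in H. This orthogonal ends at the radical, so the rank is 2 |s| + dim (perp l H) -
    dim H. *)
Lemma rank_parity l H : inL l -> gmod H -> max_isotropic l H ->
  odd (rk_fform l) = (perp l H != H).
Proof.
move=> Ll gH mH; have gP := gmod_perp Ll gH; have HP := max_isotropic_sub mH.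
have [s [fs sE]] := flag_exists solv gP (gmod1 g) gP.1.
have d1 u : is_flag (perp l H) u -> \dim (flag_top (perp l H) u) = (\dim (perp l H) + size u)%N.
  elim: u => [|[y w] u IH] /=; first by rewrite addn0.
  by case=> fu _ yu _; rewrite dim_add_line // IH // addnS.
have d2 u : is_flag (perp l H) u ->
    (\dim (H :&: perp l (flag_top (perp l H) u)) + size u = \dim H)%N.
  elim: u => [_|[y w] u IH] /=.
    rewrite addn0; congr (\dim _); apply/capv_idPl/subvP => x xH; apply/perpP.
    have x1 := gmod_odd gH xH; split=> // r rP.
    by rewrite (brC1 (perp_odd rP) x1); apply: perp_orth rP.
  move=> [fu y1 yu ey]; rewrite -(IH fu); have gY := gmod_flag gP fu.
  have [x [xH xY xy]] := flag_dual fu y1 yu; have x1 := gmod_odd gH xH.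
  have [|phi phiE] := @hom_of_linear F g (fun r => l (br r y)).
    by move=> c r r'; rewrite brDl brZl homvD homvZ.
  rewrite addnS -addSn; congr (_ + _)%N; symmetry.
  apply: (@dim_hyperplane _ _ x phi); last 1 first.
  - move=> r; rewrite !memv_cap; split=> [/andP[rH rP]|[/andP[rH rP] e]].
      rewrite rH /= phiE; split; last first.
        rewrite (brC1 (gmod_odd gH rH) y1); apply: perp_orth rP.
        by rewrite (subvP (addvSr _ _)) // memv_line.
      apply/perpP; split; first exact: perp_odd rP.
      by move=> a aY; apply: perp_orth rP; apply: (subvP (addvSl _ _)).
    rewrite rH; have r1 := gmod_odd gH rH; apply/perpP; split=> // _ /memv_add_line[a aY [c ->]].
    rewrite brDl brZl homvD homvZ (perp_orth aY rP) (brC1 y1 r1); move: e; rewrite phiE => ->.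
    by rewrite mulr0 addr0.
  - rewrite memv_cap xH; apply/perpP; split=> // r rY.
    by rewrite (brC1 (gmod_odd gY rY) x1) xY.
  - by rewrite phiE.
have RH : (H :&: perp l g1 = perp l g1)%VS.
  apply/capv_idPr/subvP => r rR; have r1 := perp_odd rR.
  apply: (max_isotropic_perp mH); last exact: perp_orth r1 rR.
  apply/perpP; split=> // x xH; exact: perp_orth (gmod_odd gH xH) rR.
have e1 := d1 s fs; have e2 := d2 s fs; rewrite sE in e1; rewrite sE RH in e2.
have := radical_dim l; rewrite e1.
have [PH|[y [yH PE _ _]]] := perp_cases Ll gH mH.
  rewrite PH eqxx -e2 -addnA [LHS]addnC => /addnI ->.
  by rewrite addnn odd_double.
have -> : (perp l H != H).
  by apply: contraNneq yH => e; rewrite -e PE (subvP (addvSr _ _)) // memv_line.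
rewrite PE dim_add_line // -e2 addSn -addnA -addnS [LHS]addnC => /addnI ->.
by rewrite addnn /= odd_double.
Qed.

(* A weight vector of the even part killed by a submodule k of the odd part of maximal
   dimension: by isotropic_extend, k is then maximal isotropic for the weight. *)
Lemma singular_vector_exists (V : supermod g) : fin_dim V -> (exists u : V, u != 0) ->
  exists (b : bool) (v : V) (chi : 'Hom(g, F^o)) (k : {vspace g}),
    [/\ mgr V b v, v <> 0 & inL chi] /\
    [/\ forall z, z \in g0 -> act z v = chi z *: v, gmod k, forall x, x \in k -> act x v = 0
      & max_isotropic chi k].
Proof.
move=> [n [e eE]] [u u0]; have [m sm] := solv; have repV := supermod_is_rep V fullv.
have [b [w wb w0]] : exists b, exists2 w, mgr V b w & w <> 0.
  have [u1 [u2 [h1 h2 uE]]] := mgr_add u.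
  have [u10|u10] := eqVneq u1 0; last by exists false, u1 => //; apply/eqP.
  by exists true, u2 => // u20; move: u0; rewrite uE u10 u20 addr0 eqxx.
have s0 : subspace (fun x : V => x = 0).
  by split=> // c x y -> ->; rewrite scaler0 addr0.
have [||||||||||v [vb v0 ev]] := @lie_eigenvector F g V (@act F g V) (@act_linr F g V) (@act_linl
  F g V) _
    _ s0 m g0 (mgr V b) w.
- by move=> x y u' x0 y0; rewrite (act_br u' x0 y0) expr0 scale1r.
- exact: subvv.
- exact: br00.
- by apply/eqP; rewrite -subv0 -sm; apply: iter_brvS; apply: subvf.
- by move=> a v a0 ->; rewrite act0r.
- exact: mgr_subspace.
- by move=> a v a0 vb; have := act_mgr a0 vb.
- by exists n, e => v _; have [c ->] := eE v; exists c; rewrite subrr.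
- exact: wb.
- exact: w0.
have /choice[c cE] z : exists c, act (even_part z) v = c *: v.
  by have [c /eqP] := ev _ (even_part_in z); rewrite subr_eq0 => /eqP; exists c.
have [|chi chiE] := @hom_of_linear F g c.
  move=> d x y; apply/eqP; rewrite -subr_eq0; apply/eqP.
  have : (c (d *: x + y) - (d * c x + c y)) *: v = 0.
    rewrite scalerBl scalerDl -scalerA -!cE.
    have -> : even_part (d *: x + y) = d *: even_part x + even_part y by exact: linearP.
    by rewrite actDl actZl subrr.
  by move/eqP; rewrite scaler_eq0 => /orP[/eqP//|/eqP].
have chiv z : z \in g0 -> act z v = chi z *: v.
  by move=> z0; rewrite chiE -cE even_part_id.
have weight_inL (x : V) (chi' : 'Hom(g, F^o)) : x <> 0 -> (forall z, z \in g0 -> act z x = chi' z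
  *: x) ->
    forall y z, y \in g0 -> z \in g0 -> chi' (br y z) = 0.
  move=> x0 chix y z y0 z0; have /eqP := act_br x y0 z0.
  rewrite expr0 scale1r (chix y y0) (chix z z0) (chix _ (br00 y0 z0)) !actZr (chix y y0) (chix z
    z0).
  by rewrite !scalerA mulrC subrr scaler_eq0 => /orP[/eqP//|/eqP].
have Lchi : inL chi.
  split=> [x x1|]; last exact: weight_inL chiv.
  rewrite chiE; have /eqP := cE x; rewrite even_part0 // (rep0l repV) eq_sym scaler_eq0.
  by move=> /orP[/eqP//|/eqP].
apply: contrapT => none.
suff ext d : exists (b' : bool) (x : V) (chi' : 'Hom(g, F^o)) (k : {vspace g}),
    [/\ mgr V b' x, x <> 0 & inL chi'] /\
    [/\ forall z, z \in g0 -> act z x = chi' z *: x, gmod k, forall a, a \in k -> act a x = 0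
      & (d <= \dim k)%N].
  have [b' [x [chi' [k [_ [_ _ _]]]]]] := ext (\dim {:g}).+1.
  by rewrite ltnNge dimvS //; apply: subvf.
elim: d => [|d [b' [x [chi' [k [[xb x0 L'] [chix gk kx dk]]]]]]].
  exists b, v, chi, 0%VS; split; split=> //; first exact: gmod0.
  by move=> a; rewrite memv0 => /eqP ->; rewrite (rep0l repV).
(* [p,q] acts on x by chi'([p,q]), and by 0 because p and q kill x. *)
have ik : isotropic chi' k.
  split; first exact: gk.1.
  move=> p q pk qk; have p1 := gmod_odd gk pk; have q1 := gmod_odd gk qk.
  have /eqP := act_odd x p1 q1; rewrite (kx p pk) (kx q qk) !act0r subr0 chix ?br11 //.
  by rewrite eq_sym scaler_eq0 => /orP[/eqP//|/eqP].
have nmax : ~ max_isotropic chi' k by move=> mk; apply: none; exists b', x, chi', k.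
have [y [w' [y1 yk ey Lw [_ iy]]]] := isotropic_extend solv L' gk ik nmax.
have yy : y \in (k + <[y]>)%VS by rewrite (subvP (addvSr _ _)) // memv_line.
have gk' := gmod_add_line gk y1 ey.
have dk' : (d < \dim (k + <[y]>))%N by rewrite dim_add_line.
(* If y kills x, then x is kept. Otherwise yx has weight chi' + w' and is killed by k + <y>, because
   chi' vanishes on [a,y] for a in k and on [y,y]. *)
have [yx|yx] := pselect (act y x = 0).
  exists b', x, chi', (k + <[y]>)%VS; split; split=> // _ /memv_add_line[a ak [f ->]].
  by rewrite actDl actZl kx // yx scaler0 addr0.
exists (~~ b'), (act y x), (chi' + w'), (k + <[y]>)%VS; split; split=> //.
- by have := act_mgr y1 xb; rewrite addTb.
- exact: inLD.
- move=> z z0; rewrite (act_even _ z0 y1) chix // actZr.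
  have -> : br z y = (br z y - w' z *: y) + w' z *: y by rewrite subrK.
  by rewrite actDl (kx (br z y - _)) ?ey // add0r actZl -scalerDl lfunE.
- move=> _ /memv_add_line[a ak [f ->]]; have a1 := gmod_odd gk ak.
  rewrite actDl actZl act_sq // act_odd // (kx a ak) act0r subr0 !chix ?br11 //.
  have -> : chi' (br a y) = 0 :> F by apply: iy => //; apply: (subvP (addvSl _ _)).
  have -> : chi' (br y y) = 0 :> F by apply: iy.
  by rewrite !scale0r !scaler0 addr0.
Qed.

Lemma polarization_thetaN l h : inL l -> polarization l h ->
  inL (l - theta h) /\ polarization (l - theta h) h.
Proof.
move=> Ll ph; split; first by apply: inLD => //; apply: inLN; exact: (theta_inL solv ph).
by rewrite -scaleN1r; apply: polarization_theta.
Qed.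

Lemma polarization_thetaD l h : inL l -> polarization l h ->
  inL (l + theta h) /\ polarization (l + theta h) h.
Proof.
move=> Ll ph; split; first by apply: inLD => //; exact: (theta_inL solv ph).
by rewrite -[theta h]scale1r; apply: polarization_theta.
Qed.

Lemma I_iso l h : inL l -> polarization l h -> parity_iso (Ih h l) (I_ l).
Proof.
by move=> Ll ph; apply: polarization_independence => //; apply: some_polarizationP.
Qed.

(** A singular vector of weight chi identifies V with the module induced from chi, that is, with
    I(chi - theta). *)
Lemma irreducible_classification (V : supermod g) : fin_dim V -> irreducible V ->
  exists2 l, inL l & smod_iso_Pi V (I_ l).
Proof.
move=> fV irrV; have [b [v [chi [k [[vb v0 Lc] [chiv gk kv mk]]]]]] :=
  singular_vector_exists fV irrV.1.
have pk := gmod_polarization Lc gk mk.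
have [Ll pl] := polarization_thetaN Lc pk.
exists (chi - theta (g0 + k)) => //; apply/parity_isoP; apply: parity_iso_sym.
apply: parity_iso_trans (parity_iso_sym (I_iso Ll pl)) _.
rewrite /Ih subrK; apply: (@frobenius_iso _ _ _ _ _ b v) => //.
  exact: (ind_irreducible solv Lc pk).
case=> x xk xa; last exact: chiv.
by rewrite scale0r kv //; apply: add0_odd xk xa; apply: gk.1.
Qed.

Lemma I_irreducible l : inL l -> fin_dim (I_ l) /\ irreducible (I_ l).
Proof.
move=> Ll; have [L' p'] := polarization_thetaD Ll (some_polarizationP solv Ll).
by split; [exact: (ind_fin_dim solv L' p') | exact: (ind_irreducible solv L' p')].
Qed.

(** The invariant of the module induced from l + theta is (l + theta) - theta = l. *)
Lemma I_injective l m : inL l -> inL m -> smod_iso_Pi (I_ l) (I_ m) -> l = m.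
Proof.
move=> Ll Lm /parity_isoP e; have [L' p'] := polarization_thetaD Ll (some_polarizationP solv Ll).
have [M' q'] := polarization_thetaD Lm (some_polarizationP solv Lm).
by have := ind_iso_weight solv L' p' M' q' e; rewrite !addrK.
Qed.

(** The module induced from l is I_h(l - theta_h), so equivalent pairs give I of one parameter for
    two of its polarizations. *)
Lemma ind_iso_equiv l m h t : inZ l h -> inZ m t ->
  smod_iso_Pi (Ind h l) (Ind t m) <-> equivZ l h m t.
Proof.
move=> [Ll ph] [Lm pt]; split=> [/parity_isoP|e]; first exact: ind_iso_weight.
have [Ln pn] := polarization_thetaN Ll ph; have [_ qn] := polarization_thetaN Lm pt.
apply/parity_isoP; have := polarization_independence solv Ln pn (t := t).
by rewrite /Ih subrK (e : l - theta h = m - theta t) subrK; apply.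
Qed.

(** The type is read from l + theta, the rank from l. [perp_tau_sub], applied in both directions,
    shows that the two forms give H the same orthogonal. *)
Lemma I_type l : inL l ->
  (~~ odd (rk_fform l) -> G_type (I_ l)) /\ (odd (rk_fform l) -> Q_type (I_ l)).
Proof.
move=> Ll; have ph := some_polarizationP solv Ll; have [gH mH _] := polarization_gmod ph.
have [L' p'] := polarization_thetaD Ll ph; have [_ mH' _] := polarization_gmod p'.
rewrite (rank_parity Ll gH mH).
have -> : perp l (some_polarization l :&: g1) = perp (l + theta (some_polarization l))
  (some_polarization l :&: g1).
  have [_ _ h0 _] := ph.
  have e z : z \in g0 -> (l + theta (some_polarization l)) z =
      l z + - 2^-1 * tau (some_polarization l :&: g1) z :> F.
    by move=> z0; rewrite lfunE /= theta_tau // mulNr.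
  apply/eqP; rewrite eqEsubv (perp_tau_sub solv L' Ll gH mH' (c := 2^-1)).
    by rewrite (perp_tau_sub solv Ll L' gH mH e).
  by move=> z z0; rewrite e // -addrA -mulrDl addNr mul0r addr0.
split; first by rewrite negbK => /eqP PH; exact: (vac_G_type solv L' p' PH).
move=> nPH; have [PH|[y [yH PE yy zy]]] := perp_cases L' gH mH'; first by rewrite PH eqxx in nPH.
by split; [exact: (ind_irreducible solv L' p') | exact: (vac_Q_subspace solv L' p' PE yy zy)].
Qed.

End Classification.

Theorem mainTheorem1 (R : realType) (g : lieSuperalg R[i]) :
  solvable_lsa g ->
  [/\ (forall V : supermod g, fin_dim V -> irreducible V ->
         exists2 l : 'Hom(g, R[i]^o), inL l & smod_iso_Pi V (I_ l)),
      [/\ (forall l : 'Hom(g, R[i]^o), inL l ->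
             fin_dim (I_ l) /\ irreducible (I_ l)),
          (forall l m : 'Hom(g, R[i]^o), inL l -> inL m ->
             smod_iso_Pi (I_ l) (I_ m) -> l = m)
        & (forall V : supermod g, fin_dim V -> irreducible V ->
             exists2 l : 'Hom(g, R[i]^o), inL l & smod_iso_Pi V (I_ l))],
      (forall (l m : 'Hom(g, R[i]^o)) (h t : {vspace g}),
         inZ l h -> inZ m t ->
         smod_iso_Pi (Ind h l) (Ind t m) <-> equivZ l h m t)
    & (forall l : 'Hom(g, R[i]^o), inL l ->
         (~~ odd (rk_fform l) -> G_type (I_ l)) /\
         (odd (rk_fform l) -> Q_type (I_ l)))].
Proof.
move=> solv; split.
- exact: (irreducible_classification (F := R[i]) solv).
- split.
  + exact: (I_irreducible (F := R[i]) solv).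
  + exact: (I_injective (F := R[i]) solv).
  + exact: (irreducible_classification (F := R[i]) solv).
- exact: (ind_iso_equiv (F := R[i]) solv).
- exact: (I_type (F := R[i]) solv).
Qed.
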